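(* There is a randomized highly parallel algorithm which, given any differentiable $L$-Lipschitz convex $f:\mathbb{R}^d\to\mathbb{R}$ minimized at some $x^*$ with $\|x^*\|\le R$, and $\epsilon,\nu>0$, computes with probability at least $1-\nu$ a point $x\in\mathbb{R}^d$ with $f(x)-f(x^* )\le\epsilon$, using depth $\tilde O\big(d^{1/3}(LR/\epsilon)^{2/3}\big)$ and work $\tilde O\big(d^{4/3}(LR/\epsilon)^{8/3}\big)$, where $\tilde O(\cdot)$ hides factors polylogarithmic in $d,\epsilon,L,R,\nu^{-1}$.
   Context: A highly parallel algorithm interacts with a gradient oracle for $f$ in rounds: in each round it submits a finite set of query points (chosen based on all previous answers and its internal randomness) and receives $\nabla f(x)$ for each query $x$. The depth is the number of rounds; the work is the total number of queries. *)

(* Defs.v *)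
From Stdlib Require Import Reals Lra Lia List Arith.
Open Scope R_scope.

Definition Vec (d : nat) : Type := {i : nat | (i < d)%nat} -> R.

Definition vget {d : nat} (x : Vec d) (i : nat) : R :=
  match Compare_dec.lt_dec i d with
  | left h => x (exist _ i h)
  | right _ => 0
  end.

Definition vadd {d : nat} (x y : Vec d) : Vec d := fun i => x i + y i.
Definition vsub {d : nat} (x y : Vec d) : Vec d := fun i => x i - y i.
Definition vscale {d : nat} (a : R) (x : Vec d) : Vec d := fun i => a * x i.

Fixpoint rsum (n : nat) (g : nat -> R) : R :=
  match n with
  | O => 0
  | S m => rsum m g + g m
  end.

Definition dot {d : nat} (x y : Vec d) : R := rsum d (fun i => vget x i * vget y i).
Definition norm {d : nat} (x : Vec d) : R := sqrt (dot x x).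

Definition is_gradient {d : nat} (f : Vec d -> R) (g : Vec d -> Vec d) : Prop :=
  forall x : Vec d, forall e : R, 0 < e -> exists delta : R, 0 < delta /\
    forall h : Vec d, norm h < delta ->
      Rabs (f (vadd x h) - f x - dot (g x) h) <= e * norm h.

Definition lipschitz {d : nat} (L : R) (f : Vec d -> R) : Prop :=
  forall x y : Vec d, Rabs (f x - f y) <= L * norm (vsub x y).

Definition convex {d : nat} (f : Vec d -> R) : Prop :=
  forall (x y : Vec d) (t : R), 0 <= t <= 1 ->
    f (vadd (vscale t x) (vscale (1 - t) y)) <= t * f x + (1 - t) * f y.

(** Transcript: list of rounds, each round a list of (query point, gradient). *)
Definition history (d : nat) : Type := list (list (Vec d * Vec d)).

(** A randomized highly parallel algorithm with a fixed number of rounds.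
    Internal randomness: a seed n : nat drawn from the (countably supported)
    distribution [weight].  In round t (t = 0, ..., depth-1) the algorithm
    submits the finite query set [query seed t h], where h is the transcript of
    all previous rounds; at the end it outputs [output seed h]. *)
Record ParAlg (d : nat) : Type := {
  depth : nat;
  weight : nat -> R;
  weight_nonneg : forall n, 0 <= weight n;
  weight_total : infinite_sum weight 1;
  query : nat -> nat -> history d -> list (Vec d);
  output : nat -> history d -> Vec d
}.
Arguments depth {d}.
Arguments weight {d}.
Arguments query {d}.
Arguments output {d}.

Fixpoint run {d : nat} (A : ParAlg d) (s : nat) (g : Vec d -> Vec d) (t : nat)
  : history d :=
  match t with
  | O => nil
  | S t' => let h := run A s g t' in
            h ++ (map (fun x => (x, g x)) (query A s t' h)) :: nil
  end.

Definition final_history {d : nat} (A : ParAlg d) (s : nat) (g : Vec d -> Vec d)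
  : history d := run A s g (depth A).

Definition work {d : nat} (A : ParAlg d) (s : nat) (g : Vec d -> Vec d) : nat :=
  fold_right (fun r acc => (length r + acc)%nat) 0%nat (final_history A s g).

Definition alg_output {d : nat} (A : ParAlg d) (s : nat) (g : Vec d -> Vec d) : Vec d :=
  output A s (final_history A s g).

Definition prob_le {d : nat} (A : ParAlg d) (bad : nat -> Prop) (p : R) : Prop :=
  forall l : list nat, NoDup l -> (forall n, In n l -> bad n) ->
    fold_right (fun n acc => weight A n + acc) 0 l <= p.

Definition logfactor (d : nat) (L R0 eps nu : R) : R :=
  1 + ln (2 + INR d) + Rabs (ln L) + Rabs (ln R0) + Rabs (ln eps) + ln (2 + / nu).

(* Main.v *)
Require Import Defs.
From Stdlib Require Import Reals List Lra Lia ZArith Psatz Classical ClassicalEpsilon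
  FunctionalExtensionality ProofIrrelevance.
Open Scope R_scope.

(** Smooth [f] at scale [sigma ~ eps / (L sqrt d)] by a discrete Gaussian on a fine lattice.
    Gradients sampled around one point [q] estimate, after importance reweighting, the
    smoothed gradient simultaneously at all lattice points within distance
    [r ~ sigma / polylog] of [q]: the likelihood ratio of two such Gaussians is bounded up to
    a negligible mass, so truncating it costs little bias, and Hoeffding's inequality with a
    union bound over lattice points and directions needs only [d (L R / eps)^2] samples up to
    logarithms. One round therefore implements an oracle minimising the smoothed function over
    a ball of radius [r], and accelerated proximal steps with that oracle reach accuracy [eps]
    in [(R / r)^(2/3) ~ d^(1/3) (L R / eps)^(2/3)] rounds. A lattice is used because seeds have
    countable support; the gradient of the smoothing is nearly constant between neighbouring
    lattice points, and stationarity is only ever needed at lattice points. *)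

(** * Euclidean vectors *)

(** Two obstacles shape the argument. The multiplier of a proximal step is known only after the
    oracle has answered, and searching for it would cost rounds; the acceleration therefore commits
    to a guess, damps the step when the guess was too low, and counts rounds by a Lyapunov function
    that gains 1 per step. Moreover the point wanted is defined by the unknown smoothed function. So
    the ball constraint becomes a radial penalty, whose multiplier is an explicit function of the
    distance: minimising the true penalised function proves that a nearly stationary lattice point
    exists, while the algorithm takes any point whose estimated penalised gradient is small. Two
    free scales carry the costs. With [sigma / r = sqrt (m + 1)] and [m] logarithmic, the moment of
    order [m + 1] of the likelihood ratio is at most exponential in [m] in every dimension, so
    truncation at a constant leaves a bias exponentially small in [m]. The lattice spacing affects
    the sample size only through the logarithm of the number of lattice points; it may be
    polynomially fine, which absorbs the [sqrt d] lost by bounding gradients one coordinate at a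
    time. *)

Lemma rsum_ext n a b :
  (forall i, (i < n)%nat -> a i = b i) -> rsum n a = rsum n b.
Proof.
  induction n as [|n IH]; intros H; simpl; [reflexivity|].
  rewrite IH by (intros; apply H; lia). rewrite H by lia. reflexivity.
Qed.

Lemma rsum_plus n a b : rsum n (fun i => a i + b i) = rsum n a + rsum n b.
Proof. induction n as [|n IH]; simpl; [lra|rewrite IH; lra]. Qed.

Lemma rsum_scal n c a : rsum n (fun i => c * a i) = c * rsum n a.
Proof. induction n as [|n IH]; simpl; [lra|rewrite IH; lra]. Qed.

Lemma rsum_le n a b :
  (forall i, (i < n)%nat -> a i <= b i) -> rsum n a <= rsum n b.
Proof.
  induction n as [|n IH]; intros H; simpl; [lra|].
  apply Rplus_le_compat; [apply IH; intros; apply H; lia|apply H; lia].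
Qed.

Lemma rsum_const n c : rsum n (fun _ => c) = INR n * c.
Proof. induction n as [|n IH]; [simpl; lra|]. simpl rsum. rewrite IH, S_INR. lra. Qed.

Lemma rsum_nonneg n a : (forall i, (i < n)%nat -> 0 <= a i) -> 0 <= rsum n a.
Proof.
  intros H. replace 0 with (rsum n (fun _ => 0)) by (rewrite rsum_const; lra).
  now apply rsum_le.
Qed.

Lemma rsum_term_le n a i :
  (forall j, (j < n)%nat -> 0 <= a j) -> (i < n)%nat -> a i <= rsum n a.
Proof.
  induction n as [|n IH]; intros H Hi; [lia|]. simpl.
  destruct (Nat.eq_dec i n) as [->|Hne].
  - assert (0 <= rsum n a) by (apply rsum_nonneg; intros; apply H; lia). lra.
  - assert (a i <= rsum n a) by (apply IH; [intros; apply H; lia|lia]).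
    assert (0 <= a n) by (apply H; lia). lra.
Qed.

Lemma rsum_split a b c : rsum (a + b) c = rsum a c + rsum b (fun i => c (a + i)%nat).
Proof.
  induction b as [|b IH]; [rewrite Nat.add_0_r; simpl; lra|].
  rewrite Nat.add_succ_r. simpl. rewrite IH. lra.
Qed.

Definition mkv (d : nat) (a : nat -> R) : Vec d := fun i => a (proj1_sig i).

Lemma vget_mkv d a i : (i < d)%nat -> vget (mkv d a) i = a i.
Proof.
  intros H. unfold vget, mkv. destruct (Compare_dec.lt_dec i d); [reflexivity|lia].
Qed.

Lemma vget_add {d} (x y : Vec d) i : vget (vadd x y) i = vget x i + vget y i.
Proof. unfold vget, vadd. destruct (Compare_dec.lt_dec i d); lra. Qed.

Lemma vget_sub {d} (x y : Vec d) i : vget (vsub x y) i = vget x i - vget y i.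
Proof. unfold vget, vsub. destruct (Compare_dec.lt_dec i d); lra. Qed.

Lemma vget_scale {d} a (x : Vec d) i : vget (vscale a x) i = a * vget x i.
Proof. unfold vget, vscale. destruct (Compare_dec.lt_dec i d); lra. Qed.

Lemma vec_ext {d} (x y : Vec d) :
  (forall i, (i < d)%nat -> vget x i = vget y i) -> x = y.
Proof.
  intros H. apply functional_extensionality. intros [i h].
  specialize (H i h). unfold vget in H.
  destruct (Compare_dec.lt_dec i d) as [h'|]; [|lia].
  now rewrite (proof_irrelevance _ h h').
Qed.

Ltac vec_ring :=
  apply vec_ext; intros;
  repeat (rewrite vget_add || rewrite vget_sub || rewrite vget_scale); try ring.

Lemma dot_comm {d} (x y : Vec d) : dot x y = dot y x.
Proof. apply rsum_ext; intros; ring. Qed.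

Lemma dot_add_l {d} (x y z : Vec d) : dot (vadd x y) z = dot x z + dot y z.
Proof.
  unfold dot. rewrite <- rsum_plus. apply rsum_ext. intros.
  rewrite vget_add. ring.
Qed.

Lemma dot_scale_l {d} a (x z : Vec d) : dot (vscale a x) z = a * dot x z.
Proof.
  unfold dot. rewrite <- rsum_scal. apply rsum_ext. intros.
  rewrite vget_scale. ring.
Qed.

Lemma dot_sub_l {d} (x y z : Vec d) : dot (vsub x y) z = dot x z - dot y z.
Proof.
  replace (vsub x y) with (vadd x (vscale (-1) y)) by vec_ring.
  rewrite dot_add_l, dot_scale_l. ring.
Qed.

Lemma dot_add_r {d} (x y z : Vec d) : dot x (vadd y z) = dot x y + dot x z.
Proof. rewrite dot_comm, dot_add_l, (dot_comm y), (dot_comm z). reflexivity. Qed.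

Lemma dot_sub_r {d} (x y z : Vec d) : dot x (vsub y z) = dot x y - dot x z.
Proof. rewrite dot_comm, dot_sub_l, (dot_comm y), (dot_comm z). reflexivity. Qed.

Lemma dot_scale_r {d} a (x y : Vec d) : dot x (vscale a y) = a * dot x y.
Proof. rewrite dot_comm, dot_scale_l, dot_comm. reflexivity. Qed.

Ltac dot_expand :=
  repeat (rewrite dot_add_l || rewrite dot_sub_l || rewrite dot_scale_l ||
          rewrite dot_add_r || rewrite dot_sub_r || rewrite dot_scale_r).

Lemma dot_self_nonneg {d} (x : Vec d) : 0 <= dot x x.
Proof. apply rsum_nonneg. intros. nra. Qed.

Lemma norm_nonneg {d} (x : Vec d) : 0 <= norm x.
Proof. apply sqrt_pos. Qed.

Lemma norm_sqr {d} (x : Vec d) : norm x * norm x = dot x x.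
Proof. apply sqrt_sqrt, dot_self_nonneg. Qed.

Lemma norm_le_iff {d} (x : Vec d) c : 0 <= c -> norm x <= c <-> dot x x <= c * c.
Proof.
  intros Hc. rewrite <- norm_sqr. pose proof (norm_nonneg x). split; intros; nra.
Qed.

Lemma dot_le_norm {d} (x y : Vec d) : dot x y <= norm x * norm y.
Proof.
  pose proof (norm_nonneg x) as Hx. pose proof (norm_nonneg y) as Hy.
  pose proof (dot_self_nonneg (vsub (vscale (norm y) x) (vscale (norm x) y))) as H.
  revert H. dot_expand. rewrite <- !norm_sqr, (dot_comm y x). intros H.
  destruct (Req_dec (norm x * norm y) 0) as [H0|H0].
  - apply Rmult_integral in H0. rewrite Rmult_comm.
    destruct (Rle_or_lt (dot x y) 0) as [|Hd]; [destruct H0 as [E|E]; rewrite E; lra|].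
    exfalso. destruct H0 as [E|E].
    (* With [norm x = 0] the quadratic term vanishes, and this coefficient would make the square
       equal to [- norm y ^ 2 - 2]. *)
    + pose proof (dot_self_nonneg (vsub y (vscale ((norm y * norm y + 1) / dot x y) x))) as H1.
      revert H1. dot_expand. rewrite <- !norm_sqr, (dot_comm y x), E. intros H1.
      assert ((norm y * norm y + 1) / dot x y * dot x y = norm y * norm y + 1) by (field; lra).
      nra.
    + pose proof (dot_self_nonneg (vsub x (vscale ((norm x * norm x + 1) / dot x y) y))) as H1.
      revert H1. dot_expand. rewrite <- !norm_sqr, (dot_comm y x), E. intros H1.
      assert ((norm x * norm x + 1) / dot x y * dot x y = norm x * norm x + 1) by (field; lra).
      nra.
  - assert (0 < norm x * norm y) by nra. nra.
Qed.

Lemma norm_scale {d} a (x : Vec d) : norm (vscale a x) = Rabs a * norm x.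
Proof.
  unfold norm. rewrite dot_scale_l, dot_scale_r, <- Rmult_assoc.
  rewrite sqrt_mult by (try apply dot_self_nonneg; nra).
  f_equal. apply sqrt_Rsqr_abs.
Qed.

Lemma dot_abs_le_norm {d} (x y : Vec d) : Rabs (dot x y) <= norm x * norm y.
Proof.
  apply Rabs_le. split; [|apply dot_le_norm].
  pose proof (dot_le_norm (vscale (-1) x) y) as H.
  rewrite dot_scale_l, norm_scale, Rabs_left in H by lra. lra.
Qed.

Lemma norm_triang {d} (x y : Vec d) : norm (vadd x y) <= norm x + norm y.
Proof.
  pose proof (norm_nonneg x). pose proof (norm_nonneg y).
  apply norm_le_iff; [lra|]. dot_expand. rewrite <- !norm_sqr, (dot_comm y x).
  pose proof (dot_le_norm x y). lra.
Qed.

Lemma norm_vget {d} (x : Vec d) i : (i < d)%nat -> Rabs (vget x i) <= norm x.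
Proof.
  intros Hi. pose proof (norm_nonneg x).
  assert (vget x i * vget x i <= norm x * norm x).
  { rewrite norm_sqr. unfold dot.
    apply (rsum_term_le d (fun i => vget x i * vget x i)); [intros; nra|exact Hi]. }
  apply Rabs_le. nra.
Qed.

Lemma norm_dim0 {d} (x : Vec d) : d = 0%nat -> norm x = 0.
Proof. intros ->. apply sqrt_0. Qed.

Lemma norm_le_coord {d} (x : Vec d) c :
  0 <= c -> (forall i, (i < d)%nat -> Rabs (vget x i) <= c) ->
  norm x <= sqrt (INR d) * c.
Proof.
  intros Hc H. pose proof (pos_INR d). pose proof (sqrt_pos (INR d)).
  apply norm_le_iff; [nra|].
  replace (sqrt (INR d) * c * (sqrt (INR d) * c))
    with (sqrt (INR d) * sqrt (INR d) * (c * c)) by ring.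
  rewrite sqrt_sqrt by lra. rewrite <- rsum_const. apply rsum_le.
  intros i Hi. specialize (H i Hi). pose proof (Rle_abs (vget x i)). pose proof (Rle_abs (- vget x i)) as H4.
  rewrite Rabs_Ropp in H4. nra.
Qed.

(** * Gradients of convex Lipschitz functions *)

Lemma gradient_inequality {d} (f : Vec d -> R) g :
  is_gradient f g -> convex f ->
  forall x y, f x + dot (g x) (vsub y x) <= f y.
Proof.
  intros Hg Hc x y. apply Rnot_lt_le. intros Hlt.
  set (h := vsub y x) in *. set (c := f x + dot (g x) h - f y).
  assert (0 < c) by (unfold c; lra). pose proof (norm_nonneg h) as Hh.
  (* The [+ 1] covers [h = 0]; the tolerance leaves an error of at most [t * c / 2] at step [t],
     half of the supposed gap. *)
  assert (He : 0 < c / (2 * (norm h + 1))) by (apply Rdiv_lt_0_compat; lra).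
  destruct (Hg x _ He) as (delta & Hd & Hdelta).
  set (t := Rmin 1 (delta / (2 * (norm h + 1)))).
  assert (Ht0 : 0 < t).
  { unfold t. apply Rmin_glb_lt; [lra|]. apply Rdiv_lt_0_compat; lra. }
  assert (Ht1 : t <= 1) by apply Rmin_l.
  assert (Htd : t * (2 * (norm h + 1)) <= delta).
  { replace delta with (delta / (2 * (norm h + 1)) * (2 * (norm h + 1))) by (field; lra).
    apply Rmult_le_compat_r; [lra|]. apply Rmin_r. }
  specialize (Hdelta (vscale t h)). specialize (Hc y x t ltac:(lra)).
  replace (vadd (vscale t y) (vscale (1 - t) x)) with (vadd x (vscale t h)) in Hc
    by (unfold h; vec_ring).
  rewrite norm_scale, (Rabs_pos_eq t), dot_scale_r in Hdelta by lra.
  assert (Hn : t * norm h < delta) by nra. specialize (Hdelta Hn).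
  assert (c / (2 * (norm h + 1)) * (t * norm h) <= t * (c / 2)).
  { replace (t * (c / 2)) with (c / (2 * (norm h + 1)) * (t * (norm h + 1))) by (field; lra).
    apply Rmult_le_compat_l; nra. }
  pose proof (Rle_abs (- (f (vadd x (vscale t h)) - f x - t * dot (g x) h))) as Ha.
  rewrite Rabs_Ropp in Ha.
  assert (t * (dot (g x) h) - t * (c / 2) <= t * (f y - f x)) by lra.
  assert (dot (g x) h - c / 2 <= f y - f x) by nra.
  unfold c in *. lra.
Qed.

(** A step of length [delta / 2] along [g x] itself raises [f] at a rate close to [norm (g x)], and
    the Lipschitz bound caps that rate by [L]. *)
Lemma gradient_norm_le {d} (f : Vec d -> R) g L :
  0 < L -> is_gradient f g -> lipschitz L f -> forall x, norm (g x) <= L.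
Proof.
  intros HL Hg Hl x. apply Rnot_lt_le. intros Hlt.
  set (G := norm (g x)) in *.
  assert (He : 0 < (G - L) / 2) by lra.
  destruct (Hg x _ He) as (delta & Hd & Hdelta).
  set (t := delta / (2 * G)).
  assert (Ht : 0 < t) by (apply Rdiv_lt_0_compat; lra).
  specialize (Hdelta (vscale t (g x))).
  rewrite norm_scale, (Rabs_pos_eq t), dot_scale_r, <- norm_sqr in Hdelta by lra.
  fold G in Hdelta.
  assert (Htg : t * G = delta / 2) by (unfold t; field; lra).
  specialize (Hdelta ltac:(lra)).
  pose proof (Hl (vadd x (vscale t (g x))) x) as H1.
  replace (vsub (vadd x (vscale t (g x))) x) with (vscale t (g x)) in H1 by vec_ring.
  rewrite norm_scale, (Rabs_pos_eq t) in H1 by lra. fold G in H1.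
  pose proof (Rle_abs (f (vadd x (vscale t (g x))) - f x)).
  pose proof (Rle_abs (- (f (vadd x (vscale t (g x))) - f x - t * (G * G)))) as Ha.
  rewrite Rabs_Ropp in Ha.
  assert (t * G * G <= t * G * (L + (G - L) / 2)) by nra.
  assert (0 < t * G) by nra. nra.
Qed.

(** * Finitely supported probability distributions *)

(** Repeated values are allowed, so [bind] merges nothing and a position in the list can later serve
    as a seed. *)
Definition fdist (A : Type) : Type := list (R * A).

Definition E {A} (D : fdist A) (phi : A -> R) : R :=
  fold_right (fun pa acc => fst pa * phi (snd pa) + acc) 0 D.

Definition is_fdist {A} (D : fdist A) : Prop :=
  Forall (fun pa => 0 <= fst pa) D /\ E D (fun _ => 1) = 1.

Definition supp {A} (D : fdist A) (a : A) : Prop := exists p, In (p, a) D.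

Definition indic (P : Prop) : R := if excluded_middle_informative P then 1 else 0.

Lemma indic_true (P : Prop) : P -> indic P = 1.
Proof. intros. unfold indic. destruct excluded_middle_informative; tauto. Qed.

Lemma indic_false (P : Prop) : ~ P -> indic P = 0.
Proof. intros. unfold indic. destruct excluded_middle_informative; tauto. Qed.

Lemma indic_bounds P : 0 <= indic P <= 1.
Proof. unfold indic. destruct excluded_middle_informative; lra. Qed.

Lemma indic_mono (P Q : Prop) : (P -> Q) -> indic P <= indic Q.
Proof.
  intros H. unfold indic. repeat destruct excluded_middle_informative; try lra. tauto.
Qed.

Lemma indic_or P Q : indic (P \/ Q) <= indic P + indic Q.
Proof. unfold indic. repeat destruct excluded_middle_informative; try lra; tauto. Qed.

Lemma E_ext {A} (D : fdist A) phi psi :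
  (forall a, supp D a -> phi a = psi a) -> E D phi = E D psi.
Proof.
  intros H. unfold E. induction D as [|[p a] D IH]; simpl; [reflexivity|].
  rewrite IH, H; [reflexivity|exists p; now left|].
  intros b [q Hq]. apply H. exists q. now right.
Qed.

Lemma E_le {A} (D : fdist A) phi psi :
  is_fdist D -> (forall a, supp D a -> phi a <= psi a) -> E D phi <= E D psi.
Proof.
  intros [HD _] H. unfold E. induction D as [|[p a] D IH]; simpl; [lra|].
  inversion HD; subst. simpl in *. apply Rplus_le_compat.
  - apply Rmult_le_compat_l; [assumption|]. apply H. exists p. now left.
  - apply IH; [assumption|]. intros b [q Hq]. apply H. exists q. now right.
Qed.

Lemma E_plus {A} (D : fdist A) phi psi :
  E D (fun a => phi a + psi a) = E D phi + E D psi.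
Proof. unfold E. induction D as [|[p a] D IH]; simpl; [lra|rewrite IH; lra]. Qed.

Lemma E_scal {A} (D : fdist A) c phi : E D (fun a => c * phi a) = c * E D phi.
Proof. unfold E. induction D as [|[p a] D IH]; simpl; [lra|rewrite IH; lra]. Qed.

Lemma E_minus {A} (D : fdist A) phi psi :
  E D (fun a => phi a - psi a) = E D phi - E D psi.
Proof. unfold E. induction D as [|[p a] D IH]; simpl; [lra|rewrite IH; lra]. Qed.

Lemma E_const {A} (D : fdist A) c : is_fdist D -> E D (fun _ => c) = c.
Proof.
  intros [_ H]. rewrite (E_ext D _ (fun _ => c * 1)) by (intros; ring).
  rewrite E_scal, H. ring.
Qed.

Lemma E_rsum {A} (D : fdist A) n (phi : A -> nat -> R) :
  E D (fun a => rsum n (phi a)) = rsum n (fun i => E D (fun a => phi a i)).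
Proof.
  induction n as [|n IH]; simpl.
  - unfold E. induction D as [|[p a] D IHD]; simpl; lra.
  - rewrite E_plus, IH. reflexivity.
Qed.

Lemma E_abs_le {A} (D : fdist A) phi psi :
  is_fdist D -> (forall a, supp D a -> Rabs (phi a) <= psi a) ->
  Rabs (E D phi) <= E D psi.
Proof.
  intros HD H. apply Rabs_le. split.
  - replace (- E D psi) with (E D (fun a => (-1) * psi a)) by (rewrite E_scal; ring).
    apply E_le; [assumption|]. intros a Ha. specialize (H a Ha).
    pose proof (Rle_abs (- phi a)) as H1. rewrite Rabs_Ropp in H1. lra.
  - apply E_le; [assumption|]. intros a Ha. specialize (H a Ha).
    pose proof (Rle_abs (phi a)). lra.
Qed.

Lemma E_nonneg {A} (D : fdist A) phi :
  is_fdist D -> (forall a, supp D a -> 0 <= phi a) -> 0 <= E D phi.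
Proof.
  intros HD H. rewrite <- (E_const D 0 HD). now apply E_le.
Qed.

Definition bind {A B} (D : fdist A) (k : A -> fdist B) : fdist B :=
  flat_map (fun pa => map (fun qb => (fst pa * fst qb, snd qb)) (k (snd pa))) D.

Lemma E_app {A} (D D' : fdist A) phi : E (D ++ D') phi = E D phi + E D' phi.
Proof. unfold E. induction D as [|[p a] D IH]; simpl; [lra|rewrite IH; lra]. Qed.

Lemma E_bind {A B} (D : fdist A) (k : A -> fdist B) phi :
  E (bind D k) phi = E D (fun a => E (k a) phi).
Proof.
  unfold bind. induction D as [|[p a] D IH]; simpl; [reflexivity|].
  rewrite E_app, IH. simpl. f_equal.
  unfold E. induction (k a) as [|[q b] l IHl]; simpl; [lra|rewrite IHl; lra].
Qed.

Lemma supp_bind {A B} (D : fdist A) (k : A -> fdist B) b :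
  supp (bind D k) b -> exists a, supp D a /\ supp (k a) b.
Proof.
  intros [p H]. apply in_flat_map in H. destruct H as ([q a] & H1 & H2).
  apply in_map_iff in H2. destruct H2 as ([q' b'] & H3 & H4).
  simpl in *. inversion H3; subst. exists a. split; [now exists q|now exists q'].
Qed.

Lemma bind_is_fdist {A B} (D : fdist A) (k : A -> fdist B) :
  is_fdist D -> (forall a, is_fdist (k a)) -> is_fdist (bind D k).
Proof.
  intros HD Hk. split.
  - apply Forall_forall. intros [p b] H. apply in_flat_map in H.
    destruct H as ([q a] & H1 & H2). apply in_map_iff in H2.
    destruct H2 as ([q' b'] & H3 & H4). simpl in *. inversion H3; subst.
    destruct HD as [HD _]. rewrite Forall_forall in HD. apply HD in H1.
    destruct (Hk a) as [Ha _]. rewrite Forall_forall in Ha. apply Ha in H4.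
    simpl in *. nra.
  - rewrite E_bind. rewrite (E_ext D _ (fun _ => 1)).
    + now apply E_const.
    + intros a _. apply (Hk a).
Qed.

Fixpoint iid {A} (n : nat) (D : fdist A) : fdist (list A) :=
  match n with
  | O => (1, nil) :: nil
  | S n' => bind D (fun a => bind (iid n' D) (fun l => (1, a :: l) :: nil))
  end.

Lemma E_ret {A} (a : A) phi : E ((1, a) :: nil) phi = phi a.
Proof. unfold E; simpl; lra. Qed.

Lemma ret_is_fdist {A} (a : A) : is_fdist ((1, a) :: nil).
Proof.
  split; [|apply (E_ret a (fun _ => 1))]. apply Forall_forall. intros pa [<-|[]]. simpl. lra.
Qed.

Lemma E_iid_S {A} n (D : fdist A) phi :
  E (iid (S n) D) phi = E D (fun a => E (iid n D) (fun l => phi (a :: l))).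
Proof.
  simpl. rewrite E_bind. apply E_ext. intros a _. rewrite E_bind.
  apply E_ext. intros l _. apply E_ret.
Qed.

Lemma iid_is_fdist {A} n (D : fdist A) : is_fdist D -> is_fdist (iid n D).
Proof.
  intros HD. induction n as [|n IH]; simpl; [apply ret_is_fdist|].
  apply bind_is_fdist; [assumption|]. intros a. apply bind_is_fdist; [assumption|].
  intros; apply ret_is_fdist.
Qed.

Lemma iid_supp {A} n (D : fdist A) l :
  supp (iid n D) l -> length l = n /\ Forall (supp D) l.
Proof.
  revert l. induction n as [|n IH]; intros l H; simpl in H.
  - destruct H as [p [H|[]]]. inversion H. now split.
  - apply supp_bind in H. destruct H as (a & Ha & H).
    apply supp_bind in H. destruct H as (l' & Hl & [p [H|[]]]).
    inversion H; subst. destruct (IH _ Hl) as [H1 H2]. split; [simpl; lia|].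
    now constructor.
Qed.

(** * Exponential moments, union bound and Hoeffding's inequality *)

Definition lprod {A} (h : A -> R) (l : list A) : R :=
  fold_right (fun a acc => h a * acc) 1 l.

Definition lsum {A} (h : A -> R) (l : list A) : R :=
  fold_right (fun a acc => h a + acc) 0 l.

Lemma E_iid_prod {A} n (D : fdist A) h : E (iid n D) (lprod h) = E D h ^ n.
Proof.
  induction n as [|n IH]; [simpl; apply E_ret|].
  rewrite E_iid_S. simpl. rewrite (E_ext D _ (fun a => E D h ^ n * h a)).
  - rewrite E_scal. ring.
  - intros a _. rewrite E_scal, IH. ring.
Qed.

Lemma exp_lsum {A} (h : A -> R) l : exp (lsum h l) = lprod (fun a => exp (h a)) l.
Proof.
  induction l as [|a l IH]; simpl; [apply exp_0|]. now rewrite exp_plus, IH.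
Qed.

Lemma lsum_affine {A} (X : A -> R) s c l :
  lsum (fun a => s * (X a - c)) l = s * (lsum X l - INR (length l) * c).
Proof.
  induction l as [|a l IH]; simpl lsum; [simpl; lra|].
  rewrite IH. simpl length. rewrite S_INR. ring.
Qed.

Lemma lsum_E_iid {A} n (D : fdist A) X :
  is_fdist D -> E (iid n D) (lsum X) = INR n * E D X.
Proof.
  intros HD. induction n as [|n IH]; [unfold E; simpl; lra|].
  rewrite E_iid_S. cbn [lsum fold_right].
  rewrite (E_ext D _ (fun a => X a + INR n * E D X)).
  - rewrite E_plus, E_const, S_INR by assumption. ring.
  - intros a _. rewrite E_plus, E_const by now apply iid_is_fdist.
    f_equal. exact IH.
Qed.

Lemma E_indic_exists {A I} (D : fdist A) (l : list I) (P : I -> A -> Prop) beta :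
  is_fdist D -> (forall i, In i l -> E D (fun a => indic (P i a)) <= beta) ->
  E D (fun a => indic (exists i, In i l /\ P i a)) <= INR (length l) * beta.
Proof.
  intros HD. induction l as [|i l IH]; intros H.
  - simpl. rewrite (E_ext D _ (fun _ => 0)); [rewrite E_const by assumption; lra|].
    intros. apply indic_false. intros (? & [] & _).
  - simpl length. rewrite S_INR.
    apply Rle_trans with
      (E D (fun a => indic (P i a) + indic (exists i, In i l /\ P i a))).
    + apply E_le; [assumption|]. intros a _. eapply Rle_trans; [|apply indic_or].
      apply indic_mono. intros (j & [->|Hj] & Hp); [now left|right; eauto].
    + rewrite E_plus. specialize (H i ltac:(now left)) as H1.
      assert (E D (fun a => indic (exists i, In i l /\ P i a)) <= INR (length l) * beta).
      { apply IH. intros. apply H. now right. }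
      lra.
Qed.

(** Squaring [exp (x/2) <= 1 / (1 - x/2)] leaves a polynomial inequality that reduces to
    [1 - 3 x + x^2 >= 0]. *)
Lemma exp_quadratic_bound x : Rabs x <= 1 / 3 -> exp x <= 1 + x + x * x.
Proof.
  intros Hx. assert (-(1/3) <= x <= 1/3).
  { pose proof (Rle_abs x). pose proof (Rle_abs (-x)). rewrite Rabs_Ropp in *. lra. }
  pose proof (exp_ineq1_le (-(x/2))) as H1.
  assert (H2 : exp (x/2) * exp (-(x/2)) = 1) by (rewrite <- exp_plus, Rplus_opp_r; apply exp_0).
  pose proof (exp_pos (x/2)).
  replace (exp x) with (exp (x/2) * exp (x/2)) by (rewrite <- exp_plus; f_equal; field).
  assert (exp (x/2) * (1 - x/2) <= 1) by nra.
  assert (0 < 1 - x/2) by lra.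
  apply Rmult_le_reg_r with ((1 - x/2) * (1 - x/2)); [nra|].
  apply Rle_trans with 1; [|].
  - assert (0 <= exp (x/2) * (1 - x/2)) by nra.
    replace (exp (x / 2) * exp (x / 2) * ((1 - x / 2) * (1 - x / 2)))
      with ((exp (x/2) * (1 - x/2)) * (exp (x/2) * (1 - x/2))) by ring.
    nra.
  - replace ((1 + x + x * x) * ((1 - x / 2) * (1 - x / 2)))
      with (1 + x * x * ((1 - 3 * x + x * x) / 4)) by field.
    assert (0 <= x * x) by nra. assert (0 <= 1 - 3 * x + x * x) by nra. nra.
Qed.

Lemma exp_INR_mult x n : exp (INR n * x) = exp x ^ n.
Proof.
  induction n as [|n IH]; [simpl; rewrite Rmult_0_l; apply exp_0|].
  rewrite S_INR, Rmult_plus_distr_r, Rmult_1_l, exp_plus, IH. simpl. ring.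
Qed.

Lemma hoeffding {A} (D : fdist A) X b t N :
  is_fdist D -> (forall a, supp D a -> Rabs (X a) <= b) -> 0 < t <= b ->
  E (iid N D) (fun l => indic (INR N * t <= lsum X l - INR N * E D X))
    <= exp (- (INR N * (t * t / (16 * (b * b))))).
Proof.
  (* Chernoff's method; this [s] minimises [- s t + 4 s^2 b^2]. The hypothesis [t <= b] keeps
     [s * (X a - mu)] within [1/4], where the quadratic bound on [exp] applies. *)
  intros HD Hb Ht. set (mu := E D X). set (s := t / (8 * (b * b))).
  assert (Hs : 0 < s) by (apply Rdiv_lt_0_compat; nra).
  assert (Hmu : Rabs mu <= b).
  { rewrite <- (E_const D b HD). now apply E_abs_le. }
  apply Rle_trans with
    (E (iid N D) (fun l => exp (- (INR N * (s * t))) * lprod (fun a => exp (s * (X a - mu))) l)).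
  - apply E_le; [now apply iid_is_fdist|]. intros l Hl.
    apply iid_supp in Hl. destruct Hl as [Hl _].
    rewrite <- (exp_lsum (fun a => s * (X a - mu))), <- exp_plus, lsum_affine, Hl.
    unfold indic. destruct excluded_middle_informative as [H|]; [|left; apply exp_pos].
    rewrite <- exp_0 at 1. apply Rle_trans with (exp (s * 0)).
    + rewrite Rmult_0_r. lra.
    + 
      destruct (Req_dec 0 (lsum X l - INR N * mu - INR N * t)) as [Heq|Hne].
      * right. f_equal. rewrite Heq. ring.
      * left. apply exp_increasing. nra.
  - rewrite E_scal, E_iid_prod.
    assert (H1 : E D (fun a => exp (s * (X a - mu))) <= exp (4 * (s * s * (b * b)))).
    { apply Rle_trans with (1 + 4 * (s * s * (b * b))); [|pose proof (exp_ineq1_le (4 * (s * s * (b * b)))); lra].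
      apply Rle_trans with (E D (fun a => (1 - s * mu + 4 * (s * s * (b * b))) + s * X a)).
      - apply E_le; [assumption|]. intros a Ha. specialize (Hb a Ha).
        assert (Rabs (X a - mu) <= 2 * b).
        { unfold Rminus. eapply Rle_trans; [apply Rabs_triang|]. rewrite Rabs_Ropp. lra. }
        eapply Rle_trans; [apply exp_quadratic_bound|].
        + rewrite Rabs_mult, (Rabs_pos_eq s) by lra.
          apply Rle_trans with (s * (2 * b)); [apply Rmult_le_compat_l; lra|].
          replace (s * (2 * b)) with (t / b * / 4) by (unfold s; field; lra).
          assert (t / b <= 1) by (apply Rmult_le_reg_r with b; [lra|]; field_simplify; lra).
          lra.
        + assert ((X a - mu) * (X a - mu) <= 4 * (b * b)).
          { assert (- (2 * b) <= X a - mu <= 2 * b); [|nra].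
            pose proof (Rle_abs (X a - mu)). pose proof (Rle_abs (- (X a - mu))) as H4.
            rewrite Rabs_Ropp in H4. lra. }
          assert (s * s * ((X a - mu) * (X a - mu)) <= s * s * (4 * (b * b))).
          { apply Rmult_le_compat_l; nra. }
          lra.
      - rewrite E_plus, E_const, E_scal by assumption. fold mu. lra. }
    apply Rle_trans with (exp (- (INR N * (s * t))) * exp (4 * (s * s * (b * b))) ^ N).
    + apply Rmult_le_compat_l; [left; apply exp_pos|]. apply pow_incr. split; [|assumption].
      apply E_nonneg; [assumption|]. intros. left. apply exp_pos.
    + rewrite <- exp_INR_mult, <- exp_plus. right. f_equal. unfold s. field. lra.
Qed.

(** * Seeds: enumerating a finite distribution by natural numbers *)

Lemma sum_NoDup_le_rsum (v : nat -> R) m l :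
  (forall n, 0 <= v n) -> NoDup l -> (forall n, In n l -> (n < m)%nat) ->
  lsum v l <= rsum m v.
Proof.
  intros Hv. revert l. induction m as [|m IH]; intros l Hl Hm.
  - destruct l as [|a l]; [simpl; lra|]. specialize (Hm a (or_introl eq_refl)). lia.
  - simpl. destruct (in_dec Nat.eq_dec m l) as [Hi|Hi].
    + destruct (in_split _ _ Hi) as (l1 & l2 & ->).
      assert (Happ : forall l1 l2, lsum v (l1 ++ l2) = lsum v l1 + lsum v l2).
      { clear. induction l1 as [|a l1 IH]; intros; simpl; [lra|rewrite IH; lra]. }
      pose proof (NoDup_remove _ _ _ Hl) as [Hnd Hnot].
      assert (lsum v (l1 ++ l2) <= rsum m v).
      { apply IH; [assumption|]. intros n Hn.
        assert (n <> m) by (intros ->; tauto).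
        assert (n < S m)%nat by (apply Hm; apply in_app_iff in Hn; apply in_app_iff; simpl; tauto).
        lia. }
      rewrite Happ in *. simpl. lra.
    + assert (lsum v l <= rsum m v).
      { apply IH; [assumption|]. intros n Hn. assert (n <> m) by (intros ->; tauto).
        specialize (Hm n Hn). lia. }
      specialize (Hv m). lra.
Qed.

(** The default 0 gives every number past the end of the list probability zero, which makes this a
    law on all of [nat]. *)
Definition seed_weight {A} (D : fdist A) (n : nat) : R := nth n (map fst D) 0.

Definition seed_value {A} (D : fdist A) (a0 : A) (n : nat) : A := nth n (map snd D) a0.

Lemma rsum_shift n a : rsum (S n) a = a 0%nat + rsum n (fun i => a (S i)).
Proof. induction n as [|n IH]; [simpl; lra|]. simpl in *. rewrite IH. lra. Qed.

Lemma rsum_seed {A} (D : fdist A) a0 phi :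
  rsum (length D) (fun n => seed_weight D n * phi (seed_value D a0 n)) = E D phi.
Proof.
  induction D as [|[p a] D IH]; [reflexivity|].
  simpl length. rewrite rsum_shift. unfold E. simpl fold_right.
  fold (E D phi). rewrite <- IH. reflexivity.
Qed.

Lemma seed_weight_nonneg {A} (D : fdist A) : is_fdist D -> forall n, 0 <= seed_weight D n.
Proof.
  intros [H _] n. unfold seed_weight. destruct (Nat.lt_ge_cases n (length (map fst D))) as [Hn|Hn].
  - pose proof (nth_In (map fst D) 0 Hn) as Hi. apply in_map_iff in Hi.
    destruct Hi as ([p a] & <- & Hi). rewrite Forall_forall in H. apply (H _ Hi).
  - rewrite nth_overflow by assumption. lra.
Qed.

Lemma seed_weight_total {A} (D : fdist A) : is_fdist D -> infinite_sum (seed_weight D) 1.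
Proof.
  intros [_ H] e He. exists (length D). intros n Hn.
  destruct D as [|pa D]; [unfold E in H; simpl in H; lra|]. set (D' := pa :: D) in *.
  replace (sum_f_R0 (seed_weight D') n) with (rsum (S n) (seed_weight D')).
  - replace (S n) with (length D' + (S n - length D'))%nat by lia. rewrite rsum_split.
    rewrite (rsum_ext (S n - length D') _ (fun _ => 0)).
    + rewrite rsum_const, <- H, <- (rsum_seed D' (snd pa) (fun _ => 1)).
      rewrite (rsum_ext _ (fun n0 => seed_weight D' n0 * 1) (seed_weight D')) by (intros; ring).
      unfold Rdist. rewrite Rmult_0_r, Rplus_0_r, Rminus_diag, Rabs_R0. exact He.
    + intros i _. unfold seed_weight. apply nth_overflow. rewrite length_map. lia.
  - clear. induction n as [|n IH]; [simpl; lra|]. simpl in *. rewrite <- IH. reflexivity.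
Qed.

(** Passes from the finite sums of [prob_le] to an expectation. Seeds past the end may count as bad,
    but they weigh nothing and are filtered out. *)
Lemma sum_seed_weight_le {A} (D : fdist A) a0 (bad : A -> Prop) l :
  is_fdist D -> NoDup l -> (forall n, In n l -> bad (seed_value D a0 n)) ->
  lsum (seed_weight D) l <= E D (fun a => indic (bad a)).
Proof.
  intros HD Hl Hbad. rewrite <- (rsum_seed D a0).
  pose proof (seed_weight_nonneg D HD) as Hw.
  set (v := fun n => seed_weight D n * indic (bad (seed_value D a0 n))).
  set (small := fun n => Nat.ltb n (length D)).
  apply Rle_trans with (lsum v (filter small l)).
  - clear Hl. induction l as [|n l IH]; [simpl; lra|]. simpl.
    assert (lsum (seed_weight D) l <= lsum v (filter small l)).
    { apply IH. intros. apply Hbad. now right. }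
    unfold small at 1. destruct (Nat.ltb_spec n (length D)).
    + simpl. unfold v at 1. rewrite indic_true by (apply Hbad; now left). lra.
    + unfold seed_weight at 1. rewrite nth_overflow by now rewrite length_map. lra.
  - apply sum_NoDup_le_rsum.
    + intros n. unfold v. pose proof (indic_bounds (bad (seed_value D a0 n))).
      specialize (Hw n). nra.
    + now apply NoDup_filter.
    + intros n Hn. apply filter_In in Hn. destruct Hn as [_ Hn].
      now apply Nat.ltb_lt in Hn.
Qed.

(** * The truncated discrete Gaussian law on the integers *)

Definition wsum (lo : Z) (len : nat) (phi : Z -> R) : R :=
  rsum len (fun i => phi (lo + Z.of_nat i)%Z).

Lemma wsum_ext lo len phi psi :
  (forall k, (lo <= k < lo + Z.of_nat len)%Z -> phi k = psi k) ->
  wsum lo len phi = wsum lo len psi.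
Proof. intros H. apply rsum_ext. intros. apply H. lia. Qed.

Lemma wsum_shift lo len j phi :
  wsum lo len (fun k => phi (k + j)%Z) = wsum (lo + j) len phi.
Proof. apply rsum_ext. intros. f_equal. lia. Qed.

Lemma wsum_split lo a b phi :
  wsum lo (a + b) phi = wsum lo a phi + wsum (lo + Z.of_nat a) b phi.
Proof.
  unfold wsum. rewrite rsum_split. f_equal. apply rsum_ext. intros. f_equal. lia.
Qed.

Lemma wsum_scal lo len c phi : wsum lo len (fun k => c * phi k) = c * wsum lo len phi.
Proof. apply rsum_scal. Qed.

Lemma wsum_1 lo phi : wsum lo 1 phi = phi lo.
Proof. unfold wsum. simpl. rewrite Z.add_0_r. lra. Qed.

Lemma wsum_zero lo len phi :
  (forall k, (lo <= k < lo + Z.of_nat len)%Z -> phi k = 0) -> wsum lo len phi = 0.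
Proof.
  intros H. rewrite (wsum_ext _ _ _ (fun _ => 0)) by assumption.
  unfold wsum. rewrite rsum_const. lra.
Qed.

Definition csum (K : nat) (phi : Z -> R) : R := wsum (- Z.of_nat K) (2 * K + 1) phi.

Lemma csum_0 phi : csum 0 phi = phi 0%Z.
Proof. unfold csum. simpl. apply wsum_1. Qed.

Lemma csum_S K phi :
  csum (S K) phi = csum K phi + phi (Z.of_nat K + 1)%Z + phi (- (Z.of_nat K + 1))%Z.
Proof.
  unfold csum. replace (2 * S K + 1)%nat with (1 + (2 * K + 1) + 1)%nat by lia.
  rewrite !wsum_split, !wsum_1.
  replace (- Z.of_nat (S K) + Z.of_nat 1)%Z with (- Z.of_nat K)%Z by lia.
  replace (- Z.of_nat (S K) + Z.of_nat (1 + (2 * K + 1)))%Z with (Z.of_nat K + 1)%Z by lia.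
  replace (- Z.of_nat (S K))%Z with (- (Z.of_nat K + 1))%Z by lia. lra.
Qed.

Definition rho (n : nat) (k : Z) : R := exp (- (IZR k * IZR k) / (2 * (INR n * INR n))).

Definition Zn (n K : nat) : R := csum K (rho n).

Lemma rho_pos n k : 0 < rho n k.
Proof. apply exp_pos. Qed.

Lemma exp_le_compat x y : x <= y -> exp x <= exp y.
Proof.
  intros [H| ->]; [left; now apply exp_increasing|right; reflexivity].
Qed.

Lemma rho_mono n k k' :
  (0 < n)%nat -> (k * k <= k' * k')%Z -> rho n k' <= rho n k.
Proof.
  intros Hn H. apply lt_0_INR in Hn. apply exp_le_compat.
  apply IZR_le in H. rewrite !mult_IZR in H. unfold Rdiv.
  apply Rmult_le_compat_r; [|lra]. left. apply Rinv_0_lt_compat. nra.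
Qed.

Lemma rho_opp n k : rho n (- k) = rho n k.
Proof. unfold rho. rewrite opp_IZR. f_equal. unfold Rdiv. ring. Qed.

Lemma rho_0 n : rho n 0 = 1.
Proof.
  unfold rho. replace (- (0 * 0) / (2 * (INR n * INR n))) with 0; [apply exp_0|].
  unfold Rdiv. ring.
Qed.

Lemma Zn_S n K : Zn n (S K) = Zn n K + 2 * rho n (Z.of_nat K + 1).
Proof. unfold Zn. rewrite csum_S, rho_opp. ring. Qed.

Lemma Zn_ge_1 n K : 1 <= Zn n K.
Proof.
  induction K as [|K IH]; [unfold Zn; rewrite csum_0, rho_0; lra|].
  rewrite Zn_S. pose proof (rho_pos n (Z.of_nat K + 1)). lra.
Qed.

(** Within one standard deviation every weight is at least [exp (- 1/2) >= 1/2], so each symmetric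
    pair adds at least 1. *)
Lemma Zn_ge n K : (0 < n)%nat -> (n <= K)%nat -> INR n <= Zn n K.
Proof.
  intros Hn H.
  assert (Hle : forall k, (k <= n)%nat -> INR k <= Zn n k).
  { induction k as [|k IH]; intros Hk; [pose proof (Zn_ge_1 n 0); simpl; lra|].
    rewrite Zn_S, S_INR. specialize (IH ltac:(lia)).
    assert (1 / 2 <= rho n (Z.of_nat k + 1)); [|lra].
    apply Rle_trans with (rho n (Z.of_nat n)).
    - unfold rho. rewrite <- INR_IZR_INZ. apply lt_0_INR in Hn.
      replace (- (INR n * INR n) / (2 * (INR n * INR n))) with (- (1 / 2)) by (field; lra).
      pose proof (exp_ineq1_le (- (1/2))). lra.
    - apply rho_mono; [assumption|nia]. }
  induction H as [|K H IH]; [now apply Hle|].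
  rewrite Zn_S. pose proof (rho_pos n (Z.of_nat K + 1)). lra.
Qed.

Lemma rho_diff n K :
  (0 < n)%nat ->
  (2 * INR K + 1) * rho n (Z.of_nat K + 1)
    <= 2 * (INR n * INR n) * (rho n (Z.of_nat K) - rho n (Z.of_nat K + 1)).
Proof.
  intros Hn. apply lt_0_INR in Hn.
  assert (rho n (Z.of_nat K) = rho n (Z.of_nat K + 1) * exp ((2 * INR K + 1) / (2 * (INR n * INR n)))).
  { unfold rho. rewrite <- exp_plus. f_equal. rewrite plus_IZR, <- INR_IZR_INZ. field. lra. }
  rewrite H. pose proof (exp_ineq1_le ((2 * INR K + 1) / (2 * (INR n * INR n)))) as H1.
  pose proof (rho_pos n (Z.of_nat K + 1)).
  apply Rle_trans with (2 * (INR n * INR n) * (rho n (Z.of_nat K + 1) *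
     ((2 * INR K + 1) / (2 * (INR n * INR n))))).
  - right. field. lra.
  - apply Rmult_le_compat_l; [nra|]. nra.
Qed.

(* Summation by parts: [rho_diff] is the discrete counterpart of x rho = - n^2 rho'. *)
Lemma csum_second_moment n K :
  (0 < n)%nat ->
  csum K (fun k => rho n k * (IZR k * IZR k)) <= 4 * (INR n * INR n) * Zn n K.
Proof.
  intros Hn.
  (* The subtracted boundary term makes the induction close; at [K = 0] there is equality. *)
  assert (H : csum K (fun k => rho n k * (IZR k * IZR k))
    <= 2 * (INR n * INR n) * (Zn n K + 1)
       - 4 * (INR n * INR n) * ((INR K + 1) * rho n (Z.of_nat K))).
  { induction K as [|K IH].
    - rewrite csum_0. unfold Zn. rewrite csum_0. simpl. rewrite rho_0. nra.
    - rewrite csum_S, Zn_S, rho_opp, opp_IZR, plus_IZR, <- INR_IZR_INZ, S_INR.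
      replace (Z.of_nat (S K)) with (Z.of_nat K + 1)%Z by lia.
      pose proof (rho_diff n K Hn) as H1. pose proof (pos_INR K) as H2.
      pose proof (rho_pos n (Z.of_nat K + 1)).
      set (a := rho n (Z.of_nat K + 1)) in *. set (b := rho n (Z.of_nat K)) in *.
      set (N := INR n * INR n) in *. set (k := INR K) in *.
      assert (2 * (k + 1) * ((k + 1) * a) <= 2 * (k + 1) * (2 * N * (b - a))).
      { apply Rmult_le_compat_l; [lra|]. nra. }
      nra. }
  pose proof (Zn_ge_1 n K). pose proof (pos_INR n). pose proof (pos_INR K).
  pose proof (rho_pos n (Z.of_nat K)).
  assert (0 <= INR n * INR n) by nra.
  assert (0 <= (INR K + 1) * rho n (Z.of_nat K)) by nra. nra.
Qed.

(** Summation by parts moves the difference onto [rho], whose total variation is at most 2 by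
    unimodality. The boundary terms are kept apart in the induction: the interior costs
    [2 B (1 - rho n K)], the boundary [2 B rho n K]. *)
Lemma csum_neighbour n K B phi :
  (0 < n)%nat -> (forall k, Rabs (phi k) <= B) ->
  Rabs (csum K (fun k => rho n k * (phi (k + 1)%Z - phi k))) <= 2 * B.
Proof.
  intros Hn HB. assert (0 <= B) by (eapply Rle_trans; [apply Rabs_pos|apply (HB 0%Z)]).
  assert (Hb : forall k, - B <= phi k <= B).
  { intros k. specialize (HB k). pose proof (Rle_abs (phi k)).
    pose proof (Rle_abs (- phi k)) as H1. rewrite Rabs_Ropp in H1. lra. }
  assert (Hm : - (B * (2 - 2 * rho n (Z.of_nat K))) <=
     csum K (fun k => rho n k * (phi (k + 1)%Z - phi k))
          - rho n (Z.of_nat K) * (phi (Z.of_nat K + 1)%Z - phi (- Z.of_nat K)%Z)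
    <= B * (2 - 2 * rho n (Z.of_nat K))).
  { induction K as [|K IH].
    - rewrite csum_0. simpl. rewrite rho_0. lra.
    - rewrite csum_S, rho_opp.
      replace (Z.of_nat (S K)) with (Z.of_nat K + 1)%Z by lia.
      replace (- (Z.of_nat K + 1) + 1)%Z with (- Z.of_nat K)%Z by lia.
      assert (rho n (Z.of_nat K + 1) <= rho n (Z.of_nat K)) by (apply rho_mono; [assumption|nia]).
      pose proof (Hb (Z.of_nat K + 1)%Z). pose proof (Hb (- Z.of_nat K)%Z).
      set (a := rho n (Z.of_nat K + 1)) in *. set (b := rho n (Z.of_nat K)) in *.
      set (p := phi (Z.of_nat K + 1)%Z) in *. set (p' := phi (- Z.of_nat K)%Z) in *.
      assert (- (2 * B) * (b - a) <= (p - p') * (b - a) <= 2 * B * (b - a)) by nra.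
      nra. }
  pose proof (Hb (Z.of_nat K + 1)%Z). pose proof (Hb (- Z.of_nat K)%Z).
  pose proof (rho_pos n (Z.of_nat K)).
  apply Rabs_le. nra.
Qed.

(** Sliding the window one step away from the centre trades a weight for one farther from 0. *)
Lemma wsum_rho_window n K s :
  (0 < n)%nat -> wsum (- Z.of_nat K + s) (2 * K + 1) (rho n) <= Zn n K.
Proof.
  intros Hn.
  assert (step : forall lo, wsum (lo + 1) (2 * K + 1) (rho n)
     = wsum lo (2 * K + 1) (rho n) - rho n lo + rho n (lo + Z.of_nat (2 * K + 1))).
  { intros lo. pose proof (wsum_split lo 1 (2 * K + 1) (rho n)) as H1.
    pose proof (wsum_split lo (2 * K + 1) 1 (rho n)) as H2.
    rewrite Nat.add_comm in H2. rewrite H1 in H2. rewrite !wsum_1 in H2.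
    change (Z.of_nat 1) with 1%Z in H2. lra. }
  assert (Hpos : forall p : nat, wsum (- Z.of_nat K + Z.of_nat p) (2 * K + 1) (rho n) <= Zn n K).
  { induction p as [|p IH]; [rewrite Z.add_0_r; unfold Zn, csum; lra|].
    replace (- Z.of_nat K + Z.of_nat (S p))%Z with (- Z.of_nat K + Z.of_nat p + 1)%Z by lia.
    rewrite step.
    assert (rho n (- Z.of_nat K + Z.of_nat p + Z.of_nat (2 * K + 1))
       <= rho n (- Z.of_nat K + Z.of_nat p)); [|lra].
    apply rho_mono; [assumption|nia]. }
  assert (Hneg : forall p : nat, wsum (- Z.of_nat K - Z.of_nat p) (2 * K + 1) (rho n) <= Zn n K).
  { induction p as [|p IH]; [rewrite Z.sub_0_r; unfold Zn, csum; lra|].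
    replace (- Z.of_nat K - Z.of_nat p)%Z with (- Z.of_nat K - Z.of_nat (S p) + 1)%Z in IH by lia.
    rewrite step in IH.
    assert (rho n (- Z.of_nat K - Z.of_nat (S p))
       <= rho n (- Z.of_nat K - Z.of_nat (S p) + Z.of_nat (2 * K + 1))); [|lra].
    apply rho_mono; [assumption|nia]. }
  destruct (Z.le_gt_cases 0 s).
  - rewrite <- (Z2Nat.id s) by assumption. apply Hpos.
  - replace (- Z.of_nat K + s)%Z with (- Z.of_nat K - Z.of_nat (Z.to_nat (- s)))%Z by lia.
    apply Hneg.
Qed.

Definition gaussZ (n K : nat) : fdist Z :=
  map (fun i => let k := (- Z.of_nat K + Z.of_nat i)%Z in (rho n k / Zn n K, k))
      (seq 0 (2 * K + 1)).

Lemma E_map_seq {A} (w : nat -> R) (v : nat -> A) len phi :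
  E (map (fun i => (w i, v i)) (seq 0 len)) phi = rsum len (fun i => w i * phi (v i)).
Proof.
  induction len as [|len IH]; [reflexivity|].
  rewrite seq_S, map_app, E_app, IH. simpl. unfold E; simpl; lra.
Qed.

Lemma E_gaussZ n K phi :
  E (gaussZ n K) phi = csum K (fun k => rho n k * phi k) / Zn n K.
Proof.
  unfold gaussZ. cbn zeta.
  rewrite (E_map_seq (fun i => rho n (- Z.of_nat K + Z.of_nat i) / Zn n K)
    (fun i => (- Z.of_nat K + Z.of_nat i)%Z)).
  unfold csum, wsum, Rdiv. rewrite Rmult_comm, <- rsum_scal. apply rsum_ext.
  intros. ring.
Qed.

Lemma gaussZ_is_fdist n K : is_fdist (gaussZ n K).
Proof.
  pose proof (Zn_ge_1 n K) as HZ. split.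
  - apply Forall_forall. intros pa H. apply in_map_iff in H.
    destruct H as (i & <- & _). simpl. left. apply Rdiv_lt_0_compat; [apply rho_pos|lra].
  - rewrite E_gaussZ.
    replace (csum K (fun k => rho n k * 1)) with (Zn n K)
      by (apply wsum_ext; intros; ring).
    field. lra.
Qed.

Lemma gaussZ_second_moment n K :
  (0 < n)%nat -> E (gaussZ n K) (fun k => IZR k * IZR k) <= 4 * (INR n * INR n).
Proof.
  intros Hn. rewrite E_gaussZ. pose proof (csum_second_moment n K Hn).
  pose proof (Zn_ge_1 n K). apply Rmult_le_reg_r with (Zn n K); [lra|].
  unfold Rdiv. rewrite Rmult_assoc, Rinv_l by lra. lra.
Qed.

Lemma gaussZ_neighbour n K B phi :
  (0 < n)%nat -> (n <= K)%nat -> (forall k, Rabs (phi k) <= B) ->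
  Rabs (E (gaussZ n K) (fun k => phi (k + 1)%Z) - E (gaussZ n K) phi) <= 2 * B / INR n.
Proof.
  intros Hn HK HB. rewrite <- E_minus, E_gaussZ.
  pose proof (csum_neighbour n K B phi Hn HB) as H.
  pose proof (Zn_ge n K Hn HK) as HZ. pose proof (lt_0_INR n Hn).
  unfold Rdiv. rewrite Rabs_mult, (Rabs_pos_eq (/ _))
    by (left; apply Rinv_0_lt_compat; lra).
  apply Rmult_le_compat; try assumption.
  - apply Rabs_pos.
  - left; apply Rinv_0_lt_compat; lra.
  - now apply Rinv_le_contravar.
Qed.

(** Density of the law of [k + j], [k] drawn from [gaussZ n K], with respect to
    the wider law [gaussZ n K']. *)
Definition shift_ratio (n K K' : nat) (k j : Z) : R :=
  if (Z.abs (k - j) <=? Z.of_nat K)%Z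
  then Zn n K' / Zn n K * (rho n (k - j) / rho n k) else 0.

Lemma shift_ratio_nonneg n K K' k j : 0 <= shift_ratio n K K' k j.
Proof.
  unfold shift_ratio. destruct (_ <=? _)%Z; [|lra].
  pose proof (Zn_ge_1 n K). pose proof (Zn_ge_1 n K').
  pose proof (rho_pos n (k - j)). pose proof (rho_pos n k).
  apply Rmult_le_pos; left; apply Rdiv_lt_0_compat; lra.
Qed.

(** Change of measure. Truncating the reference law at [K + J] keeps the shifted support
    [[-K + j, K + j]] inside it for every admissible [j]. *)
Lemma E_gaussZ_shift n K J j phi :
  (Z.abs j <= Z.of_nat J)%Z ->
  E (gaussZ n K) (fun k => phi (k + j)%Z)
    = E (gaussZ n (K + J)) (fun k => shift_ratio n K (K + J) k j * phi k).
Proof.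
  intros Hj. rewrite !E_gaussZ.
  pose proof (Zn_ge_1 n K) as H1. pose proof (Zn_ge_1 n (K + J)) as H2.
  set (psi := fun k => if (Z.abs (k - j) <=? Z.of_nat K)%Z
     then rho n (k - j) * phi k else 0).
  replace (csum (K + J) (fun k => rho n k * (shift_ratio n K (K + J) k j * phi k)))
    with (Zn n (K + J) / Zn n K * csum (K + J) psi).
  2:{ unfold csum. rewrite <- wsum_scal. apply wsum_ext. intros k _.
      unfold psi, shift_ratio. destruct (_ <=? _)%Z; [|ring].
      pose proof (rho_pos n k). field. lra. }
  replace (csum (K + J) psi) with (csum K (fun k => rho n k * phi (k + j)%Z)).
  { unfold csum. field. lra. }
  unfold csum at 2. set (p := Z.to_nat (Z.of_nat J + j)).
  set (q := Z.to_nat (Z.of_nat J - j)).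
  replace (2 * (K + J) + 1)%nat with (p + (2 * K + 1) + q)%nat by lia.
  rewrite (wsum_split _ (p + (2 * K + 1)) q), (wsum_split _ p (2 * K + 1)).
  rewrite (wsum_zero _ p), (wsum_zero _ q).
  - replace (- Z.of_nat (K + J) + Z.of_nat p)%Z with (- Z.of_nat K + j)%Z by lia.
    rewrite <- wsum_shift. unfold csum. rewrite Rplus_0_l, Rplus_0_r. apply wsum_ext.
    intros k Hk. unfold psi. replace (k + j - j)%Z with k by lia.
    destruct (Z.leb_spec (Z.abs k) (Z.of_nat K)); [reflexivity|lia].
  - intros k Hk. unfold psi. destruct (Z.leb_spec (Z.abs (k - j)) (Z.of_nat K)); [lia|reflexivity].
  - intros k Hk. unfold psi. destruct (Z.leb_spec (Z.abs (k - j)) (Z.of_nat K)); [lia|reflexivity].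
Qed.

(** Completing the square: the tilt recentres the Gaussian at [m * j]. *)
Lemma rho_tilt n m k j :
  (0 < n)%nat ->
  rho n k * (rho n k / rho n (k + j)) ^ m
    = exp (INR m * (INR m + 1) * (IZR j * IZR j) / (2 * (INR n * INR n)))
      * rho n (k + - (Z.of_nat m * j))%Z.
Proof.
  intros Hn. apply lt_0_INR in Hn. unfold rho, Rdiv at 2.
  rewrite <- exp_Ropp, <- exp_plus, <- exp_INR_mult, <- !exp_plus. f_equal.
  rewrite !plus_IZR, opp_IZR, mult_IZR, <- INR_IZR_INZ. field. lra.
Qed.

(** One factor of the ratio changes the measure to the shifted law; the other [m] tilt it into a
    translated Gaussian, whose mass in the window is at most [Zn n K]. *)
Lemma shift_ratio_moment n K J j m :
  (0 < n)%nat -> (Z.abs j <= Z.of_nat J)%Z ->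
  E (gaussZ n (K + J)) (fun k => shift_ratio n K (K + J) k j ^ (S m))
    <= (Zn n (K + J) / Zn n K) ^ m
       * exp (INR m * (INR m + 1) * (IZR j * IZR j) / (2 * (INR n * INR n))).
Proof.
  intros Hn Hj. simpl.
  rewrite <- (E_gaussZ_shift n K J j (fun k => shift_ratio n K (K + J) k j ^ m)) by assumption.
  rewrite E_gaussZ.
  pose proof (Zn_ge_1 n K) as H1. pose proof (Zn_ge_1 n (K + J)) as H2.
  set (c := exp (INR m * (INR m + 1) * (IZR j * IZR j) / (2 * (INR n * INR n)))).
  replace (csum K (fun k => rho n k * shift_ratio n K (K + J) (k + j) j ^ m))
    with ((Zn n (K + J) / Zn n K) ^ m * c *
          wsum (- Z.of_nat K + - (Z.of_nat m * j))%Z (2 * K + 1) (rho n)).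
  - pose proof (wsum_rho_window n K (- (Z.of_nat m * j)) Hn) as Hw.
    assert (0 <= (Zn n (K + J) / Zn n K) ^ m * c).
    { apply Rmult_le_pos; [|left; apply exp_pos]. apply pow_le. left.
      apply Rdiv_lt_0_compat; lra. }
    apply Rmult_le_reg_r with (Zn n K); [lra|].
    unfold Rdiv at 1. rewrite Rmult_assoc, Rinv_l by lra.
    rewrite Rmult_1_r. now apply Rmult_le_compat_l.
  - rewrite <- wsum_shift, <- wsum_scal. apply wsum_ext. intros k Hk.
    unfold shift_ratio. replace (k + j - j)%Z with k by lia.
    destruct (Z.leb_spec (Z.abs k) (Z.of_nat K)); [|lia].
    rewrite Rpow_mult_distr. unfold c. rewrite Rmult_assoc, <- rho_tilt by assumption. ring.
Qed.

Lemma Zn_growth n K J :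
  (0 < n)%nat -> Zn n (K + J) <= Zn n K + 2 * INR J * rho n (Z.of_nat K).
Proof.
  intros Hn. induction J as [|J IH]; [rewrite Nat.add_0_r; simpl; lra|].
  rewrite Nat.add_succ_r, Zn_S, S_INR.
  assert (rho n (Z.of_nat (K + J) + 1) <= rho n (Z.of_nat K)).
  { apply rho_mono; [assumption|nia]. }
  lra.
Qed.

(** This fixes the truncation radius: at [K = 2 n J d] even the crude [exp (- x) <= 1 / x] bounds
    the added mass by [1 / d], so the normalisation ratio stays bounded after [d] coordinates. *)
Lemma Zn_ratio_pow n J d :
  (0 < n)%nat -> (0 < J)%nat -> (0 < d)%nat ->
  let K := (2 * n * J * d)%nat in (Zn n (K + J) / Zn n K) ^ d <= exp 1.
Proof.
  intros Hn HJ Hd K. pose proof (Zn_ge_1 n K) as H1.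
  assert (HnR : 1 <= INR n) by (apply (le_INR 1); lia).
  assert (HJR : 1 <= INR J) by (apply (le_INR 1); lia).
  assert (HdR : 1 <= INR d) by (apply (le_INR 1); lia).
  assert (HK : INR K = 2 * INR n * INR J * INR d) by (unfold K; rewrite !mult_INR; simpl; ring).
  assert (Hrho : 2 * INR J * rho n (Z.of_nat K) <= / INR d).
  { set (x := INR K * INR K / (2 * (INR n * INR n))).
    assert (Hx : x = 2 * (INR J * INR d) * (INR J * INR d)) by (unfold x; rewrite HK; field; lra).
    assert (1 <= INR J * INR d) by nra.
    assert (0 < x) by (rewrite Hx; nra).
    assert (rho n (Z.of_nat K) <= / x).
    { unfold rho. rewrite <- INR_IZR_INZ.
      replace (- (INR K * INR K) / (2 * (INR n * INR n))) with (- x)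
        by (unfold x; field; lra).
      rewrite exp_Ropp. apply Rinv_le_contravar; [assumption|].
      pose proof (exp_ineq1_le x). lra. }
    apply Rle_trans with (2 * INR J * / x); [apply Rmult_le_compat_l; lra|].
    rewrite Hx. apply Rmult_le_reg_r with (INR J * INR d * INR d); [nra|].
    apply Rle_trans with 1; [right; field; lra|].
    replace (/ INR d * (INR J * INR d * INR d)) with (INR J * INR d) by (field; lra). lra. }
  pose proof (Zn_growth n K J Hn) as Hg.
  assert (0 < / INR d) by (apply Rinv_0_lt_compat; lra).
  assert (Hr : Zn n (K + J) / Zn n K <= exp (/ INR d)).
  { apply Rle_trans with (1 + / INR d); [|apply exp_ineq1_le].
    apply Rmult_le_reg_r with (Zn n K); [lra|].
    unfold Rdiv. rewrite Rmult_assoc, Rinv_l, Rmult_1_r by lra. nra. }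
  apply Rle_trans with (exp (/ INR d) ^ d).
  - apply pow_incr. split; [|assumption]. left. apply Rdiv_lt_0_compat; [|lra].
    pose proof (Zn_ge_1 n (K + J)). lra.
  - rewrite <- exp_INR_mult, Rinv_r by lra. lra.
Qed.

(** * Lattice vectors and the product law *)

Fixpoint zadd (z u : list Z) : list Z :=
  match z, u with
  | a :: z', b :: u' => (a + b)%Z :: zadd z' u'
  | _, _ => nil
  end.

Fixpoint bump (i : nat) (e : Z) (u : list Z) : list Z :=
  match u, i with
  | nil, _ => nil
  | a :: u', O => (a + e)%Z :: u'
  | a :: u', S i' => a :: bump i' e u'
  end.

Definition zsq (u : list Z) : R := lsum (fun k => IZR k * IZR k) u.

Definition gauss_lattice (n K d : nat) : fdist (list Z) := iid d (gaussZ n K).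

Fixpoint lattice_ratio (n K K' : nat) (z u : list Z) : R :=
  match z, u with
  | a :: z', b :: u' => shift_ratio n K K' a b * lattice_ratio n K K' z' u'
  | _, _ => 1
  end.

Lemma gauss_lattice_is_fdist n K d : is_fdist (gauss_lattice n K d).
Proof. apply iid_is_fdist, gaussZ_is_fdist. Qed.

Lemma gauss_lattice_length n K d z : supp (gauss_lattice n K d) z -> length z = d.
Proof. intros H. now apply iid_supp in H. Qed.

Lemma lattice_ratio_nonneg n K K' z u : 0 <= lattice_ratio n K K' z u.
Proof.
  revert u. induction z as [|a z IH]; intros [|b u]; simpl; try lra.
  apply Rmult_le_pos; [apply shift_ratio_nonneg|apply IH].
Qed.

Lemma zsq_nonneg u : 0 <= zsq u.
Proof. induction u as [|a u IH]; unfold zsq; simpl; [lra|]. unfold zsq in IH. nra. Qed.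

Lemma E_lattice_shift n K J u phi :
  Forall (fun j => (Z.abs j <= Z.of_nat J)%Z) u ->
  E (gauss_lattice n K (length u)) (fun z => phi (zadd z u))
    = E (gauss_lattice n (K + J) (length u))
        (fun z => lattice_ratio n K (K + J) z u * phi z).
Proof.
  intros H. revert phi. induction H as [|j u Hj _ IH]; intros phi.
  - unfold gauss_lattice, E. simpl. ring.
  - unfold gauss_lattice in *. simpl length. rewrite !E_iid_S. cbn [zadd lattice_ratio].
    set (psi := fun k => E (iid (length u) (gaussZ n (K + J)))
       (fun z => lattice_ratio n K (K + J) z u * phi (k :: z))).
    rewrite (E_ext (gaussZ n K) _ (fun a => psi (a + j)%Z)).
    + rewrite (E_gaussZ_shift n K J j psi) by assumption. unfold psi.
      apply E_ext. intros a _. rewrite <- E_scal. apply E_ext. intros z _. ring.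
    + intros a _. apply (IH (fun z => phi ((a + j)%Z :: z))).
Qed.

Lemma lattice_ratio_moment n K J m u :
  (0 < n)%nat -> Forall (fun j => (Z.abs j <= Z.of_nat J)%Z) u ->
  E (gauss_lattice n (K + J) (length u)) (fun z => lattice_ratio n K (K + J) z u ^ S m)
    <= ((Zn n (K + J) / Zn n K) ^ length u) ^ m
       * exp (INR m * (INR m + 1) * zsq u / (2 * (INR n * INR n))).
Proof.
  intros Hn H. unfold zsq. induction H as [|j u Hj _ IH].
  - unfold gauss_lattice, E. simpl. rewrite !pow1, Rmult_0_r.
    unfold Rdiv. rewrite Rmult_0_l, exp_0. lra.
  - unfold gauss_lattice in *. simpl length. rewrite E_iid_S. cbn [lattice_ratio lsum fold_right].
    rewrite (E_ext _ _ (fun a => E (iid (length u) (gaussZ n (K + J)))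
       (fun z => lattice_ratio n K (K + J) z u ^ S m) * shift_ratio n K (K + J) a j ^ S m)).
    + rewrite E_scal, Rmult_comm.
      pose proof (shift_ratio_moment n K J j m Hn Hj) as Hm.
      eapply Rle_trans; [apply Rmult_le_compat|].
      * apply E_nonneg; [apply gaussZ_is_fdist|]. intros. apply pow_le, shift_ratio_nonneg.
      * apply E_nonneg; [apply gauss_lattice_is_fdist|]. intros. apply pow_le, lattice_ratio_nonneg.
      * exact Hm.
      * exact IH.
      * rewrite <- tech_pow_Rmult, Rpow_mult_distr.
        fold (lsum (fun k => IZR k * IZR k) u).
        set (s := lsum (fun k => IZR k * IZR k) u).
        replace (INR m * (INR m + 1) * (IZR j * IZR j + s) / (2 * (INR n * INR n)))
          with (INR m * (INR m + 1) * (IZR j * IZR j) / (2 * (INR n * INR n))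
             + INR m * (INR m + 1) * s / (2 * (INR n * INR n)))
          by (unfold Rdiv; ring).
        rewrite exp_plus. right. ring.
    + intros a _. rewrite Rmult_comm, <- E_scal. apply E_ext. intros z _.
      apply Rpow_mult_distr.
Qed.

(** Only coordinate [i] moves, so conditioning on the others leaves the one-dimensional bound, free
    of the dimension. *)
Lemma gauss_lattice_neighbour n K B i u phi :
  (0 < n)%nat -> (n <= K)%nat -> (forall z, Rabs (phi z) <= B) -> (i < length u)%nat ->
  Rabs (E (gauss_lattice n K (length u)) (fun z => phi (zadd z (bump i 1 u)))
        - E (gauss_lattice n K (length u)) (fun z => phi (zadd z u))) <= 2 * B / INR n.
Proof.
  intros Hn HK. revert i phi. induction u as [|b u IH]; intros i phi HB Hi;
    [simpl in Hi; lia|].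
  unfold gauss_lattice in *. simpl length. rewrite !E_iid_S.
  destruct i as [|i]; cbn [bump zadd].
  - pose proof (gaussZ_neighbour n K B (fun k => E (iid (length u) (gaussZ n K))
       (fun z => phi ((k + b)%Z :: zadd z u))) Hn HK) as H.
    rewrite (E_ext (gaussZ n K) _ (fun k => E (iid (length u) (gaussZ n K))
       (fun z => phi ((k + 1 + b)%Z :: zadd z u)))).
    + apply H. intros k. rewrite <- (E_const (iid (length u) (gaussZ n K)) B)
        by apply gauss_lattice_is_fdist.
      apply E_abs_le; [apply gauss_lattice_is_fdist|]. intros; apply HB.
    + intros a _. apply E_ext. intros z _. do 2 f_equal. lia.
  - rewrite <- E_minus. rewrite <- (E_const (gaussZ n K) (2 * B / INR n))
      by apply gaussZ_is_fdist.
    apply E_abs_le; [apply gaussZ_is_fdist|]. intros a _.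
    apply (IH i (fun z => phi ((a + b)%Z :: z))); [intros; apply HB|].
    simpl in Hi. lia.
Qed.

Lemma gauss_lattice_second_moment n K d :
  (0 < n)%nat -> E (gauss_lattice n K d) zsq <= INR d * (4 * (INR n * INR n)).
Proof.
  intros Hn. unfold gauss_lattice, zsq. rewrite lsum_E_iid by apply gaussZ_is_fdist.
  apply Rmult_le_compat_l; [apply pos_INR|]. now apply gaussZ_second_moment.
Qed.

(** Above [M] the factor [(w / M) ^ m] is at least 1 and may multiply the excess. *)
Lemma truncation_excess_le w M m : 0 <= w -> 0 < M -> w - Rmin w M <= / M ^ m * w ^ S m.
Proof.
  intros Hw HM. pose proof (pow_lt M m HM) as Hp. destruct (Rle_or_lt w M) as [H|H].
  - rewrite Rmin_left, Rminus_diag by assumption.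
    apply Rmult_le_pos; [left; now apply Rinv_0_lt_compat|now apply pow_le].
  - rewrite Rmin_right by lra. apply Rle_trans with w; [lra|].
    simpl. replace w with (/ M ^ m * (w * M ^ m)) at 1 by (field; lra).
    apply Rmult_le_compat_l; [left; now apply Rinv_0_lt_compat|].
    apply Rmult_le_compat_l; [assumption|]. apply pow_incr. lra.
Qed.

(* Markov's inequality for the [m]-th moment of the likelihood ratio under the shifted law. *)
Lemma lattice_truncation_bias n J m u :
  let d := length u in let K := (2 * n * J * d)%nat in
  (0 < n)%nat -> (0 < J)%nat -> (0 < d)%nat ->
  Forall (fun j => (Z.abs j <= Z.of_nat J)%Z) u ->
  (INR m + 1) * zsq u <= INR n * INR n ->
  E (gauss_lattice n (K + J) d) (fun z => lattice_ratio n K (K + J) z u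
      - Rmin (lattice_ratio n K (K + J) z u) (exp 2)) <= exp (- (INR m / 2)).
Proof.
  intros d K Hn HJ Hd Hu Hm. pose proof (lt_0_INR n Hn) as HnR. pose proof (pos_INR m).
  eapply Rle_trans.
  - apply E_le; [apply gauss_lattice_is_fdist|]. intros z _.
    apply (truncation_excess_le _ _ m); [apply lattice_ratio_nonneg|apply exp_pos].
  - rewrite E_scal.
    pose proof (lattice_ratio_moment n K J m u Hn Hu) as H1.
    pose proof (Zn_ratio_pow n J d Hn HJ Hd) as H2. cbn zeta in H2. fold K d in H1, H2.
    assert (H3 : ((Zn n (K + J) / Zn n K) ^ d) ^ m <= exp 1 ^ m).
    { apply pow_incr. split; [|assumption]. apply pow_le. left.
      pose proof (Zn_ge_1 n K). pose proof (Zn_ge_1 n (K + J)). apply Rdiv_lt_0_compat; lra. }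
    assert (H4 : exp (INR m * (INR m + 1) * zsq u / (2 * (INR n * INR n))) <= exp (INR m / 2)).
    { apply exp_le_compat. apply Rmult_le_reg_r with (2 * (INR n * INR n)); [nra|].
      unfold Rdiv at 1. rewrite Rmult_assoc, Rinv_l, Rmult_1_r by nra.
      replace (INR m / 2 * (2 * (INR n * INR n))) with (INR m * (INR n * INR n)) by field.
      rewrite Rmult_assoc. now apply Rmult_le_compat_l. }
    (* Per moment, the level [exp 2] beats the normalisation [exp 1] and the tilt [exp (1/2)],
       leaving [exp (- 1/2)]. *)
    apply Rle_trans with (/ exp 2 ^ m * (exp 1 ^ m * exp (INR m / 2))).
    + apply Rmult_le_compat_l; [left; apply Rinv_0_lt_compat, pow_lt, exp_pos|].
      eapply Rle_trans; [exact H1|]. apply Rmult_le_compat; try assumption.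
      * apply pow_le, pow_le. left.
        pose proof (Zn_ge_1 n K). pose proof (Zn_ge_1 n (K + J)). apply Rdiv_lt_0_compat; lra.
      * left. apply exp_pos.
    + rewrite <- !exp_INR_mult, <- exp_Ropp, <- !exp_plus. right. f_equal. field.
Qed.

(** * Lattice points as vectors, and finite boxes of them *)

Definition off (d : nat) (eta : R) (z : list Z) : Vec d :=
  mkv d (fun i => eta * IZR (nth i z 0%Z)).

Lemma zadd_nth z u i :
  length z = length u -> nth i (zadd z u) 0%Z = (nth i z 0 + nth i u 0)%Z.
Proof.
  revert u i. induction z as [|a z IH]; intros [|b u] i H; try discriminate.
  - now destruct i.
  - destruct i; [reflexivity|]. simpl. apply IH. now inversion H.
Qed.

Lemma off_zadd d eta z u :
  length z = length u -> off d eta (zadd z u) = vadd (off d eta u) (off d eta z).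
Proof.
  intros H. apply vec_ext. intros i Hi. unfold off.
  rewrite vget_add, !vget_mkv, zadd_nth, plus_IZR by assumption. ring.
Qed.

Lemma bump_length i e u : length (bump i e u) = length u.
Proof.
  revert i. induction u as [|a u IH]; intros [|i]; simpl; try reflexivity.
  now rewrite IH.
Qed.

Lemma bump_nth i e u j :
  (i < length u)%nat ->
  nth j (bump i e u) 0%Z = (nth j u 0 + if Nat.eqb i j then e else 0)%Z.
Proof.
  revert i j. induction u as [|a u IH]; intros i j H; [simpl in H; lia|].
  destruct i as [|i], j as [|j]; simpl; try lia.
  apply IH. simpl in H. lia.
Qed.

Lemma zsq_bump i e u :
  (i < length u)%nat ->
  zsq (bump i e u) = zsq u + 2 * IZR e * IZR (nth i u 0%Z) + IZR e * IZR e.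
Proof.
  unfold zsq. revert i. induction u as [|a u IH]; intros i H; [simpl in H; lia|].
  destruct i as [|i]; simpl.
  - rewrite plus_IZR. ring.
  - rewrite IH by (simpl in H; lia). ring.
Qed.

Lemma norm_off_sqr d eta u :
  length u = d -> norm (off d eta u) * norm (off d eta u) = eta * eta * zsq u.
Proof.
  intros H. rewrite norm_sqr. unfold dot.
  rewrite (rsum_ext d _ (fun i => eta * eta * (IZR (nth i u 0%Z) * IZR (nth i u 0%Z)))).
  - rewrite rsum_scal. f_equal. subst d. unfold zsq.
    induction u as [|a u IH]; [reflexivity|]. simpl length. rewrite rsum_shift.
    simpl. f_equal. apply IH.
  - intros i Hi. unfold off. rewrite vget_mkv by assumption. ring.
Qed.

Lemma nth_sqr_le_zsq i u : IZR (nth i u 0%Z) * IZR (nth i u 0%Z) <= zsq u.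
Proof.
  unfold zsq. revert i. induction u as [|a u IH]; intros [|i]; simpl; try lra.
  - pose proof (zsq_nonneg u). unfold zsq in *. lra.
  - specialize (IH i). nra.
Qed.

Fixpoint zbox (J d : nat) : list (list Z) :=
  match d with
  | O => nil :: nil
  | S d' => flat_map (fun i => map (cons (- Z.of_nat J + Z.of_nat i)%Z) (zbox J d'))
              (seq 0 (2 * J + 1))
  end.

Lemma zbox_In J d u :
  In u (zbox J d) <-> length u = d /\ Forall (fun j => (Z.abs j <= Z.of_nat J)%Z) u.
Proof.
  revert u. induction d as [|d IH]; intros u; simpl zbox.
  - simpl. split.
    + intros [<-|[]]. now split.
    + intros [H _]. left. now destruct u.
  - rewrite in_flat_map. split.
    + intros (i & Hi & H). apply in_map_iff in H. destruct H as (u' & <- & Hu).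
      apply IH in Hu. apply in_seq in Hi. destruct Hu as [<- Hu]. split; [reflexivity|].
      constructor; [lia|assumption].
    + intros [H Hu]. destruct u as [|a u]; [discriminate|]. inversion Hu; subst.
      exists (Z.to_nat (a + Z.of_nat J)). split; [apply in_seq; lia|].
      apply in_map_iff. exists u. split; [f_equal; lia|].
      apply IH. split; [now inversion H|assumption].
Qed.

Lemma zbox_length J d : length (zbox J d) = ((2 * J + 1) ^ d)%nat.
Proof.
  induction d as [|d IH]; [reflexivity|]. cbn [zbox Nat.pow].
  rewrite <- IH. generalize (zbox J d) as l. generalize (2 * J + 1)%nat as k. intros k l.
  transitivity (length (seq 0 k) * length l)%nat; [|now rewrite length_seq].
  induction (seq 0 k) as [|a s IHs]; [reflexivity|].
  simpl. rewrite length_app, length_map, IHs. reflexivity.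
Qed.

Lemma zbox_of_zsq J u :
  zsq u <= INR J * INR J -> Forall (fun j => (Z.abs j <= Z.of_nat J)%Z) u.
Proof.
  intros H. apply Forall_forall. intros j Hj.
  destruct (In_nth _ _ 0%Z Hj) as (i & _ & <-).
  pose proof (nth_sqr_le_zsq i u) as H1. rewrite INR_IZR_INZ in H.
  assert (H2 : IZR (nth i u 0%Z) * IZR (nth i u 0%Z) <= IZR (Z.of_nat J) * IZR (Z.of_nat J)) by lra.
  rewrite <- !mult_IZR in H2. apply le_IZR in H2. nia.
Qed.

(** * Lattice smoothing *)

Definition smooth {d} (n K : nat) (eta : R) (f : Vec d -> R) (y : Vec d) : R :=
  E (gauss_lattice n K d) (fun z => f (vadd y (off d eta z))).

Definition smooth_grad {d} (n K : nat) (eta : R) (g : Vec d -> Vec d) (y : Vec d) : Vec d :=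
  mkv d (fun i => E (gauss_lattice n K d) (fun z => vget (g (vadd y (off d eta z))) i)).

(** Convexity in a form linear in [f] and [g], which averaging over translates preserves. *)
Definition subgradient {d} (f : Vec d -> R) (g : Vec d -> Vec d) : Prop :=
  forall x y, f x + dot (g x) (vsub y x) <= f y.

Lemma dot_E_mkv {A d} (D : fdist A) (X : A -> Vec d) h :
  dot (mkv d (fun i => E D (fun a => vget (X a) i))) h = E D (fun a => dot (X a) h).
Proof.
  unfold dot. rewrite E_rsum. apply rsum_ext. intros i Hi.
  rewrite vget_mkv, Rmult_comm, <- E_scal by assumption.
  apply E_ext. intros. ring.
Qed.

Lemma smooth_subgradient {d} n K eta (f : Vec d -> R) g :
  subgradient f g -> subgradient (smooth n K eta f) (smooth_grad n K eta g).
Proof.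
  intros H x y. unfold smooth, smooth_grad. rewrite dot_E_mkv, <- E_plus.
  apply E_le; [apply gauss_lattice_is_fdist|]. intros z _.
  specialize (H (vadd x (off d eta z)) (vadd y (off d eta z))).
  replace (vsub y x) with (vsub (vadd y (off d eta z)) (vadd x (off d eta z))) by vec_ring.
  exact H.
Qed.

Lemma smooth_lipschitz {d} n K eta (f : Vec d -> R) L :
  lipschitz L f -> lipschitz L (smooth n K eta f).
Proof.
  intros H x y. unfold smooth. rewrite <- E_minus.
  rewrite <- (E_const (gauss_lattice n K d) (L * norm (vsub x y)))
    by apply gauss_lattice_is_fdist.
  apply E_abs_le; [apply gauss_lattice_is_fdist|]. intros z _.
  replace (vsub x y) with (vsub (vadd x (off d eta z)) (vadd y (off d eta z))) by vec_ring.
  apply H.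
Qed.

Lemma smooth_close {d} n K eta (f : Vec d -> R) L y :
  (0 < n)%nat -> (0 < d)%nat -> 0 < eta -> 0 < L -> lipschitz L f ->
  Rabs (smooth n K eta f y - f y) <= L * (2 * (eta * INR n) * sqrt (INR d)).
Proof.
  intros Hn Hd Heta HL H. unfold smooth.
  pose proof (lt_0_INR n Hn) as HnR. pose proof (lt_0_INR d Hd) as HdR.
  pose proof (sqrt_lt_R0 _ HdR) as Hs. pose proof (sqrt_sqrt (INR d) ltac:(lra)) as Hss.
  set (c := 2 * (eta * INR n) * sqrt (INR d)).
  assert (Hc : 0 < c) by (unfold c; apply Rmult_lt_0_compat; nra).
  assert (HD := gauss_lattice_is_fdist n K d).
  rewrite <- (E_const (gauss_lattice n K d) (f y) HD) at 1. rewrite <- E_minus.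
  (* In place of Jensen's inequality: [w <= (c^2 + w^2) / (2 c)], with [c^2] the bound on the second
     moment of the displacement. *)
  apply Rle_trans with
    (E (gauss_lattice n K d) (fun z => L * (c / 2) + L * (eta * eta / (2 * c)) * zsq z)).
  - apply E_abs_le; [assumption|]. intros z Hz. apply gauss_lattice_length in Hz.
    eapply Rle_trans; [apply H|].
    replace (vsub (vadd y (off d eta z)) y) with (off d eta z) by vec_ring.
    pose proof (norm_off_sqr d eta z Hz) as Hsq. set (w := norm (off d eta z)) in *.
    replace (L * (c / 2) + L * (eta * eta / (2 * c)) * zsq z)
      with (L * ((c * c + w * w) / (2 * c))) by (rewrite Hsq; field; lra).
    apply Rmult_le_compat_l; [lra|]. apply Rmult_le_reg_r with (2 * c); [lra|].
    unfold Rdiv. rewrite Rmult_assoc, Rinv_l, Rmult_1_r by lra.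
    pose proof (Rle_0_sqr (c - w)). unfold Rsqr in *. lra.
  - rewrite E_plus, E_const, E_scal by assumption.
    pose proof (gauss_lattice_second_moment n K d Hn) as H2.
    apply Rle_trans with (L * (c / 2) + L * (eta * eta / (2 * c)) * (INR d * (4 * (INR n * INR n)))).
    + apply Rplus_le_compat_l. apply Rmult_le_compat_l; [|assumption].
      apply Rmult_le_pos; [lra|]. left. apply Rdiv_lt_0_compat; nra.
    + right. replace (INR d * (4 * (INR n * INR n))) with (c * c / (eta * eta)); [field; lra|].
      unfold c. rewrite <- Hss at 3. field. lra.
Qed.

Lemma smooth_grad_zadd {d} n K eta (g : Vec d -> Vec d) q u i :
  length u = d -> (i < d)%nat ->
  vget (smooth_grad n K eta g (vadd q (off d eta u))) i
    = E (gauss_lattice n K (length u)) (fun z => vget (g (vadd q (off d eta (zadd z u)))) i).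
Proof.
  intros Hu Hi. unfold smooth_grad. rewrite vget_mkv, Hu by assumption.
  apply E_ext. intros z Hz. apply gauss_lattice_length in Hz.
  rewrite off_zadd by lia. do 2 f_equal. vec_ring.
Qed.

Lemma smooth_grad_neighbour {d} n K eta (g : Vec d -> Vec d) L q u i :
  (0 < n)%nat -> (n <= K)%nat -> (forall x, norm (g x) <= L) ->
  length u = d -> (i < d)%nat ->
  Rabs (vget (smooth_grad n K eta g (vadd q (off d eta (bump i 1 u)))) i
        - vget (smooth_grad n K eta g (vadd q (off d eta u))) i) <= 2 * L / INR n.
Proof.
  intros Hn HK Hg Hu Hi.
  rewrite !smooth_grad_zadd, bump_length by (try rewrite bump_length; assumption).
  apply (gauss_lattice_neighbour n K L i u (fun z => vget (g (vadd q (off d eta z))) i));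
    try assumption; [|lia].
  intros z. eapply Rle_trans; [now apply norm_vget|apply Hg].
Qed.

(** * The ball oracle: a stationary lattice point of a penalised smoothing *)

Lemma list_argmin {A} (phi : A -> R) l :
  l <> nil -> exists a, In a l /\ forall b, In b l -> phi a <= phi b.
Proof.
  induction l as [|a l IH]; [congruence|]. intros _.
  destruct l as [|a' l].
  - exists a. split; [now left|]. intros b [<-|[]]. lra.
  - destruct IH as (b & Hb & Hmin); [discriminate|].
    destruct (Rle_or_lt (phi a) (phi b)) as [H|H].
    + exists a. split; [now left|]. intros c [<-|Hc]; [lra|]. specialize (Hmin c Hc). lra.
    + exists b. split; [now right|]. intros c [<-|Hc]; [lra|auto].
Qed.

Lemma dot_single {d} (x y : Vec d) i c :
  (i < d)%nat -> (forall j, (j < d)%nat -> vget y j = if Nat.eqb i j then c else 0) ->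
  dot x y = c * vget x i.
Proof.
  intros Hi H. unfold dot.
  rewrite (rsum_ext d _ (fun j => if Nat.eqb i j then c * vget x i else 0)).
  - clear H y. revert Hi. generalize (c * vget x i) as a. intros a Hi. clear x.
    induction d as [|d IH]; [lia|]. simpl.
    destruct (Nat.eqb_spec i d) as [->|Hne].
    + rewrite (rsum_ext d _ (fun _ => 0)), rsum_const; [lra|].
      intros j Hj. destruct (Nat.eqb_spec d j); [lia|reflexivity].
    + rewrite IH; [lra|lia].
  - intros j Hj. rewrite H by assumption.
    destruct (Nat.eqb_spec i j) as [->|]; ring.
Qed.

(** Penalty in the squared distance [s] to the query point, flat up to radius [r / 2] and
    dominating [L sqrt s] beyond radius [r]; [mult] is the factor [2 pen'(s)] in its gradient. *)
Definition pen (r L s : R) : R := 2 * L / (r * r * r) * (Rmax 0 (s - r * r / 4) * Rmax 0 (s - r * r / 4)).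

Definition mult (r L s : R) : R := 8 * L / (r * r * r) * Rmax 0 (s - r * r / 4).

Lemma cube_pos r : 0 < r -> 0 < r * r * r.
Proof. intros. assert (0 < r * r) by nra. nra. Qed.

(** The squared positive part lies below its tangent plus [(s' - s)^2]. *)
Lemma pen_upper r L s s' :
  0 < r -> 0 < L ->
  pen r L s' <= pen r L s + mult r L s / 2 * (s' - s)
                + 2 * L / (r * r * r) * ((s' - s) * (s' - s)).
Proof.
  intros Hr HL. unfold pen, mult. set (a := r * r / 4).
  assert (0 < 2 * L / (r * r * r)) by (apply Rdiv_lt_0_compat; [lra|now apply cube_pos]).
  replace (8 * L / (r * r * r)) with (4 * (2 * L / (r * r * r))) by (field; lra).
  set (c := 2 * L / (r * r * r)) in *. set (p := Rmax 0 (s - a)). set (p' := Rmax 0 (s' - a)).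
  assert (p' * p' <= p * p + 2 * p * (s' - s) + (s' - s) * (s' - s)).
  { replace (p * p + 2 * p * (s' - s) + (s' - s) * (s' - s))
      with ((p + (s' - s)) * (p + (s' - s))) by ring.
    assert (p' * p' = 0 \/ 0 <= p' <= p + (s' - s)) as [H0|]; [|rewrite H0; apply Rle_0_sqr|nra].
    unfold p, p', Rmax. repeat destruct Rle_dec; lra. }
  nra.
Qed.

Lemma mult_nonneg r L s : 0 < r -> 0 < L -> 0 <= mult r L s.
Proof.
  intros Hr HL. unfold mult. apply Rmult_le_pos; [|apply Rmax_l].
  left. apply Rdiv_lt_0_compat; [lra|now apply cube_pos].
Qed.

Lemma mult_le r L s : 0 < r -> 0 < L -> s <= r * r -> mult r L s <= 6 * L / r.
Proof.
  intros Hr HL Hs. unfold mult.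
  apply Rle_trans with (8 * L / (r * r * r) * (3 / 4 * (r * r))); [|right; field; lra].
  apply Rmult_le_compat_l.
  - left. apply Rdiv_lt_0_compat; [lra|now apply cube_pos].
  - apply Rmax_lub; nra.
Qed.

Lemma mult_pos_inv r L s : 0 < mult r L s -> r * r / 4 < s.
Proof.
  unfold mult, Rmax. destruct Rle_dec; [|intros; lra].
  intros H. destruct (Req_dec s (r * r / 4)) as [->|]; [|lra].
  rewrite Rminus_diag in H. lra.
Qed.

Lemma pen_large r L t : 0 < r -> 0 < L -> r < t -> L * t < pen r L (t * t).
Proof.
  intros Hr HL Ht. unfold pen. rewrite Rmax_right by nra.
  assert (Hc : 0 < 2 * L / (r * r * r)) by (apply Rdiv_lt_0_compat; [lra|now apply cube_pos]).
  set (w := t * t - r * r / 4).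
  assert (Hw : 3 / 4 * (t * t) <= w) by (unfold w; nra).
  assert (9 / 16 * (t * t * (t * t)) <= w * w) by nra.
  apply Rlt_le_trans with (2 * L / (r * r * r) * (9 / 16 * (t * t * (t * t)))).
  - replace (2 * L / (r * r * r) * (9 / 16 * (t * t * (t * t))))
      with (L * t * (9 / 8 * ((t * t * t) / (r * r * r)))) by (field; lra).
    assert (1 < t * t * t / (r * r * r)).
    { pose proof (cube_pos r Hr). apply Rmult_lt_reg_r with (r * r * r); [assumption|].
      replace (t * t * t / (r * r * r) * (r * r * r)) with (t * t * t) by (field; lra).
      rewrite Rmult_1_l. assert (r * r < t * t) by nra. nra. }
    assert (0 < L * t) by nra. nra.
  - apply Rmult_le_compat_l; lra.
Qed.

(** A minimiser of the penalised function over a box cannot leave the ball, hence competes with all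
    its [2 d] neighbours. Each comparison bounds one coordinate of the penalised gradient from one
    side, with [G] taken at the neighbour; [tau] moves it back to the minimiser. *)
Lemma stationary_lattice_point {d} (F : Vec d -> R) G q n m eta r L tau :
  (0 < n)%nat -> 0 < eta -> 0 < L -> 0 < r -> eta <= r ->
  r * r * (INR m + 1) = eta * eta * (INR n * INR n) ->
  subgradient F G -> lipschitz L F ->
  (forall u i, length u = d -> (i < d)%nat ->
     Rabs (vget (G (vadd q (off d eta (bump i 1 u)))) i - vget (G (vadd q (off d eta u))) i) <= tau) ->
  exists u, length u = d /\ (INR m + 1) * zsq u <= INR n * INR n /\
    norm (vadd (G (vadd q (off d eta u))) (vscale (mult r L (eta * eta * zsq u)) (off d eta u)))
      <= sqrt (INR d) * (21 * L * eta / r + tau).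
Proof.
  intros Hn Heta HL Hr Her Hrn HFG Hlip Htau.
  pose proof (lt_0_INR n Hn) as HnR. pose proof (pos_INR m) as HmR.
  set (P := fun u => F (vadd q (off d eta u)) + pen r L (eta * eta * zsq u)).
  assert (Hnonempty : In (repeat 0%Z d) (zbox (n + 1) d)).
  { apply zbox_In. split; [apply repeat_length|]. apply Forall_forall. intros j Hj.
    apply repeat_spec in Hj. subst. lia. }
  destruct (list_argmin P (zbox (n + 1) d)) as (u & Hu & Hmin).
  { intros H. rewrite H in Hnonempty. destruct Hnonempty. }
  apply zbox_In in Hu. destruct Hu as [Hlen _].
  assert (Hee : 0 < eta * eta) by nra.
  pose proof (zsq_nonneg u) as Hz.
  (* Beyond radius [r] the penalty exceeds all that a Lipschitz function can gain over the
     centre. *)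
  assert (Hin : eta * eta * zsq u <= r * r).
  { apply Rnot_lt_le. intros Hout. specialize (Hmin _ Hnonempty). unfold P in Hmin.
    assert (H0 : zsq (repeat 0%Z d) = 0).
    { unfold zsq. clear. induction d as [|d IH]; simpl; [lra|rewrite IH; lra]. }
    rewrite H0, Rmult_0_r in Hmin.
    assert (Hp0 : pen r L 0 = 0).
    { unfold pen. rewrite Rmax_left by nra. ring. }
    rewrite Hp0 in Hmin.
    pose proof (norm_off_sqr d eta u Hlen) as Ht. set (t := norm (off d eta u)) in *.
    pose proof (norm_nonneg (off d eta u)) as Ht0. fold t in Ht0.
    rewrite <- Ht in Hmin, Hout.
    pose proof (pen_large r L t Hr HL ltac:(nra)) as Hp.
    pose proof (Hlip (vadd q (off d eta (repeat 0%Z d))) (vadd q (off d eta u))) as Hl.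
    replace (vsub (vadd q (off d eta (repeat 0%Z d))) (vadd q (off d eta u)))
      with (vscale (-1) (off d eta u)) in Hl.
    2:{ apply vec_ext. intros i Hi. rewrite vget_scale, vget_sub, !vget_add. unfold off.
        rewrite !vget_mkv, nth_repeat by assumption. ring. }
    rewrite norm_scale, (Rabs_left (-1)) in Hl by lra. fold t in Hl.
    pose proof (Rle_abs (F (vadd q (off d eta (repeat 0%Z d))) - F (vadd q (off d eta u)))).
    lra. }
  assert (Hball : (INR m + 1) * zsq u <= INR n * INR n).
  { apply Rmult_le_reg_l with (eta * eta); [assumption|]. rewrite <- Hrn.
    replace (eta * eta * ((INR m + 1) * zsq u)) with (eta * eta * zsq u * (INR m + 1)) by ring.
    apply Rmult_le_compat_r; lra. }
  exists u. split; [assumption|]. split; [assumption|].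
  set (lam := mult r L (eta * eta * zsq u)).
  assert (Hlam0 : 0 <= lam) by now apply mult_nonneg.
  assert (Hlam1 : lam <= 6 * L / r) by now apply mult_le.
  (* In dimension zero nothing constrains the sign of [tau]; there both sides vanish. *)
  assert (Htau0 : 0 <= 21 * L * eta / r + tau \/ d = 0%nat).
  { destruct d as [|d']; [now right|left].
    assert (0 < 21 * L * eta / r) by (apply Rdiv_lt_0_compat; nra).
    specialize (Htau u 0%nat Hlen ltac:(lia)).
    pose proof (Rabs_pos (vget (G (vadd q (off (S d') eta (bump 0 1 u)))) 0
                         - vget (G (vadd q (off (S d') eta u))) 0)). lra. }
  destruct Htau0 as [Htau0|Hd0].
  2:{ rewrite norm_dim0 by assumption. rewrite Hd0. simpl INR. rewrite sqrt_0. lra. }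
  (* The entries of [u] are at most [n] in size; the box has half-width [n + 1] so as to contain its
     neighbours. *)
  assert (Hubox : forall i e, (i < d)%nat -> (Z.abs e <= 1)%Z -> In (bump i e u) (zbox (n + 1) d)).
  { intros i e Hi He. apply zbox_In. rewrite bump_length. split; [assumption|].
    assert (Hu : Forall (fun j => (Z.abs j <= Z.of_nat n)%Z) u) by (apply zbox_of_zsq; nra).
    apply Forall_forall. intros j Hj. destruct (In_nth _ _ 0%Z Hj) as (k & Hk & <-).
    rewrite bump_nth by lia. rewrite bump_length in Hk. rewrite Forall_forall in Hu.
    specialize (Hu _ (nth_In u 0%Z Hk)). destruct (Nat.eqb i k); lia. }
  (* Comparing the minimiser with its neighbour [u + e e_i] bounds one side of the [i]-th coordinate. *)
  assert (Hside : forall i e, (i < d)%nat -> (e = 1 \/ e = -1)%Z ->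
     - (21 * L * eta / r) <= IZR e * (vget (G (vadd q (off d eta (bump i e u)))) i
                                + lam * (eta * IZR (nth i u 0%Z)))).
  { intros i e Hi He. set (w := bump i e u).
    assert (Heabs : (Z.abs e <= 1)%Z) by lia.
    pose proof (Hmin w (Hubox i e Hi Heabs)) as H1. unfold P in H1.
    set (y := eta * IZR (nth i u 0%Z)).
    assert (Hee1 : IZR e * IZR e = 1) by (destruct He as [-> | ->]; lra).
    pose proof (pen_upper r L (eta * eta * zsq u) (eta * eta * zsq w) Hr HL) as H2.
    fold lam in H2.
    assert (Hdiff : eta * eta * zsq w - eta * eta * zsq u = eta * (2 * IZR e * y + eta)).
    { unfold w, y. rewrite zsq_bump, Hee1 by lia. ring. }
    rewrite Hdiff in H2.
    assert (Hy : - r <= y <= r).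
    { pose proof (nth_sqr_le_zsq i u).
      assert (y * y <= r * r); [|nra].
      unfold y. replace (eta * IZR (nth i u 0%Z) * (eta * IZR (nth i u 0%Z)))
        with (eta * eta * (IZR (nth i u 0%Z) * IZR (nth i u 0%Z))) by ring. nra. }
    pose proof (HFG (vadd q (off d eta w)) (vadd q (off d eta u))) as H3.
    rewrite (dot_single _ _ i (- (eta * IZR e))) in H3 by
      (try assumption; intros j Hj; rewrite vget_sub, !vget_add; unfold off;
       rewrite !vget_mkv by assumption; unfold w; rewrite bump_nth by lia;
       destruct (Nat.eqb i j); rewrite plus_IZR; ring).
    set (Gi := vget (G (vadd q (off d eta w))) i) in *.
    (* The squared distance changes by at most [3 r eta], so the quadratic remainder gives 18 of the
       constant 21; the other 3 come from [lam <= 6 L / r] in the linear term. *)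
    assert (H4 : 2 * L / (r * r * r) * (eta * (2 * IZR e * y + eta) * (eta * (2 * IZR e * y + eta)))
       <= eta * (18 * L * eta / r)).
    { assert ((2 * IZR e * y + eta) * (2 * IZR e * y + eta) <= 9 * (r * r)).
      { assert (- (3 * r) <= 2 * IZR e * y + eta <= 3 * r); [|nra].
        destruct He as [-> | ->]; lra. }
      apply Rle_trans with (2 * L / (r * r * r) * (eta * eta * (9 * (r * r)))).
      - apply Rmult_le_compat_l; [left; apply Rdiv_lt_0_compat; [lra|now apply cube_pos]|].
        nra.
      - right. field. lra. }
    assert (H5 : lam / 2 * (eta * (2 * IZR e * y + eta)) <= eta * (IZR e * (lam * y) + 3 * L * eta / r)).
    { replace (lam / 2 * (eta * (2 * IZR e * y + eta)))
        with (eta * (IZR e * (lam * y) + lam * (eta / 2))) by field.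
      apply Rmult_le_compat_l; [lra|]. apply Rplus_le_compat_l.
      apply Rle_trans with (6 * L / r * (eta / 2)); [apply Rmult_le_compat_r; lra|].
      right. field. lra. }
    assert (H6 : eta * (- (21 * L * eta / r)) <= eta * (IZR e * (Gi + lam * y))).
    { replace (21 * L * eta / r) with (18 * L * eta / r + 3 * L * eta / r) by (field; lra).
      lra. }
    apply Rmult_le_reg_l in H6; assumption. }
  apply norm_le_coord; [assumption|]. intros i Hi.
  rewrite vget_add, vget_scale. unfold off at 2. rewrite vget_mkv by assumption.
  pose proof (Hside i 1%Z Hi ltac:(now left)) as H1.
  pose proof (Hside i (-1)%Z Hi ltac:(now right)) as H2.
  pose proof (Htau u i Hlen Hi) as H3.
  pose proof (Htau (bump i (-1) u) i ltac:(now rewrite bump_length) Hi) as H4.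
  replace (bump i 1 (bump i (-1) u)) with u in H4.
  2:{ apply (nth_ext _ _ 0%Z 0%Z); [now rewrite !bump_length|]. intros j _.
      rewrite !bump_nth by (rewrite ?bump_length; lia). destruct (Nat.eqb i j); lia. }
  fold lam. set (y := eta * IZR (nth i u 0%Z)) in *.
  set (g0 := vget (G (vadd q (off d eta u))) i) in *.
  set (g1 := vget (G (vadd q (off d eta (bump i 1 u)))) i) in *.
  set (g2 := vget (G (vadd q (off d eta (bump i (-1) u)))) i) in *.
  pose proof (Rle_abs (g1 - g0)). pose proof (Rle_abs (g0 - g2)).
  apply Rabs_le. lra.
Qed.

(** * Estimating the smoothed gradient on a whole ball from one round of samples *)

Definition trunc_ratio (n K K' : nat) (z u : list Z) : R :=
  Rmin (lattice_ratio n K K' z u) (exp 2).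

Definition estimate {d} (n K K' : nat) (ps : list (list Z * Vec d)) (u : list Z) : Vec d :=
  mkv d (fun i => lsum (fun p => trunc_ratio n K K' (fst p) u * vget (snd p) i) ps
                  / INR (length ps)).

Definition answers {d} (eta : R) (g : Vec d -> Vec d) (q : Vec d) (S : list (list Z)) :
  list (list Z * Vec d) := map (fun z => (z, g (vadd q (off d eta z)))) S.

Lemma trunc_ratio_bounds n K K' z u : 0 <= trunc_ratio n K K' z u <= exp 2.
Proof.
  unfold trunc_ratio. split; [|apply Rmin_r].
  apply Rmin_glb; [apply lattice_ratio_nonneg|left; apply exp_pos].
Qed.

Lemma lsum_rsum_swap {A} (c : A -> nat -> R) d l :
  rsum d (fun i => lsum (fun a => c a i) l) = lsum (fun a => rsum d (c a)) l.
Proof.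
  induction l as [|a l IH]; simpl.
  - rewrite rsum_const. ring.
  - rewrite rsum_plus, IH. reflexivity.
Qed.

Lemma lsum_scal {A} (X : A -> R) c l : lsum (fun a => X a * c) l = lsum X l * c.
Proof. induction l as [|a l IH]; simpl; [ring|]. rewrite IH. ring. Qed.

Lemma lsum_map {A B} (X : B -> R) (k : A -> B) l : lsum X (map k l) = lsum (fun a => X (k a)) l.
Proof. induction l as [|a l IH]; simpl; [reflexivity|]. now rewrite IH. Qed.

Lemma dot_estimate {d} n K K' eta (g : Vec d -> Vec d) q S u h :
  dot (estimate n K K' (answers eta g q S) u) h
    = lsum (fun z => trunc_ratio n K K' z u * dot (g (vadd q (off d eta z))) h) S
      / INR (length S).
Proof.
  unfold dot, estimate, answers. rewrite length_map.
  rewrite (rsum_ext d _ (fun i => / INR (length S) *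
     lsum (fun z => trunc_ratio n K K' z u * (vget (g (vadd q (off d eta z))) i * vget h i)) S)).
  - rewrite rsum_scal, (lsum_rsum_swap (fun z i =>
      trunc_ratio n K K' z u * (vget (g (vadd q (off d eta z))) i * vget h i))).
    unfold Rdiv. rewrite Rmult_comm. f_equal.
    induction S as [|z S IH]; simpl; [reflexivity|]. rewrite IH, rsum_scal. reflexivity.
  - intros i Hi. rewrite vget_mkv, lsum_map by assumption. simpl.
    unfold Rdiv. rewrite Rmult_assoc, Rmult_comm, Rmult_assoc. f_equal.
    rewrite Rmult_comm, <- lsum_scal.
    induction S as [|z S IH]; simpl; [reflexivity|]. rewrite IH. ring.
Qed.

Definition trunc_mean {d} (n K K' : nat) (eta : R) (g : Vec d -> Vec d) (q : Vec d)
  (u : list Z) : Vec d :=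
  mkv d (fun i => E (gauss_lattice n K' d)
    (fun z => vget (vscale (trunc_ratio n K K' z u) (g (vadd q (off d eta z)))) i)).

Lemma dot_trunc_mean {d} n K K' eta (g : Vec d -> Vec d) q u h :
  dot (trunc_mean n K K' eta g q u) h
    = E (gauss_lattice n K' d)
        (fun z => trunc_ratio n K K' z u * dot (g (vadd q (off d eta z))) h).
Proof.
  unfold trunc_mean. rewrite dot_E_mkv. apply E_ext. intros. apply dot_scale_l.
Qed.

(** Testing the bias [e] against itself makes the problem scalar: after the change of measure
    [dot e e] averages the truncated excess times [dot (g _) e], whose size is at most [L * norm e].
    No dimension factor arises. *)
Lemma trunc_mean_bias {d} n J m eta (g : Vec d -> Vec d) q L u :
  let K := (2 * n * J * d)%nat in
  (0 < n)%nat -> (0 < J)%nat -> (0 < d)%nat -> 0 < L -> (forall x, norm (g x) <= L) ->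
  length u = d -> Forall (fun j => (Z.abs j <= Z.of_nat J)%Z) u ->
  (INR m + 1) * zsq u <= INR n * INR n ->
  norm (vsub (trunc_mean n K (K + J) eta g q u) (smooth_grad n K eta g (vadd q (off d eta u))))
    <= L * exp (- (INR m / 2)).
Proof.
  intros K Hn HJ Hd HL Hg Hu HuJ Hm.
  set (e := vsub _ _).
  set (phi := fun z => dot (g (vadd q (off d eta z))) e).
  assert (Hphi : forall z, Rabs (phi z) <= L * norm e).
  { intros z. eapply Rle_trans; [apply dot_abs_le_norm|].
    apply Rmult_le_compat_r; [apply norm_nonneg|apply Hg]. }
  assert (HG : dot (smooth_grad n K eta g (vadd q (off d eta u))) e
     = E (gauss_lattice n (K + J) d) (fun z => lattice_ratio n K (K + J) z u * phi z)).
  { unfold smooth_grad. rewrite dot_E_mkv.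
    transitivity (E (gauss_lattice n K (length u)) (fun z => phi (zadd z u))).
    - rewrite Hu. apply E_ext. intros z Hz. apply gauss_lattice_length in Hz.
      unfold phi. rewrite off_zadd by lia. do 2 f_equal. vec_ring.
    - rewrite (E_lattice_shift n K J) by assumption. now rewrite Hu. }
  pose proof (norm_nonneg e) as He.
  assert (H : norm e * norm e <= L * exp (- (INR m / 2)) * norm e).
  { rewrite norm_sqr. unfold e at 1. rewrite dot_sub_l, dot_trunc_mean, HG, <- E_minus.
    eapply Rle_trans; [apply Rle_abs|].
    apply Rle_trans with (E (gauss_lattice n (K + J) d) (fun z => L * norm e *
      (lattice_ratio n K (K + J) z u - Rmin (lattice_ratio n K (K + J) z u) (exp 2)))).
    - apply E_abs_le; [apply gauss_lattice_is_fdist|]. intros z _. fold (phi z).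
      rewrite <- Rmult_minus_distr_r, Rabs_mult, Rmult_comm.
      apply Rmult_le_compat; try apply Rabs_pos; [apply Hphi|].
      unfold trunc_ratio. rewrite Rabs_minus_sym, Rabs_pos_eq; [lra|].
      pose proof (Rmin_l (lattice_ratio n K (K + J) z u) (exp 2)). lra.
    - rewrite E_scal.
      pose proof (lattice_truncation_bias n J m u) as Hb. cbn zeta in Hb.
      rewrite Hu in Hb. specialize (Hb Hn HJ Hd HuJ Hm). fold K in Hb.
      replace (L * exp (- (INR m / 2)) * norm e) with (L * norm e * exp (- (INR m / 2))) by ring.
      apply Rmult_le_compat_l; [nra|assumption]. }
  assert (0 < L * exp (- (INR m / 2))) by (apply Rmult_lt_0_compat; [assumption|apply exp_pos]).
  apply Rnot_lt_le. intros Hlt. nra.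
Qed.

Lemma sqrt_INR_le d : (0 < d)%nat -> sqrt (INR d) <= INR d.
Proof.
  intros Hd. assert (1 <= INR d) by (apply (le_INR 1); lia).
  rewrite <- (sqrt_square (INR d)) at 2 by lra. apply sqrt_le_1_alt. nra.
Qed.

(* Rounding [2 d e / |e|] to the integer lattice yields a direction from a finite family along
   which [e] is seen up to a constant factor. *)
Lemma integer_direction {d} (e : Vec d) delta :
  (0 < d)%nat -> 0 < delta -> delta < norm e ->
  exists h, In h (zbox (2 * d + 1) d) /\ norm (off d 1 h) <= 3 * INR d /\
    INR d * delta <= dot e (off d 1 h).
Proof.
  intros Hd Hdelta He. assert (HdR : 1 <= INR d) by (apply (le_INR 1); lia).
  set (x := vscale (2 * INR d / norm e) e).
  set (h := map (fun i => Int_part (vget x i)) (seq 0 d)).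
  assert (Hh : forall i, (i < d)%nat -> nth i h 0%Z = Int_part (vget x i)).
  { intros i Hi. unfold h.
    rewrite (nth_indep _ 0%Z (Int_part (vget x 0))) by now rewrite length_map, length_seq.
    rewrite (map_nth (fun i => Int_part (vget x i))), seq_nth by assumption. reflexivity. }
  assert (Hfl : forall i, (i < d)%nat -> IZR (nth i h 0%Z) <= vget x i < IZR (nth i h 0%Z) + 1).
  { intros i Hi. rewrite Hh by assumption. pose proof (base_Int_part (vget x i)). lra. }
  assert (Hx : norm x = 2 * INR d).
  { unfold x. rewrite norm_scale, Rabs_pos_eq; [field; lra|].
    left. apply Rdiv_lt_0_compat; lra. }
  set (w := vsub (off d 1 h) x).
  assert (Hw : norm w <= INR d).
  { eapply Rle_trans; [apply (norm_le_coord w 1); [lra|]|rewrite Rmult_1_r; now apply sqrt_INR_le].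
    intros i Hi. unfold w, off. rewrite vget_sub, vget_mkv by assumption.
    specialize (Hfl i Hi). apply Rabs_le. lra. }
  assert (Hoff : off d 1 h = vadd x w) by (unfold w; vec_ring).
  exists h. split; [|split].
  - apply zbox_In. split; [unfold h; now rewrite length_map, length_seq|].
    apply Forall_forall. intros j Hj. destruct (In_nth _ _ 0%Z Hj) as (i & Hi & <-).
    unfold h in Hi. rewrite length_map, length_seq in Hi. specialize (Hfl i Hi).
    pose proof (norm_vget x i Hi) as Hv. rewrite Hx in Hv.
    pose proof (Rle_abs (vget x i)). pose proof (Rle_abs (- vget x i)) as H2.
    rewrite Rabs_Ropp in H2.
    assert (HdZ : INR d = IZR (Z.of_nat d)) by apply INR_IZR_INZ. rewrite HdZ in *.
    assert (nth i h 0 <= 2 * Z.of_nat d)%Z by (apply le_IZR; rewrite mult_IZR; lra).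
    assert (-2 * Z.of_nat d - 1 < nth i h 0 + 0)%Z; [|lia].
    apply lt_IZR. rewrite minus_IZR, plus_IZR, mult_IZR. lra.
  - rewrite Hoff. eapply Rle_trans; [apply norm_triang|]. lra.
  - rewrite Hoff, dot_add_r. unfold x. rewrite dot_scale_r, <- norm_sqr.
    pose proof (dot_abs_le_norm e w) as Hb. pose proof (Rle_abs (- dot e w)) as H2.
    rewrite Rabs_Ropp in H2.
    replace (2 * INR d / norm e * (norm e * norm e)) with (2 * INR d * norm e) by (field; lra).
    assert (norm e * norm w <= norm e * INR d) by (apply Rmult_le_compat_l; lra).
    assert (INR d * delta <= INR d * norm e) by (apply Rmult_le_compat_l; lra). lra.
Qed.

(** Uniformity in [u] covers both the stationary point, placed by the unknown function, and the
    point selected after seeing the samples. *)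
Definition good_round {d} (n K K' m : nat) (eta delta : R) (g : Vec d -> Vec d) (q : Vec d)
  (S : list (list Z)) : Prop :=
  forall u, In u (zbox (n + 1) d) -> (INR m + 1) * zsq u <= INR n * INR n ->
    norm (vsub (estimate n K K' (answers eta g q S) u)
               (smooth_grad n K eta g (vadd q (off d eta u)))) <= 2 * delta.

(** Of the tolerance [2 * delta], truncation bias uses one half and sampling the other. Along an
    integer direction the deviation [d * delta] and the range [3 d L exp 2] both scale with [d],
    which cancels in Hoeffding's exponent; [144 = 16 * 3^2]. *)
Lemma bad_round_probability {d} n m N eta (g : Vec d -> Vec d) q L delta :
  let J := (n + 1)%nat in let K := (2 * n * J * d)%nat in
  (0 < n)%nat -> (0 < d)%nat -> (0 < N)%nat -> 0 < L -> 0 < delta <= L ->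
  (forall x, norm (g x) <= L) -> L * exp (- (INR m / 2)) <= delta ->
  E (iid N (gauss_lattice n (K + J) d))
    (fun S => indic (~ good_round n K (K + J) m eta delta g q S))
  <= INR (length (list_prod (zbox (n + 1) d) (zbox (2 * d + 1) d)))
     * exp (- (INR N * (delta * delta / (144 * (L * L * (exp 2 * exp 2)))))).
Proof.
  intros J K Hn Hd HN HL Hdelta Hg Hm.
  assert (HD := gauss_lattice_is_fdist n (K + J) d). set (D := gauss_lattice n (K + J) d) in *.
  assert (HNR := lt_0_INR N HN). assert (HdR : 1 <= INR d) by (apply (le_INR 1); lia).
  assert (He2 : 1 <= exp 2) by (pose proof (exp_ineq1_le 2); lra).
  set (X := fun (uh : list Z * list Z) z =>
    trunc_ratio n K (K + J) z (fst uh) * dot (g (vadd q (off d eta z))) (off d 1 (snd uh))).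
  (* The norm condition empties the events at directions near the corners of the box, where the
     range would be too large. *)
  set (P := fun uh S => norm (off d 1 (snd uh)) <= 3 * INR d /\
    INR N * (INR d * delta) <= lsum (X uh) S - INR N * E D (X uh)).
  eapply Rle_trans; [|apply (E_indic_exists (iid N D) _ P)].
  - apply E_le; [now apply iid_is_fdist|]. intros S HS. apply indic_mono. intros Hbad.
    apply iid_supp in HS. destruct HS as [HS _].
    apply NNPP. intros Hno. apply Hbad. intros u Hu Hmu.
    assert (HuJ := proj1 (zbox_In _ _ _) Hu). destruct HuJ as [Hlen HuJ].
    pose proof (trunc_mean_bias n J m eta g q L u Hn ltac:(unfold J; lia) Hd HL Hg Hlen HuJ Hmu) as Hb.
    cbn zeta in Hb. fold K in Hb.
    set (mu := trunc_mean n K (K + J) eta g q u) in *.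
    set (Gu := smooth_grad n K eta g (vadd q (off d eta u))) in *.
    set (ghat := estimate n K (K + J) (answers eta g q S) u).
    assert (Hest : norm (vsub ghat mu) <= delta).
    { apply Rnot_lt_le. intros Hlt.
      destruct (integer_direction _ delta Hd ltac:(lra) Hlt) as (h & Hh & Hhn & Hdot).
      apply Hno. exists (u, h). split; [now apply in_prod|]. split; [exact Hhn|].
      rewrite dot_sub_l in Hdot. unfold ghat, mu in Hdot.
      rewrite dot_estimate, dot_trunc_mean, HS in Hdot.
      unfold X. cbn [fst snd]. fold D in Hdot.
      apply Rmult_le_compat_l with (r := INR N) in Hdot; [|lra].
      rewrite Rmult_minus_distr_l in Hdot.
      match type of Hdot with _ <= INR N * (?a / INR N) - _ =>
        replace (INR N * (a / INR N)) with a in Hdot by (field; lra) end.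
      exact Hdot. }
    replace (vsub ghat Gu) with (vadd (vsub ghat mu) (vsub mu Gu)) by vec_ring.
    eapply Rle_trans; [apply norm_triang|]. lra.
  - now apply iid_is_fdist.
  - intros [u h] _.
    destruct (Rle_or_lt (norm (off d 1 h)) (3 * INR d)) as [Hh|Hh].
    + set (b := exp 2 * (L * (3 * INR d))).
      assert (Hb : INR d * delta <= b).
      { unfold b. apply Rle_trans with (1 * (INR d * L)); [rewrite Rmult_1_l; apply Rmult_le_compat_l; lra|].
        apply Rmult_le_compat; nra. }
      eapply Rle_trans; [|eapply Rle_trans; [apply (hoeffding D (X (u, h)) b (INR d * delta) N HD)|]].
      * apply E_le; [now apply iid_is_fdist|]. intros S _. apply indic_mono. now intros [_ H].
      * intros z _. unfold X. cbn [fst snd]. rewrite Rabs_mult.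
        pose proof (trunc_ratio_bounds n K (K + J) z u).
        apply Rmult_le_compat; try apply Rabs_pos; [rewrite Rabs_pos_eq; lra|].
        eapply Rle_trans; [apply dot_abs_le_norm|].
        apply Rmult_le_compat; try apply norm_nonneg; [apply Hg|exact Hh].
      * split; [|exact Hb]. apply Rmult_lt_0_compat; lra.
      * right. f_equal. f_equal. f_equal. unfold b. field. pose proof (exp_pos 2). lra.
    + rewrite (E_ext _ _ (fun _ => 0)).
      * rewrite E_const by now apply iid_is_fdist. left. apply exp_pos.
      * intros S _. apply indic_false. unfold P. cbn [snd]. intros [H _]. lra.
Qed.

(** * Adaptive Monteiro-Svaiter acceleration *)

(** [sl] is the guess, made before the oracle call, of the multiplier that the ball oracle
    will return. *)
Record ms_state (d : nat) : Type := MS { sA : R; sx : Vec d; sv : Vec d; sl : R }.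
Arguments MS {d}.
Arguments sA {d}.
Arguments sx {d}.
Arguments sv {d}.
Arguments sl {d}.

(** The positive root [a] of [l a^2 = A + a]. *)
Definition ms_gain (A l : R) : R := (1 + sqrt (1 + 4 * l * A)) / (2 * l).

Definition ms_query {d} (st : ms_state d) : Vec d :=
  let a := ms_gain (sA st) (sl st) in
  vscale (/ (sA st + a)) (vadd (vscale (sA st) (sx st)) (vscale a (sv st))).

(** A Monteiro-Svaiter step without line search. Damping by [gam] enforces [gam * lam <= sl st],
    which is what the energy estimate requires; the factor [exp 1] moves the logarithm of the guess
    by exactly 1. Freezing beyond [Amax] limits the accumulated oracle error. *)
Definition ms_next {d} (Amax : R) (st : ms_state d) (xt : Vec d) (lam : R) : ms_state d :=
  if Rle_dec Amax (sA st) then st else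
  let a := ms_gain (sA st) (sl st) in
  let gam := if Rle_dec lam (sl st) then 1 else sl st / lam in
  let A' := sA st + gam * a in
  MS A'
     (vscale (/ A') (vadd (vscale ((1 - gam) * sA st) (sx st)) (vscale (gam * (sA st + a)) xt)))
     (vadd (sv st) (vscale (gam * a * lam) (vsub xt (ms_query st))))
     (if Rle_dec lam (sl st) then sl st / exp 1 else sl st * exp 1).

Definition ms_energy {d} (F : Vec d -> R) (xs : Vec d) (st : ms_state d) : R :=
  sA st * (F (sx st) - F xs) + dot (vsub (sv st) xs) (vsub (sv st) xs) / 2.

(** [ba_far] makes positive multipliers useful: the energy dissipated by a step is proportional to
    the squared displacement. *)
Record ball_answer {d} (G : Vec d -> Vec d) (delta r lmax : R) (q xt : Vec d) (lam : R) : Prop := {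
  ba_stationary : norm (vadd (G xt) (vscale lam (vsub xt q))) <= delta;
  ba_near : norm (vsub xt q) <= r;
  ba_mult : 0 <= lam <= lmax;
  ba_far : 0 < lam -> r / 2 <= norm (vsub xt q)
}.

Lemma ms_gain_spec A l :
  0 <= A -> 0 < l -> 0 < ms_gain A l /\ l * (ms_gain A l * ms_gain A l) = A + ms_gain A l.
Proof.
  intros HA Hl. unfold ms_gain. assert (0 <= 4 * l * A) by nra.
  pose proof (sqrt_pos (1 + 4 * l * A)).
  pose proof (sqrt_sqrt (1 + 4 * l * A) ltac:(lra)) as Hs.
  set (s := sqrt (1 + 4 * l * A)) in *. split; [apply Rdiv_lt_0_compat; lra|].
  replace A with ((s * s - 1) / (4 * l)) by (rewrite Hs; field; lra). field. lra.
Qed.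

Lemma subgradient_convex_combination {d} (F : Vec d -> R) G al be x y z :
  subgradient F G -> 0 <= al -> 0 <= be -> 0 < al + be ->
  z = vscale (/ (al + be)) (vadd (vscale al x) (vscale be y)) ->
  (al + be) * F z <= al * F x + be * F y.
Proof.
  intros H Ha Hb Hab ->. set (z := vscale _ _).
  pose proof (H z x) as Hx. pose proof (H z y) as Hy.
  rewrite dot_sub_r in Hx, Hy.
  assert (Hz : (al + be) * dot (G z) z = al * dot (G z) x + be * dot (G z) y).
  { unfold z at 2. dot_expand. field. lra. }
  assert (al * (F z + (dot (G z) x - dot (G z) z)) <= al * F x) by (apply Rmult_le_compat_l; lra).
  assert (be * (F z + (dot (G z) y - dot (G z) z)) <= be * F y) by (apply Rmult_le_compat_l; lra).
  lra.
Qed.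

(** The subgradient inequalities at [xt] towards [sx st] and [xs], weighted by [A] and [a], combine
    because [(A + a) q = A x + a v]. The cross term with [v - xs] cancels against the move of [v],
    and half of the dissipation survives. *)
Lemma ms_next_energy {d} (F : Vec d -> R) G xs delta r lmax Amax st xt lam :
  let a := ms_gain (sA st) (sl st) in
  let gam := if Rle_dec lam (sl st) then 1 else sl st / lam in
  let st' := ms_next Amax st xt lam in
  let D := vsub xt (ms_query st) in
  subgradient F G -> 0 < sA st < Amax -> 0 < sl st ->
  ball_answer G delta r lmax (ms_query st) xt lam ->
  ms_energy F xs st' + gam * (sA st + a) * lam * dot D D / 2
    <= ms_energy F xs st + delta * (sA st' * r + (sA st' - sA st) * norm (vsub (sv st) xs)).
Proof.
  intros a gam st' D HFG HA Hl [Hstat Hnear Hlam Hfar].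
  destruct (ms_gain_spec (sA st) (sl st)) as [Ha Hroot]; [lra|lra|]. fold a in Ha, Hroot.
  assert (Hgam : 0 < gam <= 1 /\ gam * lam <= sl st).
  { unfold gam. destruct (Rle_dec lam (sl st)) as [H|H]; [lra|]. split; [split|].
    - apply Rdiv_lt_0_compat; lra.
    - apply Rmult_le_reg_r with lam; [lra|]. unfold Rdiv.
      rewrite Rmult_assoc, Rinv_l by lra. lra.
    - unfold Rdiv. rewrite Rmult_assoc, Rinv_l by lra. lra. }
  destruct Hgam as [Hgam Hgl].
  set (q := ms_query st) in *.
  assert (HsA : sA st' = sA st + gam * a).
  { unfold st', ms_next. destruct (Rle_dec Amax (sA st)); [lra|reflexivity]. }
  set (w := vadd (G xt) (vscale lam D)). fold D in Hstat, Hnear. fold w in Hstat.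
  set (V := vsub (sv st) xs).
  set (A := sA st) in *. set (x := sx st).
  assert (Hx' : (sA st') * F (sx st') <= (1 - gam) * A * F x + gam * (A + a) * F xt).
  { replace (sA st') with ((1 - gam) * A + gam * (A + a)) by (rewrite HsA; ring).
    apply (subgradient_convex_combination F G);
      [assumption|apply Rmult_le_pos; lra|apply Rmult_le_pos; lra|nra|].
    unfold st', ms_next. fold A. destruct (Rle_dec Amax A); [lra|]. cbn [sx]. fold a gam x.
    f_equal. f_equal. ring. }
  assert (Hv' : vsub (sv st') xs = vadd V (vscale (gam * a * lam) D)).
  { unfold st', ms_next. fold A. destruct (Rle_dec Amax A); [lra|]. cbn [sv]. fold a gam q D.
    unfold V. vec_ring. }
  assert (Hq : forall h, (A + a) * dot h q = A * dot h x + a * dot h (sv st)).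
  { intros h. unfold q, ms_query. fold A a. dot_expand. fold x. field. lra. }
  pose proof (HFG xt x) as H1. pose proof (HFG xt xs) as H2.
  rewrite dot_sub_r in H1, H2.
  assert (HwD : dot (G xt) D = dot w D - lam * dot D D)
    by (unfold w; rewrite dot_add_l, dot_scale_l; ring).
  assert (HwV : dot (G xt) V = dot w V - lam * dot D V)
    by (unfold w; rewrite dot_add_l, dot_scale_l; ring).
  assert (Hcomb : (A + a) * dot (G xt) xt - A * dot (G xt) x - a * dot (G xt) xs
     = (A + a) * (dot w D - lam * dot D D) + a * (dot w V - lam * dot D V)).
  { rewrite <- HwD, <- HwV. unfold D, V. rewrite !dot_sub_r.
    rewrite !Rmult_minus_distr_l, Hq. ring. }
  assert (H3 : (A + a) * (F xt - F xs) - A * (F x - F xs)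
     <= (A + a) * (dot w D - lam * dot D D) + a * (dot w V - lam * dot D V)).
  { rewrite <- Hcomb.
    assert (A * (F xt + (dot (G xt) x - dot (G xt) xt)) <= A * F x) by (apply Rmult_le_compat_l; lra).
    assert (a * (F xt + (dot (G xt) xs - dot (G xt) xt)) <= a * F xs) by (apply Rmult_le_compat_l; lra).
    lra. }
  assert (Hdel : 0 <= delta) by (eapply Rle_trans; [apply (norm_nonneg w)|exact Hstat]).
  pose proof (norm_nonneg V) as HV0. pose proof (norm_nonneg D) as HD0.
  assert (HwD' : dot w D <= delta * r).
  { eapply Rle_trans; [apply dot_le_norm|]. apply Rmult_le_compat; try assumption; apply norm_nonneg. }
  assert (HwV' : dot w V <= delta * norm V).
  { eapply Rle_trans; [apply dot_le_norm|]. apply Rmult_le_compat_r; assumption. }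
  pose proof (dot_self_nonneg D) as HDD.
  (* The new quadratic term of [v] is absorbed by [l a^2 = A + a] and [gam * lam <= l]. *)
  assert (Hquad : (gam * a * lam) * (gam * a * lam) * dot D D <= gam * (A + a) * lam * dot D D).
  { apply Rmult_le_compat_r; [assumption|]. rewrite <- Hroot.
    replace (gam * a * lam * (gam * a * lam)) with ((gam * lam) * (a * a) * (gam * lam)) by ring.
    replace (gam * (sl st * (a * a)) * lam) with ((gam * lam) * (a * a) * sl st) by ring.
    apply Rmult_le_compat_l; [|assumption]. apply Rmult_le_pos; nra. }
  unfold ms_energy. fold x A V. rewrite Hv'.
  rewrite dot_add_l, !dot_add_r, !dot_scale_l, !dot_scale_r, (dot_comm V D).
  assert (H4 : gam * ((A + a) * (F xt - F xs) - A * (F x - F xs))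
    <= gam * ((A + a) * (delta * r - lam * dot D D) + a * (delta * norm V - lam * dot D V))).
  { apply Rmult_le_compat_l; [lra|]. eapply Rle_trans; [exact H3|].
    apply Rplus_le_compat; apply Rmult_le_compat_l; lra. }
  assert (H5 : delta * (gam * (A + a) * r) <= delta * (sA st' * r)).
  { assert (0 <= r) by lra. apply Rmult_le_compat_l; [assumption|].
    apply Rmult_le_compat_r; [assumption|]. rewrite HsA. nra. }
  assert (H6 : sA st' * F xs = (1 - gam) * A * F xs + gam * (A + a) * F xs) by (rewrite HsA; ring).
  replace (sA st' - A) with (gam * a) by (rewrite HsA; ring).
  rewrite Rmult_minus_distr_l, H6. 
  set (c := gam * a * lam) in *.
  replace (delta * (sA st' * r + gam * a * norm V))
    with (delta * (sA st' * r) + gam * a * (delta * norm V)) by ring.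
  assert (H7 : c * dot D V = gam * a * (lam * dot D V)) by (unfold c; ring).
  replace (dot V V + c * dot D V + (c * dot D V + c * (c * dot D D)))
    with (dot V V + 2 * (gam * a * (lam * dot D V)) + c * c * dot D D) by (rewrite <- H7; ring).
  lra.
Qed.

(** * Counting the accelerated steps *)

Lemma ln_le_sub1 x : 0 < x -> ln x <= x - 1.
Proof.
  intros Hx. pose proof (exp_ineq1_le (ln x)) as H. rewrite exp_ln in H by assumption. lra.
Qed.

Lemma ln_le_compat x y : 0 < x -> x <= y -> ln x <= ln y.
Proof.
  intros Hx [H| ->]; [left; now apply ln_increasing|right; reflexivity].
Qed.

(** Lyapunov function counting the steps, [e] being the energy dissipated so far. A step that
    raises the guess [l] while [A l >= s^2] dissipates energy, a step that lowers it while
    [A l <= e^2 s^2] makes [A] grow geometrically; the maximum pays for lowering the guess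
    from larger values of [A l], which can only follow dissipating steps. *)
Definition ms_count (r s e A l : R) : R :=
  16 * e / (s * s * (r * r)) + (8 * s + 2) * ln A
  - 2 * Rmax (ln (A * l)) (ln (s * s) + 1) + ln l.

(** From [l a^2 >= A] and [A l <= e^2 s^2] follows [a / A >= 1 / (e s) >= 1 / (3 s)]; then [ln (1 +
    y) >= 1 - 1 / (1 + y) >= 1 / (4 s)]. *)
Lemma ms_growth A l s :
  0 < A -> 0 < l -> 1 <= s -> ln (A * l) <= ln (s * s) + 2 ->
  2 <= 8 * s * (ln (A + ms_gain A l) - ln A).
Proof.
  intros HA Hl Hs Hy. destruct (ms_gain_spec A l) as [Ha Hroot]; [lra|assumption|].
  set (a := ms_gain A l) in *.
  assert (HAl : A * l <= exp 1 * exp 1 * (s * s)).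
  { rewrite <- (exp_ln (A * l)) by nra. rewrite <- (exp_ln (s * s)) at 1 by nra.
    rewrite <- !exp_plus. apply exp_le_compat. lra. }
  pose proof exp_le_3 as He3. pose proof (exp_pos 1) as He0.
  assert (Hx : / (3 * s) <= a / A).
  { apply Rmult_le_reg_r with (A * (3 * s)); [nra|].
    replace (/ (3 * s) * (A * (3 * s))) with A by (field; lra).
    replace (a / A * (A * (3 * s))) with (3 * s * a) by (field; lra).
    apply Rnot_lt_le. intros Hlt.
    assert (H9 : A * l <= 9 * (s * s)).
    { eapply Rle_trans; [exact HAl|]. apply Rmult_le_compat_r; nra. }
    assert (Hsq : 3 * s * a * (3 * s * a) < A * A) by (apply Rmult_le_0_lt_compat; nra).
    assert (A <= l * (a * a)) by lra.
    assert (A * A <= A * l * (a * a)) by nra.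
    assert (A * l * (a * a) <= 9 * (s * s) * (a * a)) by (apply Rmult_le_compat_r; nra).
    nra. }
  assert (Hln : ln (A + a) - ln A = - ln (/ (1 + a / A))).
  { rewrite ln_Rinv by (assert (0 < a / A) by (apply Rdiv_lt_0_compat; lra); lra).
    replace (A + a) with (A * (1 + a / A)) by (field; lra).
    rewrite ln_mult; [ring|assumption|]. assert (0 < a / A) by (apply Rdiv_lt_0_compat; lra). lra. }
  rewrite Hln. set (y := a / A) in *.
  assert (Hs3 : 0 < / (3 * s)) by (apply Rinv_0_lt_compat; lra).
  assert (Hinv : / (1 + y) <= 1 - / (4 * s)).
  { apply Rle_trans with (/ (1 + / (3 * s))); [apply Rinv_le_contravar; lra|].
    replace (/ (1 + / (3 * s))) with (3 * s / (3 * s + 1)) by (field; lra).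
    apply Rmult_le_reg_r with (4 * s * (3 * s + 1)); [nra|].
    replace (3 * s / (3 * s + 1) * (4 * s * (3 * s + 1))) with (12 * s * s) by (field; lra).
    replace ((1 - / (4 * s)) * (4 * s * (3 * s + 1))) with ((4 * s - 1) * (3 * s + 1)) by (field; lra).
    nra. }
  pose proof (ln_le_sub1 (/ (1 + y)) ltac:(apply Rinv_0_lt_compat; lra)) as Hl1.
  apply Rle_trans with (8 * s * / (4 * s)); [right; field; lra|].
  apply Rmult_le_compat_l; lra.
Qed.

Lemma ms_count_step r s e A l lam DD :
  let a := ms_gain A l in
  let gam := if Rle_dec lam l then 1 else l / lam in
  let l' := if Rle_dec lam l then l / exp 1 else l * exp 1 in
  0 < r -> 1 <= s -> 0 < A -> 0 < l -> 0 <= lam -> 0 <= DD ->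
  (l < lam -> r * r / 4 <= DD) ->
  ms_count r s e A l + 1
    <= ms_count r s (e + gam * (A + a) * lam * DD / 2) (A + gam * a) l'.
Proof.
  intros a gam l' Hr Hs HA Hl Hlam HDD Hfar.
  destruct (ms_gain_spec A l) as [Ha _]; [lra|assumption|]. fold a in Ha.
  unfold ms_count, gam, l'. clear gam l'.
  assert (Hsr : 0 < s * s * (r * r)) by (repeat apply Rmult_lt_0_compat; lra).
  set (c := s * s * (r * r)) in *.
  destruct (Rle_dec lam l) as [Hle|Hgt].
  (* Lowering the guess costs 1 in [ln l]. Up to [A l = e^2 s^2] the growth of [A] regains 2; above,
     the maximum drops by 1, and its factor 2 regains 2. The summand [2 * ln A] offsets any rise of
     the maximum due to [A]. *)
  - rewrite !Rmult_1_l.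
    assert (Hl' : ln (l / exp 1) = ln l - 1).
    { unfold Rdiv. rewrite ln_mult, ln_Rinv, ln_exp by
        (try apply Rinv_0_lt_compat; try assumption; apply exp_pos). ring. }
    assert (Hle' : 0 < l / exp 1) by (apply Rdiv_lt_0_compat; [assumption|apply exp_pos]).
    rewrite (ln_mult A l), (ln_mult (A + a)) by lra. rewrite Hl'.
    pose proof (ms_growth A l s HA Hl Hs) as Hg. rewrite ln_mult in Hg by lra. fold a in Hg.
    assert (Hinc : ln A <= ln (A + a)) by (apply ln_le_compat; lra).
    assert (He : 16 * e / c <= 16 * (e + (A + a) * lam * DD / 2) / c).
    { apply Rmult_le_compat_r; [left; now apply Rinv_0_lt_compat|].
      assert (0 <= (A + a) * lam * DD) by (repeat apply Rmult_le_pos; lra). lra. }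
    assert (Hpos : 0 <= 8 * s * (ln (A + a) - ln A)) by (apply Rmult_le_pos; lra).
    set (B := 8 * s * (ln (A + a) - ln A)) in *.
    replace ((8 * s + 2) * ln (A + a)) with ((8 * s + 2) * ln A + B + 2 * (ln (A + a) - ln A))
      by (unfold B; ring).
    unfold Rmax. repeat destruct Rle_dec; lra.
  (* Raising the guess gains 1 in [ln l]. If [A l < s^2], raising [l] alone keeps the maximum at its
     floor; otherwise it costs at most 2 through the maximum, which the dissipated energy repays. *)
  - assert (Hl' : ln (l * exp 1) = ln l + 1)
      by (rewrite ln_mult, ln_exp by (try assumption; apply exp_pos); reflexivity).
    assert (Hle' : 0 < l * exp 1) by (apply Rmult_lt_0_compat; [assumption|apply exp_pos]).
    assert (Hgl : 0 < l / lam) by (apply Rdiv_lt_0_compat; lra).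
    set (gam := l / lam) in *.
    assert (Hga : 0 < gam * a) by (apply Rmult_lt_0_compat; lra).
    rewrite (ln_mult A l), (ln_mult (A + gam * a)) by lra. rewrite Hl'.
    assert (Hinc : ln A <= ln (A + gam * a)) by (apply ln_le_compat; lra).
    replace (gam * (A + a) * lam * DD / 2) with ((A + a) * l * DD / 2)
      by (unfold gam; field; lra).
    assert (HDr : r * r / 4 <= DD) by (apply Hfar; lra).
    assert (He0 : 0 <= (A + a) * l * DD) by (repeat apply Rmult_le_pos; lra).
    assert (He1 : 16 * (e + (A + a) * l * DD / 2) / c = 16 * e / c + 8 * ((A + a) * l * DD) / c)
      by (field; lra).
    rewrite He1.
    assert (Hd0 : 0 <= 8 * ((A + a) * l * DD) / c).
    { apply Rmult_le_pos; [lra|left; now apply Rinv_0_lt_compat]. }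
    assert (Hd2 : ln (s * s) <= ln A + ln l -> 2 <= 8 * ((A + a) * l * DD) / c).
    { intros Hy. rewrite <- ln_mult in Hy by assumption.
      assert (Hss : s * s <= A * l).
      { rewrite <- (exp_ln (s * s)), <- (exp_ln (A * l)) by nra. now apply exp_le_compat. }
      apply Rmult_le_reg_r with c; [assumption|].
      replace (8 * ((A + a) * l * DD) / c * c) with (8 * ((A + a) * l * DD)) by (field; lra).
      assert (A * l <= (A + a) * l) by (apply Rmult_le_compat_r; lra).
      assert (s * s * (r * r / 4) <= (A + a) * l * DD).
      { apply Rmult_le_compat; nra. }
      unfold c. lra. }
    assert (Hb : 0 <= 8 * s * (ln (A + gam * a) - ln A)) by (apply Rmult_le_pos; lra).
    unfold Rmax. destruct (Rle_dec (ln (s * s)) (ln A + ln l)) as [Hy|Hy];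
      [specialize (Hd2 Hy)|]; repeat destruct Rle_dec; lra.
Qed.

Inductive ms_run {d} (G : Vec d -> Vec d) (delta r lmax Amax : R) :
  ms_state d -> nat -> ms_state d -> Prop :=
| ms_run_0 st : ms_run G delta r lmax Amax st 0 st
| ms_run_S st xt lam k st' :
    ball_answer G delta r lmax (ms_query st) xt lam ->
    ms_run G delta r lmax Amax (ms_next Amax st xt lam) k st' ->
    ms_run G delta r lmax Amax st (S k) st'.

(** This [A] makes each half of the initial energy at most [R0^2 / 2]; the guess [1 / A] starts the
    maximum in [ms_count] at its floor. *)
Definition ms_init (d : nat) (L R0 : R) : ms_state d :=
  MS (R0 / (2 * L)) (mkv d (fun _ => 0)) (mkv d (fun _ => 0)) (2 * L / R0).

(** Below [Amax] the count rises by 1 per step, yet it is bounded because [e <= 2 R0^2], [A < Amax]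
    and the guess is at most [exp 1 * lmax]; so [Amax] is reached before [T]. There, dividing the
    energy by [A] gives the accuracy. The slack [eps1] allows [xs] to minimise a function merely
    close to [F]. *)
Lemma ms_convergence {d} (F : Vec d -> R) G xs delta r L R0 s eps1 Amax T st' :
  let lmax := 6 * L / r in
  subgradient F G -> lipschitz L F -> norm xs <= R0 ->
  0 < L -> 0 < R0 -> 0 <= delta -> 0 < r <= R0 -> 1 <= s -> R0 / (2 * L) < Amax ->
  (forall x, F xs - eps1 <= F x) ->
  Amax * (delta * (3 * R0 + INR T * r) + eps1) <= R0 * R0 ->
  32 * (R0 * R0) / (s * s * (r * r)) + (8 * s + 2) * ln (Amax * (2 * L / R0))
    + 1 + ln (3 * R0 / r) < INR T ->
  ms_run G delta r lmax Amax (ms_init d L R0) T st' ->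
  F (sx st') - F xs <= R0 * R0 / Amax + delta * (3 * R0 + INR T * r).
Proof.
  intros lmax HFG HLip Hxs HL HR Hdelta Hr Hs HAmax Heps Hbudget HT Hrun.
  set (A0 := R0 / (2 * L)) in *. set (l0 := 2 * L / R0).
  assert (HA0 : 0 < A0) by (apply Rdiv_lt_0_compat; lra).
  assert (Hl0 : 0 < l0) by (apply Rdiv_lt_0_compat; lra).
  assert (HAl : A0 * l0 = 1) by (unfold A0, l0; field; lra).
  set (Q0 := ms_count r s 0 A0 l0).
  set (err := fun t => delta * (3 * R0 + INR t * r)).
  assert (Herr : forall t, 0 <= err t).
  { intros t. pose proof (pos_INR t). unfold err. apply Rmult_le_pos; nra. }
  assert (Herr_S : forall t, err (S t) = err t + delta * r).
  { intros t. unfold err. rewrite S_INR. ring. }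
  assert (Herr_mono : forall t, (t <= T)%nat -> err t <= err T).
  { intros t Ht. apply le_INR in Ht. unfold err. apply Rmult_le_compat_l; [lra|].
    apply Rplus_le_compat_l, Rmult_le_compat_r; lra. }
  (* [e] is the energy dissipated so far. The bound on the guess persists because it is raised only
     while below the returned multiplier. *)
  set (live := fun t st => exists e, 0 <= e /\ A0 <= sA st /\ 0 < sl st <= exp 1 * lmax /\
     ms_energy F xs st + e <= R0 * R0 + sA st * err t /\
     Q0 + INR t <= ms_count r s e (sA st) (sl st)).
  set (inv := fun t st => (sA st < Amax /\ live t st) \/
     (Amax <= sA st /\ F (sx st) - F xs <= R0 * R0 / Amax + err T)).
  assert (Hlmax : l0 <= lmax).
  { unfold l0, lmax. apply Rle_trans with (2 * L / r).
    - apply Rmult_le_compat_l; [lra|]. apply Rinv_le_contravar; lra.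
    - apply Rmult_le_compat_r; [left; apply Rinv_0_lt_compat; lra|lra]. }
  assert (He1 : 2 <= exp 1) by (pose proof (exp_ineq1_le 1); lra).
  assert (Henergy_low : forall st, 0 <= sA st -> 
     norm (vsub (sv st) xs) * norm (vsub (sv st) xs) / 2 - sA st * eps1 <= ms_energy F xs st).
  { intros st Hst. unfold ms_energy. rewrite norm_sqr. specialize (Heps (sx st)).
    assert (sA st * - eps1 <= sA st * (F (sx st) - F xs)) by (apply Rmult_le_compat_l; lra).
    lra. }
  assert (Heps0 : 0 <= eps1) by (specialize (Heps xs); lra).
  assert (Hbud : forall A t, 0 <= A <= Amax -> (t <= T)%nat -> A * err t + A * eps1 <= R0 * R0).
  { intros A t HA Ht. eapply Rle_trans; [|exact Hbudget].
    specialize (Herr_mono t Ht). specialize (Herr t). fold (err T).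
    replace (A * err t + A * eps1) with (A * (err t + eps1)) by ring.
    apply Rmult_le_compat; lra. }
  assert (Hstep : forall t st xt lam, (S t <= T)%nat -> inv t st ->
     ball_answer G delta r lmax (ms_query st) xt lam -> inv (S t) (ms_next Amax st xt lam)).
  { intros t st xt lam Ht [[HA Hlive]|[HA Hdone]] Hball.
    2:{ right. unfold ms_next. destruct (Rle_dec Amax (sA st)); [now split|lra]. }
    destruct Hlive as (e & He & HAl0 & Hl & HE & HQ).
    set (st2 := ms_next Amax st xt lam).
    pose proof (ms_next_energy F G xs delta r lmax Amax st xt lam HFG ltac:(lra) ltac:(lra) Hball) as Hen.
    cbn zeta in Hen. fold st2 in Hen.
    destruct Hball as [_ _ Hlam Hfar].
    set (D := vsub xt (ms_query st)) in *.
    set (a := ms_gain (sA st) (sl st)) in *.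
    set (gam := if Rle_dec lam (sl st) then 1 else sl st / lam) in *.
    set (spent := gam * (sA st + a) * lam * dot D D / 2) in *.
    destruct (ms_gain_spec (sA st) (sl st)) as [Ha _]; [lra|lra|]. fold a in Ha.
    assert (Hgam : 0 < gam).
    { unfold gam. destruct Rle_dec; [lra|]. apply Rdiv_lt_0_compat; lra. }
    assert (HsA : sA st2 = sA st + gam * a).
    { unfold st2, ms_next. destruct (Rle_dec Amax (sA st)); [lra|reflexivity]. }
    assert (Hsl : sl st2 = if Rle_dec lam (sl st) then sl st / exp 1 else sl st * exp 1).
    { unfold st2, ms_next. destruct (Rle_dec Amax (sA st)); [lra|reflexivity]. }
    assert (Hga : 0 < gam * a) by (apply Rmult_lt_0_compat; lra).
    pose proof (dot_self_nonneg D) as HDD.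
    assert (Hspent : 0 <= spent).
    { unfold spent. apply Rmult_le_pos; [|lra]. repeat apply Rmult_le_pos; lra. }
    (* The energy gives [norm ^ 2 / 2 <= 2 R0^2]; this bound then justifies the [3 * R0] in the
       error of the next step. *)
    assert (Hv : norm (vsub (sv st) xs) <= 3 * R0).
    { pose proof (Henergy_low st ltac:(lra)) as H1. pose proof (norm_nonneg (vsub (sv st) xs)).
      pose proof (Hbud (sA st) t ltac:(lra) ltac:(lia)).
      apply Rnot_lt_le. intros Hlt. nra. }
    assert (HE2 : ms_energy F xs st2 + (e + spent) <= R0 * R0 + sA st2 * err (S t)).
    { rewrite Herr_S.
      assert (delta * ((sA st2 - sA st) * norm (vsub (sv st) xs)) <= (sA st2 - sA st) * err t).
      { replace (delta * ((sA st2 - sA st) * norm (vsub (sv st) xs)))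
          with ((sA st2 - sA st) * (delta * norm (vsub (sv st) xs))) by ring.
        apply Rmult_le_compat_l; [lra|]. unfold err. apply Rmult_le_compat_l; [lra|].
        pose proof (pos_INR t). nra. }
      lra. }
    assert (HQ2 : Q0 + INR (S t) <= ms_count r s (e + spent) (sA st2) (sl st2)).
    { rewrite S_INR, HsA, Hsl.
      pose proof (ms_count_step r s e (sA st) (sl st) lam (dot D D)) as Hc.
      cbn zeta in Hc. fold a gam spent in Hc.
      assert (Q0 + INR t + 1 <= ms_count r s e (sA st) (sl st) + 1) by lra.
      eapply Rle_trans; [|apply Hc]; try lra.
      intros Hlt. specialize (Hfar ltac:(lra)). rewrite <- norm_sqr. nra. }
    destruct (Rlt_or_le (sA st2) Amax) as [HA2|HA2].
    - left. split; [assumption|]. exists (e + spent). split; [lra|]. split; [lra|].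
      split; [|split; assumption]. rewrite Hsl. destruct Rle_dec as [Hle|Hgt].
      + split; [apply Rdiv_lt_0_compat; lra|]. apply Rle_trans with (sl st); [|lra].
        apply Rmult_le_reg_r with (exp 1); [lra|]. unfold Rdiv.
        rewrite Rmult_assoc, Rinv_l, Rmult_1_r by lra. nra.
      + split; [nra|]. rewrite Rmult_comm. apply Rmult_le_compat_l; lra.
    - right. split; [assumption|].
      assert (Hp : 0 <= ms_energy F xs st2 - sA st2 * (F (sx st2) - F xs)).
      { unfold ms_energy. pose proof (dot_self_nonneg (vsub (sv st2) xs)). lra. }
      apply Rmult_le_reg_l with (sA st2); [lra|].
      assert (sA st2 * err (S t) <= sA st2 * err T).
      { apply Rmult_le_compat_l; [lra|]. now apply Herr_mono. }
      assert (R0 * R0 <= sA st2 * (R0 * R0 / Amax)).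
      { replace (R0 * R0) with (Amax * (R0 * R0 / Amax)) at 1 by (field; lra).
        apply Rmult_le_compat_r; [|assumption]. left. apply Rdiv_lt_0_compat; nra. }
      lra. }
  assert (Hinit : inv 0%nat (ms_init d L R0)).
  { left. cbn [sA ms_init]. fold A0. split; [assumption|]. exists 0.
    split; [lra|]. cbn [sA sl ms_init]. fold A0 l0. split; [lra|]. split; [nra|].
    split; [|unfold Q0; simpl; lra].
    unfold ms_energy. cbn [sA sx sv ms_init]. fold A0. set (o := mkv d (fun _ => 0)).
    assert (Hox : vsub o xs = vscale (-1) xs).
    { unfold o. apply vec_ext. intros i Hi. rewrite vget_sub, vget_scale, vget_mkv by assumption. ring. }
    rewrite Hox, dot_scale_l, dot_scale_r, <- norm_sqr.
    pose proof (HLip o xs) as H1. rewrite Hox, norm_scale, (Rabs_left (-1)) in H1 by lra.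
    pose proof (Rle_abs (F o - F xs)) as H2. pose proof (norm_nonneg xs).
    assert (A0 * (F o - F xs) <= A0 * (L * R0)) by (apply Rmult_le_compat_l; nra).
    assert (A0 * (L * R0) = R0 * R0 / 2) by (unfold A0; field; lra).
    specialize (Herr 0%nat). nra. }
  assert (Hfinal : inv T st').
  { assert (Hgen : forall k t st, (t + k = T)%nat -> inv t st ->
       ms_run G delta r lmax Amax st k st' -> inv T st').
    { induction k as [|k IH]; intros t st Htk Hi Hr'.
      - inversion Hr'; subst. now rewrite Nat.add_0_r.
      - inversion Hr'; subst. apply (IH (S t) (ms_next Amax st xt lam)); [lia| |assumption].
        apply Hstep; [lia|assumption|assumption]. }
    now apply (Hgen T 0%nat (ms_init d L R0)). }
  destruct Hfinal as [[HA Hlive]|[_ Hdone]]; [exfalso|exact Hdone].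
  destruct Hlive as (e & He & HAl0 & Hl & HE & HQ).
  assert (Hemax : e <= 2 * (R0 * R0)).
  { pose proof (Henergy_low st' ltac:(lra)) as H1.
    pose proof (Hbud (sA st') T ltac:(lra) ltac:(lia)).
    pose proof (norm_nonneg (vsub (sv st') xs)). nra. }
  unfold Q0, ms_count in HQ. rewrite HAl, ln_1 in HQ.
  assert (Hlns : 0 <= ln (s * s)) by (rewrite <- ln_1; apply ln_le_compat; nra).
  rewrite (Rmax_right 0) in HQ by lra.
  pose proof (Rmax_r (ln (sA st' * sl st')) (ln (s * s) + 1)) as Hmax.
  assert (Hc : 0 < s * s * (r * r)) by (repeat apply Rmult_lt_0_compat; lra).
  assert (H1 : 16 * e / (s * s * (r * r)) <= 32 * (R0 * R0) / (s * s * (r * r))).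
  { apply Rmult_le_compat_r; [left; now apply Rinv_0_lt_compat|lra]. }
  assert (H2 : ln (sA st') <= ln Amax) by (apply ln_le_compat; lra).
  assert (H3 : ln (sl st') <= 1 + ln lmax).
  { rewrite <- (ln_exp 1) at 1. rewrite <- ln_mult by lra. apply ln_le_compat; lra. }
  assert (H4 : ln (Amax * (2 * L / R0)) = ln Amax - ln A0).
  { fold l0. replace l0 with (/ A0) by (unfold A0, l0; field; lra).
    rewrite ln_mult, ln_Rinv by (try apply Rinv_0_lt_compat; lra). ring. }
  assert (H5 : ln (3 * R0 / r) = ln lmax - ln l0).
  { replace (3 * R0 / r) with (lmax * / l0) by (unfold lmax, l0; field; lra).
    rewrite ln_mult, ln_Rinv by (try apply Rinv_0_lt_compat; lra). ring. }
  rewrite H4, H5 in HT.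
  assert ((8 * s + 2) * ln (sA st') <= (8 * s + 2) * ln Amax) by (apply Rmult_le_compat_l; lra).
  replace (16 * 0 / (s * s * (r * r))) with 0 in HQ by (field; nra).
  lra.
Qed.

(** * The parallel algorithm *)

Section Algorithm.

(** [n] is the standard deviation in units of the spacing [eta], [m] the moment order of the
    truncation bound, [N] the samples per round and [T] the rounds. *)
Variables (d n m N T : nat) (L R0 eta r delta Amax : R).

Let J := (n + 1)%nat.
Let K := (2 * n * J * d)%nat.

Definition lattice_mult (u : list Z) : R := mult r L (eta * eta * zsq u).

(** A test on observed data. The threshold allows [delta] for the true stationarity error and
    [2 * delta] for estimation. *)
Definition acceptable (ps : list (list Z * Vec d)) (u : list Z) : Prop :=
  length u = d /\ (INR m + 1) * zsq u <= INR n * INR n /\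
  norm (vadd (estimate n K (K + J) ps u) (vscale (lattice_mult u) (off d eta u))) <= 3 * delta.

(** A bad round may leave no acceptable point; the choice is then arbitrary. *)
Definition pick (ps : list (list Z * Vec d)) : list Z :=
  epsilon (inhabits nil) (acceptable ps).

Definition alg_next (st : ms_state d) (ps : list (list Z * Vec d)) : ms_state d :=
  ms_next Amax st (vadd (ms_query st) (off d eta (pick ps))) (lattice_mult (pick ps)).

Definition alg_step (g : Vec d -> Vec d) (st : ms_state d) (S : list (list Z)) : ms_state d :=
  alg_next st (answers eta g (ms_query st) S).

(** [query] and [output] see only seed and transcript, so the state is rebuilt from these; the outer
    [combine] stops at the rounds already played. *)
Definition replay (w : list (list (list Z))) (h : history d) : ms_state d :=
  fold_left (fun st SR => alg_next st (combine (fst SR) (map snd (snd SR))))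
    (combine w h) (ms_init d L R0).

Definition seeds : fdist (list (list (list Z))) :=
  iid T (iid N (gauss_lattice n (K + J) d)).

Lemma seeds_is_fdist : is_fdist seeds.
Proof. apply iid_is_fdist, iid_is_fdist, gauss_lattice_is_fdist. Qed.

Definition algorithm : ParAlg d := {|
  depth := T;
  weight := seed_weight seeds;
  weight_nonneg := seed_weight_nonneg seeds seeds_is_fdist;
  weight_total := seed_weight_total seeds seeds_is_fdist;
  query := fun s t h => let w := seed_value seeds nil s in
    map (fun z => vadd (ms_query (replay w h)) (off d eta z)) (nth t w nil);
  output := fun s h => sx (replay (seed_value seeds nil s) h)
|}.

Lemma run_length s g t : length (run algorithm s g t) = t.
Proof.
  induction t as [|t IH]; [reflexivity|]. simpl. rewrite length_app, IH. simpl. lia.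
Qed.

Lemma combine_snoc {A B} (w : list A) (h : list B) a0 b :
  (length h < length w)%nat ->
  combine w (h ++ b :: nil) = combine w h ++ (nth (length h) w a0, b) :: nil.
Proof.
  revert w. induction h as [|c h IH]; intros [|a w] H; simpl in *; try lia.
  - now destruct w.
  - rewrite IH by lia. reflexivity.
Qed.

Lemma combine_map_r {A B} (k : A -> B) l : combine l (map k l) = map (fun a => (a, k a)) l.
Proof. induction l as [|a l IH]; [reflexivity|]. simpl. now rewrite IH. Qed.

Lemma firstn_S_nth {A} (l : list A) k a0 :
  (k < length l)%nat -> firstn (S k) l = firstn k l ++ nth k l a0 :: nil.
Proof.
  revert k. induction l as [|a l IH]; intros k H; [simpl in H; lia|].
  destruct k as [|k]; [reflexivity|]. simpl in H.
  rewrite !firstn_cons, IH by lia. reflexivity.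
Qed.

Lemma replay_run s g t :
  let w := seed_value seeds nil s in
  (t <= length w)%nat ->
  replay w (run algorithm s g t) = fold_left (alg_step g) (firstn t w) (ms_init d L R0).
Proof.
  intros w. induction t as [|t IH]; intros Ht.
  - unfold replay. simpl. now destruct w.
  - rewrite (firstn_S_nth w t nil) by lia. rewrite fold_left_app. simpl run.
    unfold replay at 1. rewrite (combine_snoc w _ nil) by (rewrite run_length; lia).
    rewrite fold_left_app. fold (replay w (run algorithm s g t)). rewrite IH by lia.
    rewrite run_length. simpl. fold w. rewrite !map_map, IH by lia. simpl.
    set (st := fold_left (alg_step g) (firstn t w) (ms_init d L R0)).
    unfold alg_step, answers. f_equal. apply combine_map_r.
Qed.

Lemma seeds_supp w : supp seeds w -> length w = T /\ Forall (fun S => length S = N) w.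
Proof.
  intros H. apply iid_supp in H. destruct H as [H1 H2]. split; [assumption|].
  revert H2. apply Forall_impl. intros S HS. now apply iid_supp in HS.
Qed.

Lemma seed_value_cases s :
  seed_value seeds nil s = nil \/ supp seeds (seed_value seeds nil s).
Proof.
  unfold seed_value. destruct (Nat.lt_ge_cases s (length (map snd seeds))) as [H|H].
  - right. pose proof (nth_In (map snd seeds) nil H) as Hi.
    apply in_map_iff in Hi. destruct Hi as ([p w] & <- & Hi). now exists p.
  - left. now apply nth_overflow.
Qed.

(** The bound includes seeds past the end of the list: they decode to [nil] and submit no
    queries. *)
Lemma algorithm_work s g : (work algorithm s g <= T * N)%nat.
Proof.
  unfold work, final_history. change (depth algorithm) with T.
  generalize T as t. induction t as [|t IH]; [simpl; lia|].
  assert (Happ : forall a b : history d,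
    fold_right (fun r acc => (length r + acc)%nat) 0%nat (a ++ b)
    = (fold_right (fun r acc => (length r + acc)%nat) 0%nat a
       + fold_right (fun r acc => (length r + acc)%nat) 0%nat b)%nat).
  { clear. induction a as [|x a IH]; intros b; simpl; [reflexivity|]. rewrite IH. lia. }
  simpl run. rewrite Happ. simpl. rewrite !length_map.
  assert (length (nth t (seed_value seeds nil s) nil) <= N)%nat; [|lia].
  destruct (seed_value_cases s) as [->|H]; [destruct t; simpl; lia|].
  apply seeds_supp in H. destruct H as [_ H].
  destruct (Nat.lt_ge_cases t (length (seed_value seeds nil s))) as [Ht|Ht].
  - rewrite Forall_forall in H. rewrite (H (nth t _ nil)); [lia|]. now apply nth_In.
  - rewrite nth_overflow by assumption. simpl. lia.
Qed.

Fixpoint good_run (g : Vec d -> Vec d) (st : ms_state d) (w : list (list (list Z))) : Prop :=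
  match w with
  | nil => True
  | smp :: w' => good_round n K (K + J) m eta delta g (ms_query st) smp
                 /\ good_run g (alg_step g st smp) w'
  end.

(** The query point depends on earlier samples only and the samples of the round are fresh, so a
    bound uniform in [q] survives the conditioning. *)
Lemma bad_run_probability g beta st t :
  (forall q, E (iid N (gauss_lattice n (K + J) d))
      (fun S => indic (~ good_round n K (K + J) m eta delta g q S)) <= beta) ->
  E (iid t (iid N (gauss_lattice n (K + J) d))) (fun w => indic (~ good_run g st w))
    <= INR t * beta.
Proof.
  intros Hbeta. set (D := iid N (gauss_lattice n (K + J) d)) in *.
  assert (HD : is_fdist D) by apply iid_is_fdist, gauss_lattice_is_fdist.
  revert st. induction t as [|t IH]; intros st.
  - rewrite (E_ext _ _ (fun _ => 0)).
    + rewrite E_const by now apply iid_is_fdist. simpl. lra.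
    + intros w Hw. apply iid_supp in Hw. destruct Hw as [Hw _].
      destruct w; [|discriminate]. apply indic_false. simpl. tauto.
  - rewrite E_iid_S, S_INR.
    apply Rle_trans with (E D (fun S =>
      indic (~ good_round n K (K + J) m eta delta g (ms_query st) S) + INR t * beta)).
    + apply E_le; [assumption|]. intros S _.
      apply Rle_trans with (E (iid t D) (fun w =>
        indic (~ good_round n K (K + J) m eta delta g (ms_query st) S)
        + indic (~ good_run g (alg_step g st S) w))).
      * apply E_le; [now apply iid_is_fdist|]. intros w _.
        eapply Rle_trans; [|apply indic_or]. apply indic_mono. cbn [good_run].
        intros H. apply not_and_or in H. exact H.
      * rewrite E_plus, E_const by now apply iid_is_fdist.
        apply Rplus_le_compat_l, IH.
    + rewrite E_plus, E_const by assumption. specialize (Hbeta (ms_query st)). lra.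
Qed.

(** The good round serves twice: at the stationary point, so that some point passes the test, and at
    the picked point, where the error becomes [3 + 2 = 5] times [delta]. *)
Lemma good_round_ball_answer (F : Vec d -> R) g q S :
  let G := smooth_grad n K eta g in
  let u := pick (answers eta g q S) in
  (0 < n)%nat -> (0 < d)%nat -> 0 < eta -> 0 < L -> 0 < r -> eta <= r -> 
  r * r * (INR m + 1) = eta * eta * (INR n * INR n) ->
  sqrt (INR d) * (21 * L * eta / r + 2 * L / INR n) <= delta ->
  subgradient F G -> lipschitz L F -> (forall x, norm (g x) <= L) ->
  good_round n K (K + J) m eta delta g q S ->
  ball_answer G (5 * delta) r (6 * L / r) q (vadd q (off d eta u)) (lattice_mult u).
Proof.
  intros G u Hn Hd Heta HL Hr Her Hrn Hdelta HFG HLip Hg Hgood.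
  assert (Hbox : forall u0, length u0 = d -> (INR m + 1) * zsq u0 <= INR n * INR n ->
     In u0 (zbox (n + 1) d)).
  { intros u0 H1 H2. apply zbox_In. split; [assumption|]. apply zbox_of_zsq.
    rewrite plus_INR. simpl. pose proof (pos_INR n). pose proof (pos_INR m).
    pose proof (zsq_nonneg u0). nra. }
  assert (HK : (n <= K)%nat) by (unfold K, J; nia).
  assert (Hacc : acceptable (answers eta g q S) u).
  { unfold u, pick. apply epsilon_spec.
    destruct (stationary_lattice_point F G q n m eta r L (2 * L / INR n)) as (u0 & H1 & H2 & H3);
      try assumption.
    - intros u0 i Hu0 Hi. now apply smooth_grad_neighbour.
    - exists u0. split; [assumption|]. split; [assumption|].
      pose proof (Hgood u0 (Hbox u0 H1 H2) H2) as H4.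
      set (est := estimate n K (K + J) (answers eta g q S) u0) in *.
      set (y := vscale (lattice_mult u0) (off d eta u0)).
      replace (vadd est y) with (vadd (vsub est (G (vadd q (off d eta u0))))
        (vadd (G (vadd q (off d eta u0))) y)) by vec_ring.
      eapply Rle_trans; [apply norm_triang|]. unfold y, lattice_mult, G in *. lra. }
  destruct Hacc as (H1 & H2 & H3).
  pose proof (Hgood u (Hbox u H1 H2) H2) as H4.
  pose proof (norm_off_sqr d eta u H1) as H5.
  assert (Hsq : eta * eta * zsq u <= r * r).
  { pose proof (pos_INR m). apply Rmult_le_reg_r with (INR m + 1); [lra|]. rewrite Hrn.
    replace (eta * eta * zsq u * (INR m + 1)) with (eta * eta * ((INR m + 1) * zsq u)) by ring.
    apply Rmult_le_compat_l; [nra|assumption]. }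
  pose proof (norm_nonneg (off d eta u)) as H6.
  assert (Hsub : vsub (vadd q (off d eta u)) q = off d eta u) by vec_ring.
  split; rewrite ?Hsub.
  - set (est := estimate n K (K + J) (answers eta g q S) u) in *.
    set (y := vscale (lattice_mult u) (off d eta u)) in *.
    replace (vadd (G (vadd q (off d eta u))) y)
      with (vadd (vscale (-1) (vsub est (G (vadd q (off d eta u))))) (vadd est y)) by vec_ring.
    eapply Rle_trans; [apply norm_triang|]. rewrite norm_scale, (Rabs_left (-1)) by lra.
    unfold G in *. lra.
  - nra.
  - unfold lattice_mult. split; [now apply mult_nonneg|now apply mult_le].
  - intros Hpos. apply mult_pos_inv in Hpos. nra.
Qed.

Theorem algorithm_correct (f : Vec d -> R) g xs eps nu s :
  (0 < n)%nat -> (0 < d)%nat -> (0 < N)%nat -> (0 < T)%nat ->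
  0 < L -> 0 < R0 -> 0 < eps -> eps < L * R0 -> 0 < eta -> 0 < delta <= L -> 0 < r <= R0 ->
  eta <= r -> 1 <= s -> Amax = 4 * (R0 * R0) / eps ->
  r * r * (INR m + 1) = eta * eta * (INR n * INR n) ->
  L * exp (- (INR m / 2)) <= delta ->
  sqrt (INR d) * (21 * L * eta / r + 2 * L / INR n) <= delta ->
  L * (2 * (eta * INR n) * sqrt (INR d)) <= eps / 16 ->
  5 * delta * (3 * R0 + INR T * r) <= eps / 16 ->
  32 * (R0 * R0) / (s * s * (r * r)) + (8 * s + 2) * ln (Amax * (2 * L / R0))
    + 1 + ln (3 * R0 / r) < INR T ->
  INR T * (INR (length (list_prod (zbox (n + 1) d) (zbox (2 * d + 1) d)))
     * exp (- (INR N * (delta * delta / (144 * (L * L * (exp 2 * exp 2))))))) <= nu ->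
  is_gradient f g -> convex f -> lipschitz L f ->
  (forall y, f xs <= f y) -> norm xs <= R0 ->
  prob_le algorithm (fun s => ~ (f (alg_output algorithm s g) - f xs <= eps)) nu.
Proof.
  intros Hn Hd HN HT HL HR Heps Hreg Heta Hdelta Hr Her Hs HAmax Hrn Hm Hstat Hsigma Hdrift
    Hcount Hnu Hgrad Hconv Hlip Hmin Hxs.
  pose proof (gradient_norm_le f g L HL Hgrad Hlip) as Hg.
  set (F := smooth n K eta f). set (G := smooth_grad n K eta g).
  assert (HFG : subgradient F G).
  { apply smooth_subgradient. intros x y. now apply gradient_inequality. }
  assert (HFL : lipschitz L F) by now apply smooth_lipschitz.
  assert (Hclose : forall y, F y - eps / 16 <= f y <= F y + eps / 16).
  { intros y. pose proof (smooth_close n K eta f L y Hn Hd Heta HL Hlip) as H. fold F in H.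
    pose proof (Rle_abs (F y - f y)). pose proof (Rle_abs (- (F y - f y))) as H2.
    rewrite Rabs_Ropp in H2. lra. }
  assert (HA0 : R0 / (2 * L) < Amax).
  { rewrite HAmax. apply Rmult_lt_reg_r with (2 * L * eps); [nra|].
    replace (R0 / (2 * L) * (2 * L * eps)) with (R0 * eps) by (field; lra).
    replace (4 * (R0 * R0) / eps * (2 * L * eps)) with (R0 * (8 * (L * R0))) by (field; lra).
    apply Rmult_lt_compat_l; lra. }
  assert (Hbudget : Amax * (5 * delta * (3 * R0 + INR T * r) + eps / 8) <= R0 * R0).
  { apply Rle_trans with (Amax * (eps / 4)).
    - apply Rmult_le_compat_l; [|lra]. rewrite HAmax. left. apply Rdiv_lt_0_compat; nra.
    - rewrite HAmax. right. field. lra. }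
  assert (Hgoodrun : forall w st, good_run g st w ->
     ms_run G (5 * delta) r (6 * L / r) Amax st (length w) (fold_left (alg_step g) w st)).
  { induction w as [|S w IH]; intros st Hw; [apply ms_run_0|]. destruct Hw as [H1 H2].
    simpl. eapply ms_run_S; [|apply IH; exact H2].
    apply (good_round_ball_answer F); try assumption; lra. }
  assert (Hsucc : forall w, length w = T -> good_run g (ms_init d L R0) w ->
     f (sx (fold_left (alg_step g) w (ms_init d L R0))) - f xs <= eps).
  { intros w Hw Hgood. specialize (Hgoodrun w _ Hgood). rewrite Hw in Hgoodrun.
    pose proof (ms_convergence F G xs (5 * delta) r L R0 s (eps / 8) Amax T
      (fold_left (alg_step g) w (ms_init d L R0)) HFG HFL Hxs HL HR
      ltac:(lra) Hr Hs HA0) as H. cbn zeta in H.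
    assert (HF : forall x, F xs - eps / 8 <= F x).
    { intros x. pose proof (Hclose xs). pose proof (Hclose x). specialize (Hmin x). lra. }
    specialize (H HF Hbudget Hcount Hgoodrun).
    (* Error budget: [eps / 4] from the energy, [eps / 16] from the oracle and [eps / 16] for each
       passage between [f] and [F]. *)
    replace (R0 * R0 / Amax) with (eps / 4) in H by (rewrite HAmax; field; split; nra).
    pose proof (Hclose xs). pose proof (Hclose (sx (fold_left (alg_step g) w (ms_init d L R0)))).
    lra. }
  intros l Hl Hbad.
  (* The length condition counts seeds decoding to [nil] as bad; they carry no weight. *)
  apply Rle_trans with (E seeds (fun w =>
    indic (~ (length w = T /\ good_run g (ms_init d L R0) w)))).
  - apply (sum_seed_weight_le seeds nil); [apply seeds_is_fdist|assumption|].
    intros k Hk [H1 H2]. apply (Hbad k Hk).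
    unfold alg_output, final_history. change (depth algorithm) with T. cbn [output algorithm].
    rewrite replay_run by lia. rewrite firstn_all2 by lia. now apply Hsucc.
  - apply Rle_trans with (E seeds (fun w => indic (~ good_run g (ms_init d L R0) w))).
    + apply E_le; [apply seeds_is_fdist|]. intros w Hw. apply seeds_supp in Hw.
      apply indic_mono. tauto.
    + eapply Rle_trans; [|exact Hnu]. apply bad_run_probability.
      intros q. now apply bad_round_probability.
Qed.

End Algorithm.

(** * Choice of parameters *)

(* Matching the goal keeps [Rmult_le_pos] from unfolding numerals into products. *)
Ltac mult_le_pos :=
  repeat match goal with |- 0 <= _ * _ => apply Rmult_le_pos end.

Lemma trivial_algorithm_exists (d : nat) (o : Vec d) :
  exists A : ParAlg d, depth A = 0%nat /\
    (forall s g, work A s g = 0%nat) /\ (forall s g, alg_output A s g = o).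
Proof.
  assert (HD := ret_is_fdist o).
  exists {| depth := 0; weight := seed_weight ((1, o) :: nil);
            weight_nonneg := seed_weight_nonneg _ HD;
            weight_total := seed_weight_total _ HD;
            query := fun _ _ _ => nil; output := fun _ _ => o |}.
  repeat split.
Qed.

Lemma le_mult_l a b c : 1 <= a -> 0 <= c <= b -> c <= a * b.
Proof. intros. nra. Qed.

Lemma nat_ceil x : 0 <= x -> exists n, x <= INR n <= x + 1.
Proof.
  intros Hx. destruct (archimed x) as [H1 H2]. exists (Z.to_nat (up x)).
  assert (0 <= up x)%Z by (apply le_IZR; lra).
  rewrite INR_IZR_INZ, Z2Nat.id by assumption. lra.
Qed.

Lemma pow2_le_exp k : 2 ^ k <= exp (INR k).
Proof.
  rewrite <- (Rmult_1_r (INR k)), exp_INR_mult. apply pow_incr.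
  pose proof (exp_ineq1_le 1). lra.
Qed.

Lemma Rpower_pos x y : 0 < Rpower x y.
Proof. apply exp_pos. Qed.

Lemma Rpower_le_self x y : 1 <= x -> 0 <= y <= 1 -> Rpower x y <= x.
Proof.
  intros Hx Hy. rewrite <- (Rpower_1 x) at 2 by lra.
  apply Rle_Rpower; lra.
Qed.

(** What makes [l] usable as a logarithmic factor: [d], [kap] and [1 / nu] are bounded by
    exponentials in [l], and [l >= 2] absorbs additive constants. *)
Lemma logfactor_ge d L R0 eps nu :
  (0 < d)%nat -> 0 < L -> 0 < R0 -> 0 < eps -> 0 < nu -> 1 <= L * R0 / eps ->
  let l := logfactor d L R0 eps nu in
  2 <= l /\ INR d * (L * R0 / eps) <= exp l /\ L * R0 / eps <= exp (l - 1) /\ / nu <= exp l.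
Proof.
  intros Hd HL HR He Hn Hk l. assert (HdR : 1 <= INR d) by (apply (le_INR 1); lia).
  assert (Hinv : 0 < / nu) by now apply Rinv_0_lt_compat.
  assert (H3 : 1 <= ln (2 + INR d)).
  { rewrite <- (ln_exp 1). apply ln_le_compat; [apply exp_pos|]. pose proof exp_le_3. lra. }
  assert (Hnu0 : 0 <= ln (2 + / nu)) by (rewrite <- ln_1; apply ln_le_compat; lra).
  assert (Hln : ln (L * R0 / eps) <= Rabs (ln L) + Rabs (ln R0) + Rabs (ln eps)).
  { unfold Rdiv. rewrite !ln_mult, ln_Rinv by
      (try apply Rmult_lt_0_compat; try apply Rinv_0_lt_compat; assumption).
    pose proof (Rle_abs (ln L)). pose proof (Rle_abs (ln R0)).
    pose proof (Rle_abs (- ln eps)) as Hx. rewrite Rabs_Ropp in Hx. lra. }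
  assert (Hk0 : 0 <= ln (L * R0 / eps)) by (rewrite <- ln_1; apply ln_le_compat; lra).
  unfold l, logfactor in *. repeat split.
  - lra.
  - rewrite <- (exp_ln (INR d * (L * R0 / eps))) by nra. apply exp_le_compat.
    rewrite ln_mult by lra.
    assert (ln (INR d) <= ln (2 + INR d)) by (apply ln_le_compat; lra). lra.
  - rewrite <- (exp_ln (L * R0 / eps)) at 1 by lra. apply exp_le_compat. lra.
  - apply Rle_trans with (2 + / nu); [lra|]. rewrite <- (exp_ln (2 + / nu)) at 1 by lra.
    apply exp_le_compat.
    pose proof (Rabs_pos (ln L)). pose proof (Rabs_pos (ln R0)). pose proof (Rabs_pos (ln eps)). lra.
Qed.

Theorem mainTheorem4 :
  exists (C : R) (k : nat), 0 < C /\
  forall (d : nat) (L R0 eps nu : R),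
    0 < L -> 0 < R0 -> 0 < eps -> 0 < nu ->
    exists A : ParAlg d,
      (* depth bound *)
      INR (depth A) <=
        C * Rpower (INR d) (1/3) * Rpower (L * R0 / eps) (2/3)
          * (logfactor d L R0 eps nu) ^ k /\
      (forall (f : Vec d -> R) (g : Vec d -> Vec d) (xstar : Vec d),
         is_gradient f g -> convex f -> lipschitz L f ->
         (forall y, f xstar <= f y) -> norm xstar <= R0 ->
         (* work bound, for every realization of the randomness *)
         (forall s : nat,
            INR (work A s g) <=
              C * Rpower (INR d) (4/3) * Rpower (L * R0 / eps) (8/3)
                * (logfactor d L R0 eps nu) ^ k) /\
         (* success with probability at least 1 - nu *)
         prob_le A (fun s => ~ (f (alg_output A s g) - f xstar <= eps)) nu).
Proof.
  (* The exponent 5 is 2 from the depth plus 3 from the samples per round; the constant exceeds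
     [34112 * 6 * 10^12]. *)
  exists 1000000000000000000, 5%nat. split; [lra|].
  intros d L R0 eps nu HL HR Heps Hnu.
  set (kap := L * R0 / eps).
  assert (Hkap0 : 0 < kap) by (apply Rdiv_lt_0_compat; nra).
  assert (Hkeps : kap * eps = L * R0) by (unfold kap; field; lra).
  (* In dimension zero, or if [L * R0 <= eps], the origin is already accurate enough. *)
  destruct (classic (d = 0%nat \/ kap <= 1)) as [Htriv|Hmain].
  - destruct (trivial_algorithm_exists d (mkv d (fun _ => 0))) as (A & HA & Hwork & Hout).
    assert (Hpos : forall a b, 0 <= 1000000000000000000 * Rpower (INR d) a * Rpower kap b
        * logfactor d L R0 eps nu ^ 5).
    { intros a b. pose proof (Rpower_pos (INR d) a). pose proof (Rpower_pos kap b).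
      apply Rmult_le_pos; [mult_le_pos; lra|]. apply pow_le. unfold logfactor.
      assert (0 < / nu) by now apply Rinv_0_lt_compat. pose proof (pos_INR d).
      assert (0 <= ln (2 + INR d)) by (rewrite <- ln_1; apply ln_le_compat; lra).
      assert (0 <= ln (2 + / nu)) by (rewrite <- ln_1; apply ln_le_compat; lra).
      pose proof (Rabs_pos (ln L)). pose proof (Rabs_pos (ln R0)). pose proof (Rabs_pos (ln eps)).
      lra. }
    exists A. rewrite HA. split; [apply Hpos|].
    intros f g xs _ _ Hlip _ Hxs. split; [intros s; rewrite Hwork; apply Hpos|].
    intros l _ Hbad. destruct l as [|s l]; [simpl; lra|]. exfalso.
    apply (Hbad s); [now left|]. rewrite Hout. set (o := mkv d (fun _ => 0)).
    pose proof (Hlip o xs) as H. pose proof (Rle_abs (f o - f xs)).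
    replace (vsub o xs) with (vscale (-1) xs) in H.
    2:{ apply vec_ext. intros i Hi. unfold o. rewrite vget_sub, vget_scale, vget_mkv by assumption. ring. }
    rewrite norm_scale, (Rabs_left (-1)) in H by lra.
    destruct Htriv as [Hz|Hz].
    + rewrite (norm_dim0 xs Hz) in H. lra.
    + assert (L * norm xs <= L * R0) by (apply Rmult_le_compat_l; lra). nra.
  - apply not_or_and in Hmain. destruct Hmain as [Hd0 Hk1].
    assert (Hd : (0 < d)%nat) by lia. apply Rnot_le_lt in Hk1.
    assert (HdR : 1 <= INR d) by (apply (le_INR 1); lia).
    destruct (logfactor_ge d L R0 eps nu Hd HL HR Heps Hnu) as (Hl2 & Hdk & Hk & Hnuexp);
      [fold kap; lra|]. fold kap in Hdk, Hk.
    set (l := logfactor d L R0 eps nu) in *.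
    assert (Hlexp : l <= exp l) by (pose proof (exp_ineq1_le l); lra).
    set (sd := sqrt (INR d)).
    assert (Hsd : sd * sd = INR d) by (apply sqrt_sqrt; lra).
    assert (Hsd1 : 1 <= sd) by (rewrite <- sqrt_1; apply sqrt_le_1_alt; assumption).
    assert (Hsdd : sd <= INR d) by (rewrite <- Hsd; nra).
    (* Makes the smoothing error [2 L sigma sd] equal to [eps / 16]. *)
    set (sigma := eps / (32 * L * sd)).
    assert (HLsd : 0 < 32 * L * sd) by nra.
    assert (Hsigma0 : 0 < sigma) by (apply Rdiv_lt_0_compat; assumption).
    (* The bias [exp (- m / 2)] must not exceed [delta / L = 1 / (4000 kap l)]. *)
    destruct (nat_ceil (24 * l)) as (m & Hm1 & Hm2); [lra|].
    set (mu := sqrt (INR m + 1)).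
    assert (Hmu : mu * mu = INR m + 1) by (apply sqrt_sqrt; lra).
    assert (Hmu1 : 1 <= mu) by (rewrite <- sqrt_1; apply sqrt_le_1_alt; lra).
    assert (Hmul : mu <= 26 * l) by nra.
    set (r := sigma / mu).
    assert (Hr0 : 0 < r) by (apply Rdiv_lt_0_compat; lra).
    set (ratio := R0 / r).
    assert (Hratio : ratio = 32 * kap * sd * mu).
    { unfold ratio, r, sigma, kap. field. repeat split; lra. }
    assert (Hks : 1 <= kap * sd) by nra.
    assert (Hratio1 : 1 <= ratio) by (rewrite Hratio; nra).
    assert (HrR : r * ratio = R0) by (unfold ratio; field; lra).
    (* [X] becomes the parameter [s]: it balances [(R0 / r)^2 / s^2] against [s] in the step
       count. *)
    set (X := Rpower ratio (2 / 3)).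
    assert (HX1 : 1 <= X).
    { unfold X. rewrite <- (Rpower_O ratio) by lra. apply Rle_Rpower; lra. }
    assert (HXr : X <= ratio) by (apply Rpower_le_self; lra).
    assert (HX3 : X * X * X = ratio * ratio).
    { unfold X. rewrite <- !Rpower_plus. replace (2 / 3 + 2 / 3 + 2 / 3) with (INR 2) by (simpl; field).
      rewrite Rpower_pow by lra. simpl. ring. }
    set (D := Rpower (INR d) (1/3) * Rpower kap (2/3)).
    assert (HXD : X <= 832 * l * D).
    { unfold X. rewrite Hratio.
      replace (32 * kap * sd * mu) with ((32 * mu) * (kap * sd)) by ring.
      rewrite <- (Rpower_mult_distr (32 * mu) (kap * sd)) by nra.
      rewrite <- (Rpower_mult_distr kap sd) by lra.
      assert (H1 : Rpower (32 * mu) (2/3) <= 832 * l).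
      { eapply Rle_trans; [apply Rpower_le_self; lra|]. lra. }
      assert (H2 : Rpower sd (2/3) = Rpower (INR d) (1/3)).
      { unfold sd. rewrite <- Rpower_sqrt, Rpower_mult by lra. f_equal. field. }
      rewrite H2. unfold D. rewrite (Rmult_comm (Rpower kap (2/3))).
      apply Rmult_le_compat_r; [|assumption]. apply Rmult_le_pos; left; apply Rpower_pos. }
    assert (HD0 : 0 < D) by (apply Rmult_lt_0_compat; apply Rpower_pos).
    assert (HXl : 2 <= X * l) by nra.
    (* The count asks for [32 X <= 16 X l], at most [20 X l] for the logarithm of [8 kap], and
       [3 + 3/2 X]. *)
    destruct (nat_ceil (40 * (X * l))) as (T & HT1 & HT2); [lra|].
    assert (HT3 : INR T <= 41 * (X * l)) by lra.
    (* Since [X * r <= R0], the total drift is at most [5 * delta * 43 l R0 = eps * 215 / 4000],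
       below [eps / 16]. *)
    set (delta := eps / (4000 * l * R0)).
    assert (HlR : 0 < 4000 * l * R0) by nra.
    assert (Hdelta0 : 0 < delta) by (apply Rdiv_lt_0_compat; assumption).
    assert (HLdelta : L = 4000 * kap * l * delta).
    { unfold kap, delta. field. repeat split; lra. }
    assert (Hkl : 1 <= kap * l) by nra.
    assert (HdeltaL : delta <= L) by (rewrite HLdelta; nra).
    assert (Hdk1 : 1 <= INR d * kap) by nra.
    assert (Hll : 4 <= l * l) by nra.
    (* [2188000 = 4000 * 547]: [L / delta = 4000 kap l], and [21 mu + 2 <= 547 l] because
       [mu <= 26 l]. *)
    destruct (nat_ceil (2188000 * (INR d * kap) * (l * l))) as (n & Hn1 & Hn2); [mult_le_pos; lra|].
    assert (Hdkl : 4 <= (INR d * kap) * (l * l)) by (apply le_mult_l; lra).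
    assert (Hn0 : 0 < INR n) by lra.
    assert (Hn : (0 < n)%nat) by now apply INR_lt.
    set (eta := sigma / INR n).
    assert (Heta : 0 < eta) by (apply Rdiv_lt_0_compat; lra).
    assert (Hetan : eta * INR n = sigma) by (unfold eta; field; lra).
    assert (Hetar : eta / r = mu / INR n) by (unfold eta, r; field; lra).
    assert (Hmun : mu <= INR n).
    { apply Rle_trans with (26 * l); [assumption|].
      assert (l * l <= (INR d * kap) * (l * l)) by (apply le_mult_l; lra).
      assert (2 * l <= l * l) by (apply Rmult_le_compat_r; lra). lra. }
    (* The constant is [30 * 144 * 4000^2 * 81], with [exp 4 <= 81]. The exponent [30 d l] pays
       [18 d l] for the union over points and directions, [11 l] for the rounds and [l] for [nu]. *)
    destruct (nat_ceil (5598720000000 * (INR d * (kap * kap)) * (l * l * l))) as (N & HN1 & HN2).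
    { mult_le_pos; lra. }
    assert (Hkk : 1 <= INR d * (kap * kap)) by (apply le_mult_l; [lra|]; split; [lra|]; apply le_mult_l; lra).
    assert (Hlll : 8 <= l * l * l) by nra.
    assert (Hdkkl : 8 <= INR d * (kap * kap) * (l * l * l)) by (apply le_mult_l; lra).
    assert (HN : (0 < N)%nat) by (apply INR_lt; simpl; lra).
    assert (HT : (0 < T)%nat) by (apply INR_lt; simpl; lra).
    exists (algorithm d n m N T L R0 eta r delta (4 * (R0 * R0) / eps)).
    assert (HTD : INR T <= 34112 * (l * l) * D).
    { eapply Rle_trans; [exact HT3|].
      assert (X * l <= 832 * l * D * l) by (apply Rmult_le_compat_r; lra). lra. }
    assert (Hl1 : l * l <= l ^ 5).
    { replace (l ^ 5) with (l * l * (l * l * l)) by ring.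
      rewrite (Rmult_comm (l * l)). apply le_mult_l; lra. }
    split; [|intros f g xs Hgrad Hconv Hlip Hmin Hxs; split].
    + cbn [depth algorithm].
      replace (1000000000000000000 * Rpower (INR d) (1 / 3) * Rpower kap (2 / 3) * l ^ 5)
        with (1000000000000000000 * (l ^ 5 * D)) by (unfold D; ring).
      assert (l * l * D <= l ^ 5 * D) by (apply Rmult_le_compat_r; lra).
      assert (0 <= l * l * D) by (apply Rmult_le_pos; lra). lra.
    + intros s. eapply Rle_trans; [apply le_INR, algorithm_work|]. rewrite mult_INR.
      assert (HN3 : INR N <= 6000000000000 * (INR d * (kap * kap)) * (l * l * l)) by lra.
      assert (Hd43 : Rpower (INR d) (4/3) = INR d * Rpower (INR d) (1/3)).
      { rewrite <- (Rpower_1 (INR d)) at 2 by lra. rewrite <- Rpower_plus. f_equal. field. }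
      assert (Hk83 : Rpower kap (8/3) = kap * kap * Rpower kap (2/3)).
      { replace (kap * kap) with (Rpower kap 2).
        - rewrite <- Rpower_plus. f_equal. field.
        - replace 2 with (INR 2) by (simpl; lra). rewrite Rpower_pow by lra. simpl. ring. }
      rewrite Hd43, Hk83.
      apply Rle_trans with (34112 * (l * l) * D * (6000000000000 * (INR d * (kap * kap)) * (l * l * l))).
      * apply Rmult_le_compat; try assumption; apply pos_INR.
      * replace (34112 * (l * l) * D * (6000000000000 * (INR d * (kap * kap)) * (l * l * l)))
          with (204672000000000000 * (INR d * Rpower (INR d) (1 / 3) * (kap * kap * Rpower kap (2 / 3)) * l ^ 5))
          by (unfold D; ring).
        assert (0 <= INR d * Rpower (INR d) (1 / 3) * (kap * kap * Rpower kap (2 / 3)) * l ^ 5).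
        { pose proof (Rpower_pos (INR d) (1/3)). pose proof (Rpower_pos kap (2/3)).
          mult_le_pos; lra. }
        lra.
    + apply (algorithm_correct d n m N T L R0 eta r delta (4 * (R0 * R0) / eps) f g xs eps nu X);
        try assumption; try (split; assumption); try lra.
      * unfold kap in Hk1. apply Rmult_lt_reg_r with (/ eps); [now apply Rinv_0_lt_compat|].
        rewrite Rinv_r by lra. exact Hk1.
      * split; [assumption|]. rewrite <- HrR, Rmult_comm. apply le_mult_l; lra.
      * apply Rmult_le_reg_r with (/ r); [now apply Rinv_0_lt_compat|].
        rewrite Rinv_r by lra. change (eta * / r) with (eta / r). rewrite Hetar.
        apply Rmult_le_reg_r with (INR n); [assumption|]. unfold Rdiv.
        rewrite Rmult_assoc, Rinv_l by lra. lra.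
      * unfold r. rewrite <- Hmu.
        replace (eta * eta * (INR n * INR n)) with ((eta * INR n) * (eta * INR n)) by ring.
        rewrite Hetan. field. lra.
      * assert (H1 : 4000 * kap * l <= exp (INR m / 2)).
        { pose proof (pow2_le_exp 12) as H2. replace (INR 12) with 12 in H2 by (simpl; lra).
          assert (H3 : 2 ^ 12 * (exp l * exp l) <= exp (INR m / 2)).
          { apply Rle_trans with (exp 12 * (exp l * exp l)).
            - apply Rmult_le_compat_r; [|assumption].
              mult_le_pos; lra.
            - rewrite <- !exp_plus. apply exp_le_compat. lra. }
          eapply Rle_trans; [|exact H3].
          assert (kap <= exp l) by (eapply Rle_trans; [exact Hk|apply exp_le_compat; lra]).
          assert (kap * l <= exp l * exp l) by (apply Rmult_le_compat; lra).
          simpl. lra. }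
        rewrite exp_Ropp. pose proof (exp_pos (INR m / 2)).
        apply Rmult_le_reg_r with (exp (INR m / 2)); [assumption|].
        rewrite Rmult_assoc, Rinv_l, Rmult_1_r by lra.
        rewrite HLdelta at 1. rewrite Rmult_comm. apply Rmult_le_compat_l; lra.
      * fold sd. replace (21 * L * eta / r) with (21 * L * (eta / r)) by (unfold Rdiv; ring).
        rewrite Hetar.
        replace (sd * (21 * L * (mu / INR n) + 2 * L / INR n))
          with (delta * (4000 * kap * l * sd * (21 * mu + 2) / INR n)).
        2:{ rewrite HLdelta at 1 2. field. lra. }
        rewrite <- (Rmult_1_r delta) at 2. apply Rmult_le_compat_l; [lra|].
        apply Rmult_le_reg_r with (INR n); [assumption|]. unfold Rdiv.
        rewrite Rmult_assoc, Rinv_l, Rmult_1_r, Rmult_1_l by lra.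
        eapply Rle_trans; [|exact Hn1].
        replace (2188000 * (INR d * kap) * (l * l)) with (4000 * kap * l * INR d * (547 * l)) by ring.
        apply Rmult_le_compat.
        -- mult_le_pos; lra.
        -- lra.
        -- apply Rmult_le_compat_l; [mult_le_pos; lra|assumption].
        -- lra.
      * fold sd. rewrite Hetan. right. unfold sigma. field. lra.
      * assert (HTr : INR T * r <= 41 * l * R0).
        { apply Rle_trans with (41 * (X * l) * r); [apply Rmult_le_compat_r; lra|].
          rewrite <- HrR.
          assert (X * (l * r) <= ratio * (l * r)) by (apply Rmult_le_compat_r; [mult_le_pos; lra|lra]).
          lra. }
        apply Rle_trans with (5 * delta * (43 * (l * R0))).
        -- apply Rmult_le_compat_l; [lra|].
           assert (2 * R0 <= l * R0) by (apply Rmult_le_compat_r; lra). lra.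
        -- unfold delta. apply Rle_trans with (eps * (215 / 4000)); [right; field; lra|]. lra.
      * replace (32 * (R0 * R0) / (X * X * (r * r))) with (32 * X).
        2:{ rewrite <- HrR. replace (r * ratio * (r * ratio)) with (r * r * (ratio * ratio)) by ring.
            rewrite <- HX3. field. lra. }
        replace (4 * (R0 * R0) / eps * (2 * L / R0)) with (8 * kap) by (unfold kap; field; lra).
        assert (H8 : ln (8 * kap) <= 2 * l).
        { pose proof (pow2_le_exp 3) as H2. replace (INR 3) with 3 in H2 by (simpl; lra). simpl in H2.
          assert (8 * kap <= exp (2 * l)).
          { apply Rle_trans with (exp 3 * exp (l - 1)).
            - apply Rmult_le_compat; lra.
            - rewrite <- exp_plus. apply exp_le_compat. lra. }
          rewrite <- (ln_exp (2 * l)). apply ln_le_compat; lra. }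
        assert (H3r : ln (3 * R0 / r) <= 2 + 3 / 2 * X).
        { replace (3 * R0 / r) with (3 * ratio) by (unfold ratio; field; lra).
          rewrite ln_mult by lra. pose proof (ln_le_sub1 3 ltac:(lra)).
          assert (ln X = 2 / 3 * ln ratio) by (unfold X, Rpower; apply ln_exp).
          pose proof (ln_le_sub1 X ltac:(lra)). lra. }
        assert ((8 * X + 2) * ln (8 * kap) <= (10 * X) * (2 * l)).
        { apply Rmult_le_compat; try lra. rewrite <- ln_1. apply ln_le_compat; lra. }
        assert (X * 2 <= X * l) by (apply Rmult_le_compat_l; lra). lra.
      * assert (Hbox1 : INR (2 * (n + 1) + 1) <= exp (15 * l)).
        { rewrite !plus_INR, mult_INR, plus_INR. simpl INR.
          pose proof (pow2_le_exp 23) as H2. replace (INR 23) with 23 in H2 by (simpl; lra).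
          apply Rle_trans with (exp 23 * (exp l * (exp l * exp l))).
          - apply Rle_trans with (2 ^ 23 * ((INR d * kap) * (l * l))); [simpl; lra|].
            apply Rmult_le_compat; [simpl; lra|mult_le_pos; lra|assumption|].
            apply Rmult_le_compat; try lra. apply Rmult_le_compat; lra.
          - rewrite <- !exp_plus. apply exp_le_compat. lra. }
        assert (Hbox2 : INR (2 * (2 * d + 1) + 1) <= exp (3 * l)).
        { rewrite !plus_INR, mult_INR, plus_INR, mult_INR. simpl INR.
          pose proof (pow2_le_exp 3) as H2. replace (INR 3) with 3 in H2 by (simpl; lra). simpl in H2.
          apply Rle_trans with (exp 3 * exp l).
          - apply Rle_trans with (8 * INR d); [lra|]. apply Rmult_le_compat; try lra.
            apply Rle_trans with (INR d * kap); [|assumption].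
            rewrite Rmult_comm. apply le_mult_l; lra.
          - rewrite <- exp_plus. apply exp_le_compat. lra. }
        assert (HTexp : INR T <= exp (11 * l)).
        { pose proof (pow2_le_exp 16) as H2. replace (INR 16) with 16 in H2 by (simpl; lra).
          apply Rle_trans with (exp 16 * (exp l * (exp l * exp l))).
          - apply Rle_trans with (2 ^ 16 * ((INR d * kap) * (l * l))).
            + eapply Rle_trans; [exact HT3|].
              assert (X <= 832 * l * (INR d * kap)).
              { eapply Rle_trans; [exact HXr|]. rewrite Hratio.
                replace (32 * kap * sd * mu) with (32 * kap * (sd * mu)) by ring.
                replace (832 * l * (INR d * kap)) with (32 * kap * (INR d * (26 * l))) by ring.
                apply Rmult_le_compat_l; [lra|]. apply Rmult_le_compat; lra. }
              assert (X * l <= 832 * l * (INR d * kap) * l) by (apply Rmult_le_compat_r; lra).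
              simpl. lra.
            + apply Rmult_le_compat; [simpl; lra|mult_le_pos; lra|assumption|].
              apply Rmult_le_compat; try lra. apply Rmult_le_compat; lra.
          - rewrite <- !exp_plus. apply exp_le_compat. lra. }
        rewrite length_prod, !zbox_length, mult_INR, !pow_INR.
        assert (Hboxes : INR (2 * (n + 1) + 1) ^ d * INR (2 * (2 * d + 1) + 1) ^ d
                  <= exp (18 * (INR d * l))).
        { replace (18 * (INR d * l)) with (INR d * (15 * l) + INR d * (3 * l)) by ring.
          rewrite exp_plus, !exp_INR_mult.
          apply Rmult_le_compat; try (apply pow_le, pos_INR);
            apply pow_incr; (split; [apply pos_INR|assumption]). }
        assert (Htail : exp (- (INR N * (delta * delta / (144 * (L * L * (exp 2 * exp 2))))))
                  <= exp (- (30 * (INR d * l)))).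
        { apply exp_le_compat, Ropp_le_contravar.
          assert (He4 : exp 2 * exp 2 <= 81).
          { replace (exp 2 * exp 2) with ((exp 1 * exp 1) * (exp 1 * exp 1))
              by (rewrite <- !exp_plus; f_equal; lra).
            pose proof exp_le_3. pose proof (exp_pos 1).
            assert (exp 1 * exp 1 <= 3 * 3) by (apply Rmult_le_compat; lra).
          replace 81 with ((3 * 3) * (3 * 3)) by ring.
          apply Rmult_le_compat; mult_le_pos; lra. }
          pose proof (exp_pos 2).
          assert (HLL : L * L = 16000000 * (kap * kap) * (l * l) * (delta * delta))
            by (rewrite HLdelta at 1 2; ring).
          rewrite HLL.
          replace (delta * delta / (144 * (16000000 * (kap * kap) * (l * l) * (delta * delta) * (exp 2 * exp 2))))
            with (/ (144 * 16000000 * (kap * kap) * (l * l) * (exp 2 * exp 2)))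
            by (field; repeat split; lra).
          set (e4 := exp 2 * exp 2) in *.
          assert (0 < e4) by (apply Rmult_lt_0_compat; lra).
          assert (Hkkll : 0 < kap * kap * (l * l)) by (assert (0 < kap * kap) by (apply Rmult_lt_0_compat; lra); apply Rmult_lt_0_compat; lra).
          assert (Hc : 0 < 144 * 16000000 * (kap * kap) * (l * l) * e4).
          { replace (144 * 16000000 * (kap * kap) * (l * l) * e4)
              with (2304000000 * (kap * kap * (l * l) * e4)) by ring.
            assert (0 < kap * kap * (l * l) * e4) by (apply Rmult_lt_0_compat; lra). lra. }
          apply Rmult_le_reg_r with (144 * 16000000 * (kap * kap) * (l * l) * e4); [assumption|].
          rewrite (Rmult_assoc (INR N)), Rinv_l, Rmult_1_r by lra.
          eapply Rle_trans; [|exact HN1].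
          replace (30 * (INR d * l) * (144 * 16000000 * (kap * kap) * (l * l) * e4))
            with (69120000000 * (INR d * (kap * kap)) * (l * l * l) * e4) by ring.
          replace (5598720000000 * (INR d * (kap * kap)) * (l * l * l))
            with (69120000000 * (INR d * (kap * kap)) * (l * l * l) * 81) by ring.
          apply Rmult_le_compat_l; [|assumption]. mult_le_pos; lra. }
        apply Rle_trans with (exp (11 * l) * (exp (18 * (INR d * l)) * exp (- (30 * (INR d * l))))).
        -- assert (0 <= INR (2 * (n + 1) + 1) ^ d * INR (2 * (2 * d + 1) + 1) ^ d)
             by (apply Rmult_le_pos; apply pow_le, pos_INR).
           apply Rmult_le_compat; [apply pos_INR| |assumption|].
           ++ apply Rmult_le_pos; [assumption|left; apply exp_pos].
           ++ apply Rmult_le_compat; try assumption. left; apply exp_pos.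
        -- rewrite <- !exp_plus. apply Rle_trans with (exp (- l)).
           ++ apply exp_le_compat. assert (l <= INR d * l) by (apply le_mult_l; lra). lra.
           ++ rewrite exp_Ropp. rewrite <- (Rinv_inv nu).
              apply Rinv_le_contravar; [now apply Rinv_0_lt_compat|assumption].
Qed.
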